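(* The Finsler metric $F=\frac{(\alpha+\beta)^2}{\alpha}$, where $\alpha$ is a Riemannian metric and $\beta$ is a 1-form with $\|\beta\|_\alpha<1$, is locally projectively flat if and only if $\alpha$ and $\beta$ can be expressed in the form $$\alpha=(1+\bar b^2)\bar\alpha,\qquad\beta=\sqrt{1+\bar b^2}\,\bar\beta,$$ where $\bar\alpha$ is a locally projectively flat Riemannian metric, $\bar\beta$ is a closed 1-form which is conformal with respect to $\bar\alpha$, and $\bar b:=\|\bar\beta\|_{\bar\alpha}$. In this case $F$ can be rewritten as $$F=\frac{\left(\sqrt{1+\bar b^2}\,\bar\alpha+\bar\beta\right)^2}{\bar\alpha}.$$
   Context: A Riemannian metric is written $\alpha=\sqrt{a_{ij}(x)y^iy^j}$ and a 1-form $\beta=b_i(x)y^i$, with $\|\beta\|_\alpha=\sqrt{a^{ij}b_ib_j}$. The function $F=(\alpha+\beta)^2/\alpha$ is a Finsler metric when $\|\beta\|_\alpha<1$. A Finsler metric (in particular a Riemannian one) is locally projectively flat if around every point there is a local coordinate system in which all its geodesics are straight lines (as point sets). A 1-form $\bar\beta=\bar b_iy^i$ is conformal with respect to $\bar\alpha=\sqrt{\bar a_{ij}y^iy^j}$ if $\frac12(\bar b_{i|j}+\bar b_{j|i})=c(x)\bar a_{ij}$ for some scalar function $c(x)$, where $\bar b_{i|j}$ is the covariant derivative with respect to $\bar\alpha$. *)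

(* Defs.v *)
From HB Require Import structures.
From mathcomp Require Import all_boot all_order all_algebra.
From mathcomp Require Import all_classical all_reals all_analysis.

Set Implicit Arguments.
Unset Strict Implicit.
Unset Printing Implicit Defensive.

Import Order.TTheory GRing.Theory Num.Theory.
Import numFieldNormedType.Exports.

Local Open Scope classical_set_scope.
Local Open Scope ring_scope.

(* Coordinates, tangent vectors and components of 1-forms are row vectors. *)

Definition partial (R : realType) (n : nat) (i : 'I_n) (f : 'rV[R]_n -> R)
  : 'rV[R]_n -> R := fun x => 'D_(delta_mx 0 i) f x.

(* C^oo on an open set: every iterated partial derivative is differentiable. *)
Definition smooth_on (R : realType) (n : nat) (U : set 'rV[R]_n)
    (f : 'rV[R]_n -> R) : Prop :=
  forall (s : seq 'I_n) (x : 'rV[R]_n), U x ->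
    differentiable (foldr (@partial R n) f s) x.

(* Smooth manifolds without boundary, of dimension n, given by a maximal      *)
(* atlas, so that the local coordinate systems are exactly its members.       *)
(* [chart_inv] is relevant only on the image of the chart.                    *)
Record chart (R : realType) (n : nat) (M : topologicalType) := Chart {
  chart_dom : set M ;
  chart_fun : M -> 'rV[R]_n ;
  chart_inv : 'rV[R]_n -> M ;
  chart_dom_open : open chart_dom ;
  chart_img_open : open (chart_fun @` chart_dom) ;
  chart_funK : forall p, chart_dom p -> chart_inv (chart_fun p) = p ;
  chart_fun_continuous : {within chart_dom, continuous chart_fun} ;
  chart_inv_continuous :
    {within chart_fun @` chart_dom, continuous chart_inv} }.

Definition chart_img (R : realType) (n : nat) (M : topologicalType)
    (phi : chart R n M) : set 'rV[R]_n :=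
  chart_fun phi @` chart_dom phi.

Definition overlap (R : realType) (n : nat) (M : topologicalType)
    (phi psi : chart R n M) : set 'rV[R]_n :=
  chart_fun phi @` (chart_dom phi `&` chart_dom psi).

Definition transition (R : realType) (n : nat) (M : topologicalType)
    (phi psi : chart R n M) : 'rV[R]_n -> 'rV[R]_n :=
  chart_fun psi \o chart_inv phi.

Definition compatible (R : realType) (n : nat) (M : topologicalType)
    (phi psi : chart R n M) : Prop :=
  forall i : 'I_n,
    smooth_on (overlap phi psi) (fun x => transition phi psi x 0 i) /\
    smooth_on (overlap psi phi) (fun x => transition psi phi x 0 i).

Record manifold (R : realType) (n : nat) := Manifold {
  mcarrier :> topologicalType ;
  mhausdorff : hausdorff_space mcarrier ;
  msecond_countable : @second_countable mcarrier ;
  atlas : set (chart R n mcarrier) ;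
  atlas_cover : forall p, exists2 phi, atlas phi & chart_dom phi p ;
  atlas_compatible : forall phi psi, atlas phi -> atlas psi ->
    compatible phi psi ;
  atlas_maximal : forall phi, (forall psi, atlas psi -> compatible phi psi) ->
    atlas phi }.

(* Tensor fields are given by their components in each chart of the atlas, as *)
(* functions of the coordinates, with the tensorial transformation law. They  *)
(* are irrelevant for charts outside the atlas and points outside the image.  *)
(* Since [u *m 'J f x] is the differential of f at x applied to the row       *)
(* vector u, 'J is the transpose of the usual Jacobian matrix.                *)
Record riemannian_metric (R : realType) (n : nat) (M : manifold R n) :=
  RiemannianMetric {
  metric_comp :> chart R n M -> 'rV[R]_n -> 'M[R]_n ;
  metric_smooth : forall phi, atlas phi -> forall i j,
    smooth_on (chart_img phi) (fun x => metric_comp phi x i j) ;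
  metric_sym : forall phi, atlas phi -> forall x, chart_img phi x ->
    (metric_comp phi x)^T = metric_comp phi x ;
  metric_pos : forall phi, atlas phi -> forall x, chart_img phi x ->
    forall y : 'rV[R]_n, y != 0 -> 0 < (y *m metric_comp phi x *m y^T) 0 0 ;
  metric_tensor : forall phi psi, atlas phi -> atlas psi ->
    forall x, overlap phi psi x ->
    metric_comp phi x =
      'J (transition phi psi) x *m metric_comp psi (transition phi psi x)
        *m ('J (transition phi psi) x)^T }.

Record one_form (R : realType) (n : nat) (M : manifold R n) := OneForm {
  form_comp :> chart R n M -> 'rV[R]_n -> 'rV[R]_n ;
  form_smooth : forall phi, atlas phi -> forall i,
    smooth_on (chart_img phi) (fun x => form_comp phi x 0 i) ;
  form_tensor : forall phi psi, atlas phi -> atlas psi ->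
    forall x, overlap phi psi x ->
    form_comp phi x =
      form_comp psi (transition phi psi x) *m ('J (transition phi psi) x)^T }.

(* alpha = sqrt (a_ij y^i y^j) *)
Definition metric_fun (R : realType) (n : nat) (M : manifold R n)
    (a : riemannian_metric M) (phi : chart R n M) (x y : 'rV[R]_n) : R :=
  Num.sqrt ((y *m a phi x *m y^T) 0 0).

(* beta = b_i y^i *)
Definition form_fun (R : realType) (n : nat) (M : manifold R n)
    (b : one_form M) (phi : chart R n M) (x y : 'rV[R]_n) : R :=
  (b phi x *m y^T) 0 0.

(* sqrt (a^ij b_i b_j) *)
Definition form_norm (R : realType) (n : nat) (M : manifold R n)
    (a : riemannian_metric M) (b : one_form M) (phi : chart R n M)
    (x : 'rV[R]_n) : R :=
  Num.sqrt ((b phi x *m invmx (a phi x) *m (b phi x)^T) 0 0).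

Definition square_metric (R : realType) (n : nat) (M : manifold R n)
    (a : riemannian_metric M) (b : one_form M) (phi : chart R n M)
    (x y : 'rV[R]_n) : R :=
  (metric_fun a phi x y + form_fun b phi x y) ^+ 2 / metric_fun a phi x y.

(* In the next four definitions F x y is the expression of a Finsler metric   *)
(* in a chart whose image is U.                                               *)

(* g_ij = (1/2) [F^2]_{y^i y^j} *)
Definition fundamental_tensor (R : realType) (n : nat)
    (F : 'rV[R]_n -> 'rV[R]_n -> R) (x y : 'rV[R]_n) : 'M[R]_n :=
  \matrix_(i, j) (2^-1 * partial i (partial j (fun z => F x z ^+ 2)) y).

(* G^i = (1/4) g^il ([F^2]_{x^k y^l} y^k - [F^2]_{x^l}) *)
Definition spray (R : realType) (n : nat)
    (F : 'rV[R]_n -> 'rV[R]_n -> R) (x y : 'rV[R]_n) : 'rV[R]_n :=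
  \row_i (4^-1 * \sum_(l < n) invmx (fundamental_tensor F x y) i l *
    (\sum_(k < n)
        partial k (fun u => partial l (fun z => F u z ^+ 2) y) x * y 0 k
     - partial l (fun u => F u y ^+ 2) x)).

(* Regular curves on an open interval J with c'' + 2 G(c, c') = 0. *)
Definition geodesic (R : realType) (n : nat)
    (F : 'rV[R]_n -> 'rV[R]_n -> R) (U : set 'rV[R]_n)
    (J : set R) (c : R -> 'rV[R]_n) : Prop :=
  [/\ open J, is_interval J & forall t, J t ->
    [/\ U (c t), derivable c t 1, derivable (derive1 c) t 1, derive1 c t != 0 &
        derive1n 2 c t + 2 *: spray F (c t) (derive1 c t) = 0]].

Definition geodesics_straight (R : realType) (n : nat)
    (F : 'rV[R]_n -> 'rV[R]_n -> R) (U : set 'rV[R]_n) : Prop :=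
  forall (J : set R) (c : R -> 'rV[R]_n), geodesic F U J c ->
    exists p v : 'rV[R]_n, forall t, J t -> exists s : R, c t = p + s *: v.

Definition locally_projectively_flat (R : realType) (n : nat)
    (M : manifold R n) (F : chart R n M -> 'rV[R]_n -> 'rV[R]_n -> R) : Prop :=
  forall p : M, exists phi : chart R n M,
    [/\ atlas phi, chart_dom phi p &
        geodesics_straight (F phi) (chart_img phi)].

Definition closed_form (R : realType) (n : nat) (M : manifold R n)
    (b : one_form M) : Prop :=
  forall phi, atlas phi -> forall x, chart_img phi x -> forall i j : 'I_n,
    partial j (fun z => b phi z 0 i) x = partial i (fun z => b phi z 0 j) x.

(* The Christoffel symbol Gamma^k_ij of the Levi-Civita connection. *)
Definition christoffel (R : realType) (n : nat) (M : manifold R n)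
    (a : riemannian_metric M) (phi : chart R n M) (x : 'rV[R]_n)
    (k i j : 'I_n) : R :=
  2^-1 * \sum_(l < n) invmx (a phi x) k l *
    (partial i (fun z => a phi z j l) x + partial j (fun z => a phi z i l) x
     - partial l (fun z => a phi z i j) x).

(* b_{i|j} *)
Definition covariant_derivative (R : realType) (n : nat) (M : manifold R n)
    (a : riemannian_metric M) (b : one_form M) (phi : chart R n M)
    (x : 'rV[R]_n) (i j : 'I_n) : R :=
  partial j (fun z => b phi z 0 i) x
  - \sum_(k < n) christoffel a phi x k i j * b phi x 0 k.

Definition conformal_form (R : realType) (n : nat) (M : manifold R n)
    (a : riemannian_metric M) (b : one_form M) : Prop :=
  exists c : M -> R,
    forall phi, atlas phi -> forall x, chart_img phi x -> forall i j : 'I_n,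
    2^-1 * (covariant_derivative a b phi x i j
            + covariant_derivative a b phi x j i)
    = c (chart_inv phi x) * a phi x i j.

Definition square_decomposition (R : realType) (n : nat) (M : manifold R n)
    (a : riemannian_metric M) (b : one_form M)
    (abar : riemannian_metric M) (bbar : one_form M) : Prop :=
  [/\ locally_projectively_flat (metric_fun abar),
      closed_form bbar,
      conformal_form abar bbar,
      forall phi, atlas phi -> forall x, chart_img phi x -> forall y,
        metric_fun a phi x y =
          (1 + form_norm abar bbar phi x ^+ 2) * metric_fun abar phi x y &
      forall phi, atlas phi -> forall x, chart_img phi x -> forall y,
        form_fun b phi x y =
          Num.sqrt (1 + form_norm abar bbar phi x ^+ 2)
            * form_fun bbar phi x y].

(* Main.v *)
Require Import Defs.
From HB Require Import structures.
From mathcomp Require Import all_boot all_order all_algebra.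
From mathcomp Require Import all_classical all_reals all_analysis.
From mathcomp Require Import ring lra.

Set Implicit Arguments.
Unset Strict Implicit.
Unset Printing Implicit Defensive.

Import Order.TTheory GRing.Theory Num.Theory.
Import numFieldNormedType.Exports.

Local Open Scope classical_set_scope.
Local Open Scope ring_scope.

(** The proof is a computation in coordinates, valid in every dimension. It
    rests on three observations.

    - Straight geodesics and Hamel's equations. If all geodesics in a chart are
      straight then the spray is proportional to its direction: through every
      point and in every direction there is a geodesic, by the Cauchy-Lipschitz
      theorem, and its acceleration is parallel to its velocity
      ([straight_spray_parallel]). Conversely, if the spray is proportional to
      the direction then the unit velocity of a geodesic is constant
      ([spray_parallel_straight]). For a square metric the fundamental tensor is
      positive definite because the norm of the 1-form is less than 1
      ([energy_yy_pos]), so the first condition says that the Euler-Lagrange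
      covector of F is zero in every direction ([straight_squareP], [hamelP]).
      A Riemannian metric is the case of the zero 1-form.

    - Solving these equations at a point. Write A for alpha squared, B for the
      squared norm of b, s for the vector dual to b, and G for the spray of
      alpha. The equations are polynomial in the direction y, apart from one
      term, which contains alpha itself and the exterior derivative of b. This
      term is the only one that changes sign relatively to the others when y is
      replaced by - y, so b is closed ([hamel_closed]). Contracting what remains
      with s shows that the quadratic form D = (1 + 2 B) A - 3 b(y) ^ 2 divides a
      product of the covariant derivative of b with quadratic forms prime to D.
      Hence the covariant derivative of b is t D for a scalar t, first where b
      is not zero ([sym_cov_eq_nonzero]) and then everywhere by continuity
      ([hamel_sym_cov]). Then G + t A s is proportional to y ([hamel_spray]).
      These conditions are also sufficient ([hamel_sufficient]).

    - Deforming the metric. Under the conditions above the differential of B is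
      2 t (1 - B) b. It follows that for the metric (1 - B) alpha and the 1-form
      sqrt (1 - B) b the terms in b cancel: the spray of the new metric is
      proportional to y, and the new form is closed and conformal
      ([square_straight_decomposition]). The inverse deformation, by 1 + B
      computed from the new data, leads back from these properties to the
      conditions above ([square_decomposition_hamel]).

    On a manifold, projective flatness provides one good chart around each
    point, whereas being closed and conformal is asserted in all charts. These
    two properties are transported by the tensoriality of the exterior and of
    the covariant derivative ([curl_change], [sym_cov_change]), which uses the
    symmetry of second derivatives ([partialC]). *)

Lemma mx_norm_leP (R : realType) (m n : nat) (x : 'M[R]_(m, n)) (e : R) :
  0 <= e -> (`|x| <= e <-> forall i j, `|x i j| <= e).
Proof.
move=> e0; rewrite [in X in X <-> _]/Num.Def.normr/= mx_normrE; split.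
  by move=> /bigmax_leP[_ h] i j; exact: (h (i, j)).
by move=> h; apply/bigmax_leP; split => // -[i j] _; exact: h.
Qed.

Lemma mx_entry_le_norm (R : realType) (m n : nat) (x : 'M[R]_(m, n)) i j :
  `|x i j| <= `|x|.
Proof. exact: (mx_norm_leP x (normr_ge0 x)).1. Qed.

(** * Existence of solutions of ordinary differential equations *)

Section Primitive.
Context {R : realType}.
Notation mu := (@lebesgue_measure R).

(** Zero for [t <= 0], so that it is a continuous function on the whole line
    with which Picard's iteration for positive times can be run. *)
Definition primitive (f : R -> R) (t : R) : R := \int[mu]_(s in `[0, t]) f s.

Lemma continuous_integrable_itv (f : R -> R) (a b : R) :
  continuous f -> mu.-integrable `[a, b] (EFin \o f).
Proof.
move=> cf; apply: continuous_compact_integrable; first exact: segment_compact.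
by apply: continuous_subspaceT.
Qed.

Lemma primitive_le0 (f : R -> R) (t : R) : t <= 0 -> primitive f t = 0.
Proof.
rewrite /primitive le_eqVlt => /orP[/eqP ->|t0].
  by rewrite set_itv1 Rintegral_set1.
by rewrite set_itv_ge ?Rintegral_set0// bnd_simp -ltNge.
Qed.

Lemma primitive_bound (f : R -> R) (C t u : R) : continuous f ->
  0 <= C -> (forall s, 0 <= s <= u -> `|f s| <= C) -> t <= u ->
  `|primitive f t| <= C * Num.max 0 t.
Proof.
move=> cf C0 fC tu; have [t0|t0] := leP t 0.
  by rewrite primitive_le0// mulr0 normr0.
have It := continuous_integrable_itv 0 t cf.
apply: (le_trans (le_normr_Rintegral _ It)) => //.
have -> : C * t = \int[mu]_(s in `[0, t]) (cst C s).
  rewrite Rintegral_cst//= lebesgue_measure_itv/= lte_fin t0 -EFinB /=.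
  by rewrite subr0.
apply: le_Rintegral => //.
- by apply: (@continuous_integrable_itv (fun x => `|f x|)) => x;
     apply: continuous_comp; [exact: cf|exact: norm_continuous].
- by apply: continuous_integrable_itv => x; exact: cvg_cst.
- move=> s /=; rewrite in_itv /= => /andP[s0 st]; apply: fC.
  by rewrite s0 (le_trans st).
Qed.

Lemma primitiveB (f g : R -> R) (t : R) : continuous f -> continuous g ->
  primitive f t - primitive g t = primitive (fun s => f s - g s) t.
Proof.
move=> cf cg; rewrite /primitive RintegralB//; exact: continuous_integrable_itv.
Qed.

Lemma primitive_is_derive (f : R -> R) (t : R) : continuous f -> 0 < t ->
  is_derive t 1 (primitive f) (f t).
Proof.
move=> cf t0.
have [d e] := @continuous_FTC1_closed R f 0 t (t + 1) (ltr_pwDr ltr01 (lexx t))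
  (continuous_integrable_itv 0 (t + 1) cf) t0 (cf t).
split; first exact: d.
by move: e; rewrite derive1E.
Qed.

Lemma primitive_lipschitz (f : R -> R) (C t u : R) : continuous f ->
  0 <= C -> (forall s, `|f s| <= C) ->
  `|primitive f t - primitive f u| <= C * `|t - u|.
Proof.
move=> cf C0 fC.
wlog tu : t u / u <= t.
  move=> H; have [/H//|/ltW/H] := leP u t.
  by rewrite distrC (distrC u).
have [t0|t0] := leP t 0.
  by rewrite !primitive_le0 ?(le_trans tu)// subr0 normr0 mulr_ge0.
have [u0|u0] := leP u 0.
  rewrite (primitive_le0 _ u0) subr0.
  apply: (le_trans (@primitive_bound f C t t cf C0 _ _)) => //.
  rewrite (max_r (ltW t0)) ler_wpM2l// (le_trans _ (ler_norm _))//.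
  by rewrite lerBrDr gerDl.
have [c _ ->] : exists2 c, c \in `[u, t]%R &
    primitive f t - primitive f u = f c * (t - u).
  apply: MVT_segment => //.
    move=> x; rewrite in_itv/= => /andP[ux _].
    by apply: primitive_is_derive => //; exact: lt_trans ux.
  apply: derivable_within_continuous => x; rewrite in_itv/= => /andP[ux _].
  by have [] := primitive_is_derive cf (lt_le_trans u0 ux).
by rewrite normrM ler_wpM2r.
Qed.

End Primitive.

Lemma lipschitz_continuous (R : realType) (V W : normedModType R) (f : V -> W)
    (C : R) : (forall t u, `|f t - f u| <= C * `|t - u|) -> continuous f.
Proof.
move=> fC x; apply/cvgrPdist_le => e e0.
near=> t; apply: (le_trans (fC _ _)).
have C1 : 0 < `|C| + 1 by rewrite ltr_wpDl.
apply: (@le_trans _ _ ((`|C| + 1) * `|x - t|)).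
  by rewrite ler_wpM2r// (le_trans (ler_norm _))// lerDl.
rewrite -ler_pdivlMl// mulrC; near: t.
apply: cvgr_dist_le; [exact: cvg_id|by rewrite divr_gt0].
Unshelve. all: by end_near. Qed.

Lemma ler_geometric_eps (R : realType) (x y c : R) :
  (forall k, x <= y + c * 2^-1 ^+ k) -> x <= y.
Proof.
move=> h; rewrite leNgt; apply/negP => yx.
have c0 : 0 < c.
  rewrite ltNge; apply/negP => c0; have := h 0; rewrite expr0 mulr1 leNgt.
  by rewrite (le_lt_trans _ yx)// gerDl.
have cvg0 : (fun k => c * (2^-1 : R) ^+ k) @ \oo --> (0 : R).
  rewrite -(mulr0 c); apply: cvgM; first exact: cvg_cst.
  by apply: cvg_expr; rewrite ger0_norm ?invf_lt1 ?invr_ge0// ltr1n.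
have xy0 : 0 < x - y by rewrite subr_gt0.
have /cvgrPdist_lt /(_ _ xy0) [N _ /(_ N (leqnn _))] := cvg0.
rewrite /= sub0r normrN ger0_norm ?mulr_ge0 ?exprn_ge0 ?invr_ge0// ?ltW//.
by rewrite ltrBrDr ltNge addrC h.
Qed.

(** Nested intervals: the bounds [u k -+ 2 c / 2 ^ k] are monotone, so the
    limit is a supremum. *)
Lemma geometric_limit (R : realType) (u : nat -> R) (c : R) :
  (forall k, `|u k.+1 - u k| <= c * 2^-1 ^+ k) ->
  exists l, forall k, `|u k - l| <= 2 * c * 2^-1 ^+ k.
Proof.
move=> uc; pose e k := 2 * c * (2^-1 : R) ^+ k.
have eS k : e k.+1 = e k - c * 2^-1 ^+ k by rewrite /e exprS; lra.
have low : {homo (fun k => u k - e k) : k l / (k <= l)%N >-> k <= l}.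
  apply: homo_leq => [//||k]; first exact: le_trans.
  by have := uc k; rewrite ler_norml eS => /andP[h1 h2]; lra.
have upp : {homo (fun k => - (u k + e k)) : k l / (k <= l)%N >-> k <= l}.
  apply: homo_leq => [//||k]; first exact: le_trans.
  by have := uc k; rewrite ler_norml eS => /andP[h1 h2]; lra.
have e_ge0 k : 0 <= e k.
  by have := le_trans (normr_ge0 _) (uc k); rewrite /e -mulrA => ?; lra.
have lu k l : u k - e k <= u l + e l.
  have [kl|/ltnW lk] := leqP k l.
    by have := low _ _ kl; have := e_ge0 l; lra.
  by have := upp _ _ lk; have := e_ge0 k; lra.
exists (sup (range (fun k => u k - e k))) => k.
have ne : has_sup (range (fun k => u k - e k)).
  split; first by exists (u 0%N - e 0%N); exists 0%N.
  by exists (u 0%N + e 0%N) => _ [j _ <-].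
have h1 : u k - e k <= sup (range (fun k => u k - e k)).
  by apply: ub_le_sup; [case: ne|exists k].
have h2 : sup (range (fun k => u k - e k)) <= u k + e k.
  by apply: ge_sup; [case: ne|move=> _ [j _ <-]].
by rewrite ler_norml -/(e k); apply/andP; split; lra.
Qed.

Section Picard.
Context {R : realType} {m : nat}.
Variables (W : 'rV[R]_m -> 'rV[R]_m) (z0 : 'rV[R]_m) (C K d : R).
Hypotheses (C0 : 0 <= C) (K0 : 0 <= K) (d0 : 0 <= d) (Kd : K * d <= 2^-1).
Hypothesis W_bound : forall x, `|W x| <= C.
Hypothesis W_lip : forall x y, `|W x - W y| <= K * `|x - y|.

Let integral_map (z : R -> 'rV[R]_m) : R -> 'rV[R]_m :=
  fun t => z0 + \row_i primitive (fun s => W (z s) 0 i) t.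

Let picard_seq (k : nat) : R -> 'rV[R]_m := iter k integral_map (fun=> z0).

Let W_comp_continuous (z : R -> 'rV[R]_m) i :
  continuous z -> continuous (fun s => W (z s) 0 i).
Proof.
move=> cz s.
apply: (@continuous_comp _ _ _ (W \o z) (fun v : 'rV[R]_m => v 0 i)).
  by apply: continuous_comp; [exact: cz|exact: lipschitz_continuous W_lip _].
exact: coord_continuous.
Qed.

Let integral_map_lip z : continuous z ->
  forall t u, `|integral_map z t - integral_map z u| <= C * `|t - u|.
Proof.
move=> cz t u; apply/mx_norm_leP => [|i j]; first by rewrite mulr_ge0.
rewrite /integral_map !mxE opprD addrACA subrr add0r.
apply: primitive_lipschitz => //.
  exact: W_comp_continuous.
by move=> s; apply: le_trans (mx_entry_le_norm _ _ _) (W_bound _).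
Qed.

Let picard_seq_lip k t u : `|picard_seq k t - picard_seq k u| <= C * `|t - u|.
Proof.
elim: k t u => [|k IH] t u; first by rewrite /= subrr normr0 mulr_ge0.
by apply: integral_map_lip; exact: lipschitz_continuous IH.
Qed.

Let integral_map_contraction (z w : R -> 'rV[R]_m) (e t : R) :
  continuous z -> continuous w -> 0 <= e ->
  (forall s, s <= d -> `|z s - w s| <= e) -> t <= d ->
  `|integral_map z t - integral_map w t| <= e * 2^-1.
Proof.
move=> cz cw e0 zw td.
apply/mx_norm_leP => [|i j]; first by rewrite mulr_ge0 ?invr_ge0.
rewrite /integral_map !mxE opprD addrACA subrr add0r.
rewrite primitiveB; [|exact: W_comp_continuous..].
have Ke : 0 <= K * e by rewrite mulr_ge0.
have := @primitive_bound _ (fun s => W (z s) 0 j - W (w s) 0 j) (K * e) t t.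
move=> /(_ _ Ke _ (lexx _)) /le_trans-> //.
- move=> s; apply: (@continuousB _ R^o R (fun s => W (z s) 0 j)
    (fun s => W (w s) 0 j)); exact: W_comp_continuous.
- move=> s /andP[_ st]; have := mx_entry_le_norm (W (z s) - W (w s)) 0 j.
  rewrite !mxE => /le_trans-> //; apply: (le_trans (W_lip _ _)).
  by rewrite ler_wpM2l// zw// (le_trans st).
- have : Num.max 0 t <= d by rewrite ge_max d0.
  move=> /(ler_wpM2l Ke) /le_trans-> //.
  by rewrite mulrAC mulrC ler_wpM2l.
Qed.

Let picard_seq_step k t : t <= d ->
  `|picard_seq k.+1 t - picard_seq k t| <= C * d * 2^-1 ^+ k.
Proof.
have Cd : 0 <= C * d by rewrite mulr_ge0.
elim: k t => [|k IH] t td.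
  rewrite expr0 mulr1; apply/mx_norm_leP => // i j.
  rewrite !mxE addrAC subrr add0r.
  have := @primitive_bound _ (fun s => W z0 0 j) C t t.
  move=> /(_ _ C0 _ (lexx _)) /le_trans-> //.
  - by move=> s; exact: cvg_cst.
  - by move=> s _; apply: le_trans (mx_entry_le_norm _ _ _) (W_bound _).
  - by rewrite ler_wpM2l// ge_max d0.
rewrite exprSr mulrA; apply: integral_map_contraction => //.
- exact: lipschitz_continuous (@picard_seq_lip k.+1).
- exact: lipschitz_continuous (@picard_seq_lip k).
- by rewrite mulr_ge0 ?exprn_ge0 ?invr_ge0.
Qed.

(** The iterates converge geometrically on the half-line below [d], because
    [K * d <= 1 / 2]; beyond [d] the solution is extended by a constant. *)
Lemma picard_solution : exists z : R -> 'rV[R]_m,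
  [/\ z 0 = z0, forall t u, `|z t - z u| <= C * `|t - u| &
      forall t, 0 < t < d -> forall i,
        is_derive t 1 (fun s => z s 0 i) (W (z t) 0 i)].
Proof.
have Cd : 0 <= C * d by rewrite mulr_ge0.
have lim_ex t : exists l : 'rV[R]_m, forall k,
    `|picard_seq k (Num.min t d) - l| <= 2 * (C * d) * 2^-1 ^+ k.
  have td : Num.min t d <= d by rewrite ge_min lexx orbT.
  have h i : exists l, forall k,
      `|picard_seq k (Num.min t d) 0 i - l| <= 2 * (C * d) * 2^-1 ^+ k.
    apply: (@geometric_limit _ (fun k => picard_seq k (Num.min t d) 0 i)).
    move=> k; have := picard_seq_step k td.
    by move/(mx_norm_leP _ _).1; rewrite ?mulr_ge0 ?exprn_ge0 ?invr_ge0// => /(_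
       isT 0 i); rewrite !mxE.
  exists (\row_i sval (cid (h i))) => k.
  apply/mx_norm_leP => [|i j]; first by rewrite ?mulr_ge0 ?exprn_ge0 ?invr_ge0.
  by rewrite !mxE ord1; exact: (svalP (cid (h j))).
have [z zP] := choice lim_ex.
have z_near t k : t <= d -> `|picard_seq k t - z t| <= 2 * (C * d) * 2^-1 ^+ k.
  by move=> td; have := zP t k; rewrite min_l.
have z_lip t u : `|z t - z u| <= C * `|t - u|.
  apply: (@ler_geometric_eps _ _ _ (4 * (C * d))) => k.
  set t' := Num.min t d; set u' := Num.min u d.
  have tu : `|t' - u'| <= `|t - u|.
    rewrite /t' /u'; have [|] := leP t d; have [|] := leP u d => h1 h2 //.
    - by rewrite !ler_norml; apply/andP; split; have := ler_norm (t - u);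
        have := ler_norm (u - t); rewrite (distrC u); lra.
    - by rewrite !ler_norml; apply/andP; split; have := ler_norm (t - u);
        have := ler_norm (u - t); rewrite (distrC u); lra.
    - by rewrite subrr normr0.
  have h := picard_seq_lip k t' u'.
  have ht := zP t k; have hu := zP u k.
  have -> : z t - z u = (picard_seq k t' - picard_seq k u')
      - (picard_seq k t' - z t) + (picard_seq k u' - z u).
    by rewrite opprB [picard_seq k t' - _ + _]addrC !subrKA.
  apply: (le_trans (ler_normD _ _)); have := ler_normB
    (picard_seq k t' - picard_seq k u') (picard_seq k t' - z t).
  have := ler_wpM2l C0 tu; rewrite -/t' -/u' in ht hu *.
  by move: h ht hu; lra.
have cz : continuous z by exact: lipschitz_continuous z_lip.
have z_fix t : t <= d -> z t = integral_map z t.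
  move=> td; apply/eqP; rewrite -subr_eq0 -normr_le0.
  apply: (@ler_geometric_eps _ _ _ (2 * (C * d))) => k; rewrite add0r.
  have -> : z t - integral_map z t = (picard_seq k.+1 t - integral_map z t)
     - (picard_seq k.+1 t - z t) by rewrite opprB [RHS]addrC subrKA.
  apply: (le_trans (ler_normB _ _)).
  have h1 := z_near t k.+1 td.
  have e0 : 0 <= 2 * (C * d) * 2^-1 ^+ k.
    by rewrite ?mulr_ge0 ?exprn_ge0 ?invr_ge0.
  have h2 := integral_map_contraction
    (lipschitz_continuous (@picard_seq_lip k)) cz e0 (fun s => z_near s k) td.
  by rewrite exprS in h1; rewrite -/(picard_seq k.+1) in h2; move: h1 h2; lra.
exists z; split => //.
  by rewrite z_fix//; apply/rowP => i; rewrite !mxE primitive_le0// addr0.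
move=> t /andP[t0 td] i.
have := primitive_is_derive (@W_comp_continuous z i cz) t0.
move=> /(is_deriveD (is_derive_cst (z0 0 i) t 1)); rewrite add0r.
apply: near_eq_is_derive; near=> s.
rewrite (z_fix s) ?mxE//; near: s.
by apply: cvgr_le td; exact: cvg_id.
Unshelve. all: by end_near. Qed.

End Picard.

(** * Calculus along lines *)

Section LineCalculus.
Context {R : realType} {V : normedModType R}.

(** Reduces the directional derivatives to derivatives of functions of one real
    variable, for which the chain rule and the mean value theorem are known. *)
Lemma is_derive_line (f : V -> R) (z v : V) (t df : R) :
  is_derive (z + t *: v) v f df <->
  is_derive t 1 (fun s : R => f (z + s *: v)) df.
Proof.
have E : (fun h : R => h^-1 *: (f (h *: v + (z + t *: v)) - f (z + t *: v)))
    = (fun h : R => h^-1 *: (f (z + (h *: 1 + t) *: v) - f (z + t *: v))).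
  apply/funext => h; congr (_ *: (f _ - _)).
  by rewrite [h *: 1]mulr1 scalerDl addrCA.
split=> -[h1 h2]; split.
- by rewrite /derivable -E.
- by rewrite -h2 /derive -E.
- by rewrite /derivable E.
- by rewrite -h2 /derive E.
Qed.

Lemma is_derive_comp_scalar (f : V -> R) (g : R -> R) (x v : V) (df dg : R) :
  is_derive x v f df -> is_derive (f x) 1 g dg ->
  is_derive x v (g \o f) (dg * df).
Proof.
have x0 : x = x + 0 *: v by rewrite scale0r addr0.
move=> hf hg; rewrite [in X in is_derive X]x0 is_derive_line.
apply: (@is_derive1_comp _ g (fun s => f (x + s *: v))); first by rewrite -x0.
by rewrite -is_derive_line -x0.
Qed.

Lemma is_derive_add (f g : V -> R) (x v : V) (df dg : R) :
  is_derive x v f df -> is_derive x v g dg ->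
  is_derive x v (fun y => f y + g y) (df + dg).
Proof. exact: is_deriveD. Qed.

Lemma is_derive_sub (f g : V -> R) (x v : V) (df dg : R) :
  is_derive x v f df -> is_derive x v g dg ->
  is_derive x v (fun y => f y - g y) (df - dg).
Proof. exact: is_deriveB. Qed.

Lemma is_derive_mul (f g : V -> R) (x v : V) (df dg : R) :
  is_derive x v f df -> is_derive x v g dg ->
  is_derive x v (fun y => f y * g y) (df * g x + f x * dg).
Proof.
move=> hf hg; have := is_deriveM hf hg.
by rewrite /GRing.scale/= addrC (mulrC (g x)).
Qed.

Lemma is_derive_mulr (f : V -> R) (x v : V) (df k : R) :
  is_derive x v f df -> is_derive x v (fun y => f y * k) (df * k).
Proof.
move=> hf; have := is_derive_mul hf (is_derive_cst k x v).
by rewrite mulr0 addr0.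
Qed.

Lemma is_derive_mull (f : V -> R) (x v : V) (df k : R) :
  is_derive x v f df -> is_derive x v (fun y => k * f y) (k * df).
Proof.
move=> hf; have := is_derive_mul (is_derive_cst k x v) hf.
by rewrite mul0r add0r.
Qed.

Lemma is_derive_exp (f : V -> R) (x v : V) (df : R) k :
  is_derive x v f df ->
  is_derive x v (fun y => f y ^+ k) (k%:R * f x ^+ k.-1 * df).
Proof.
move=> hf; have := is_deriveX k hf.
have -> // : f ^+ k = (fun y => f y ^+ k).
by apply/funext => y; rewrite fctE.
Qed.

Lemma is_derive_bigsum (I : finType) (F : I -> V -> R) (x v : V)
    (dF : I -> R) :
  (forall i, is_derive x v (F i) (dF i)) ->
  is_derive x v (fun y => \sum_i F i y) (\sum_i dF i).
Proof.
move=> hF; elim: (index_enum I) => [|i s IH].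
  have -> : (fun y => \sum_(i <- [::]) F i y) = cst 0.
    by apply/funext => y; rewrite big_nil.
  by rewrite big_nil; exact: is_derive_cst.
have -> : (fun y => \sum_(j <- i :: s) F j y) =
    (fun y => F i y + \sum_(j <- s) F j y).
  by apply/funext => y; rewrite big_cons.
by rewrite big_cons; exact: is_derive_add.
Qed.

Lemma is_derive_unique (f : V -> R) (x v : V) (df dg : R) :
  is_derive x v f df -> is_derive x v f dg -> df = dg.
Proof. by move=> [_ <-] [_ <-]. Qed.

Lemma is_derive_inv (f : V -> R) (x v : V) (df : R) : f x != 0 ->
  is_derive x v f df -> is_derive x v (fun y => (f y)^-1) (- df / f x ^+ 2).
Proof.
move=> fx [h1 h2]; split; first exact: derivableV.
by rewrite deriveV// h2 /GRing.scale/= !mulNr mulrC.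
Qed.

Lemma is_derive_sqrt (f : V -> R) (x v : V) (df : R) : 0 < f x ->
  is_derive x v f df ->
  is_derive x v (fun y => Num.sqrt (f y)) (df / (2 * Num.sqrt (f x))).
Proof.
move=> fx hf; have := is_derive_comp_scalar hf (is_derive1_sqrt fx).
by rewrite mulrC.
Qed.

Lemma mean_value_line (f : V -> R) (z v : V) :
  (forall t : R, 0 <= t <= 1 -> differentiable f (z + t *: v)) ->
  exists2 t : R, 0 <= t <= 1 & f (z + v) - f z = 'D_v f (z + t *: v).
Proof.
move=> df.
have h (t : R) : 0 <= t <= 1 ->
    is_derive t 1 (fun s : R => f (z + s *: v)) ('D_v f (z + t *: v)).
  move=> /df d; apply/is_derive_line; apply: derivableP.
  exact: diff_derivable.
have dF (t : R) : t \in `]0, 1[ ->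
    is_derive t 1 (fun s : R => f (z + s *: v)) ('D_v f (z + t *: v)).
  by rewrite in_itv /= => /andP[t0 t1]; apply: h; rewrite !ltW.
have cF : {within `[0, 1], continuous (fun s : R => f (z + s *: v))}.
  by apply: derivable_within_continuous => t; rewrite in_itv /= => /h[].
have [t t01] := MVT_segment ler01 dF cF.
rewrite scale1r scale0r addr0 subr0 mulr1 => e.
by exists t => //; move: t01; rewrite in_itv.
Qed.

End LineCalculus.

Section Partial.
Context {R : realType} {n : nat}.
Implicit Types (f g : 'rV[R]_n -> R) (x v : 'rV[R]_n).

Lemma derive_sum_partial f x v : differentiable f x ->
  'D_v f x = \sum_i v 0 i * partial i f x.
Proof.
move=> df; rewrite deriveE// {1}(row_sum_delta v) linear_sum/=.
by apply: eq_bigr => i _; rewrite linearZ /partial deriveE.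
Qed.

Lemma is_derive_sum_partial f x v : differentiable f x ->
  is_derive x v f (\sum_i v 0 i * partial i f x).
Proof.
move=> df; rewrite -derive_sum_partial//; apply: derivableP.
exact: diff_derivable.
Qed.

Lemma is_derive_partial f x i : differentiable f x ->
  is_derive x (delta_mx 0 i) f (partial i f x).
Proof. by move=> df; apply: derivableP; exact: diff_derivable. Qed.

Lemma near_eq_partial f g x i :
  (\near x, f x = g x) -> partial i f x = partial i g x.
Proof. by move=> fg; exact: near_eq_derive. Qed.

Lemma open_near (U : set 'rV[R]_n) x (P : 'rV[R]_n -> Prop) :
  open U -> U x -> (forall y, U y -> P y) -> \near x, P x.
Proof. by move=> oU Ux UP; near do apply: UP; exact: open_nbhs_nbhs.
Unshelve. all: by end_near. Qed.

End Partial.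

(** * Locally Lipschitz maps *)

Section LocallyLipschitz.
Context {R : realType}.

(** The bound concerns all pairs of points near [x], and thus is stronger than
    a Lipschitz estimate between [x] and nearby points. *)
Definition loclip {V W : normedModType R} (f : V -> W) (x : V) : Prop :=
  exists K e : R, [/\ 0 <= K, 0 < e & forall y z,
    `|y - x| < e -> `|z - x| < e -> `|f y - f z| <= K * `|y - z|].

Section General.
Context {V W X : normedModType R}.
Implicit Types (f g : V -> W) (x : V).

Lemma loclip_global f (K : R) x : 0 <= K ->
  (forall y z, `|f y - f z| <= K * `|y - z|) -> loclip f x.
Proof. by move=> K0 fK; exists K, 1. Qed.

Lemma loclip_cst (w : W) x : loclip (fun=> w) x.
Proof. by apply: (@loclip_global _ 0) => // y z; rewrite subrr normr0 mul0r. Qed.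

Lemma loclip_near_dist f x : loclip f x -> forall r, 0 < r ->
  exists2 e, 0 < e & forall y, `|y - x| < e -> `|f y - f x| < r.
Proof.
move=> [K [e [K0 e0 fK]]] r r0; exists (Num.min e (r / (K + 1))).
  by rewrite lt_min e0 divr_gt0// ltr_wpDl.
move=> y; rewrite lt_min => /andP[ye yr].
apply: (@le_lt_trans _ _ (K * `|y - x|)).
  by apply: fK => //; rewrite subrr normr0.
apply: (@le_lt_trans _ _ ((K + 1) * `|y - x|)).
  by rewrite ler_wpM2r// lerDl.
by rewrite mulrC -ltr_pdivlMr// ltr_wpDl.
Qed.

Lemma loclip_comp f (g : W -> X) x :
  loclip f x -> loclip g (f x) -> loclip (g \o f) x.
Proof.
move=> lf [L [r [L0 r0 gL]]]; have [d d0 fd] := loclip_near_dist lf r0.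
case: lf => K [e [K0 e0 fK]].
exists (L * K), (Num.min e d); split => [||y z]; first exact: mulr_ge0.
  by rewrite lt_min e0.
rewrite !lt_min => /andP[ye yd] /andP[ze zd].
apply: (le_trans (gL _ _ (fd _ yd) (fd _ zd))).
by rewrite -mulrA ler_wpM2l// fK.
Qed.

Lemma loclip_near_eq f g x : loclip f x -> (\near x, f x = g x) -> loclip g x.
Proof.
move=> [K [e [K0 e0 fK]]] /nbhs_ballP[r /= r0 fg].
exists K, (Num.min e r); split => //; first by rewrite lt_min e0.
move=> y z; rewrite !lt_min => /andP[ye yr] /andP[ze zr].
by rewrite -!fg ?fK// -ball_normE /ball_/= distrC.
Qed.

Lemma loclipD f g x : loclip f x -> loclip g x -> loclip (fun y => f y + g y) x.
Proof.
move=> [K [e [K0 e0 fK]]] [L [r [L0 r0 gL]]].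
exists (K + L), (Num.min e r); split => [||y z]; first exact: addr_ge0.
  by rewrite lt_min e0.
rewrite !lt_min => /andP[ye yr] /andP[ze zr].
rewrite opprD addrACA mulrDl (le_trans (ler_normD _ _))// lerD//.
  exact: fK.
exact: gL.
Qed.

Lemma loclip_sum (I : Type) (r : seq I) (P : pred I) (F : I -> V -> W) x :
  (forall i, loclip (F i) x) -> loclip (fun y => \sum_(i <- r | P i) F i y) x.
Proof.
move=> lF; elim: r => [|i r IH].
  by under [X in loclip X]eq_fun do rewrite big_nil; exact: loclip_cst.
under [X in loclip X]eq_fun do rewrite big_cons.
by case: (P i) => //; exact: loclipD.
Qed.

End General.

Section Scalar.
Context {V : normedModType R}.
Implicit Types (f g : V -> R) (x : V).

Lemma loclipM f g x : loclip f x -> loclip g x -> loclip (fun y => f y * g y) x.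
Proof.
move=> lf lg.
have [d1 d10 fd] := loclip_near_dist lf ltr01.
have [d2 d20 gd] := loclip_near_dist lg ltr01.
case: lf lg => K [e [K0 e0 fK]] [L [r [L0 r0 gL]]].
exists ((`|f x| + 1) * L + (`|g x| + 1) * K),
  (Num.min (Num.min e r) (Num.min d1 d2)); split.
- by rewrite addr_ge0// mulr_ge0// addr_ge0.
- by rewrite !lt_min e0 r0 d10.
move=> y z; rewrite !lt_min => /andP[/andP[ye yr] /andP[y1 y2]].
move=> /andP[/andP[ze zr] /andP[z1 z2]].
have -> : f y * g y - f z * g z = f y * (g y - g z) + g z * (f y - f z).
  by ring.
rewrite mulrDl (le_trans (ler_normD _ _))// !normrM -!mulrA lerD//.
  rewrite ler_pM//; last exact: gL.
  have := fd _ y1; have := ler_normD (f y - f x) (f x); rewrite subrK.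
  by move=> h1 h2; apply: (le_trans h1); rewrite addrC lerD2l ltW.
rewrite ler_pM//; last exact: fK.
have := gd _ z2; have := ler_normD (g z - g x) (g x); rewrite subrK.
by move=> h1 h2; apply: (le_trans h1); rewrite addrC lerD2l ltW.
Qed.

Lemma loclipN f x : loclip f x -> loclip (fun y => - f y) x.
Proof.
move=> lf; under eq_fun do rewrite -mulN1r.
by apply: loclipM => //; exact: loclip_cst.
Qed.

Lemma loclip_prod (I : Type) (r : seq I) (P : pred I) (F : I -> V -> R) x :
  (forall i, loclip (F i) x) -> loclip (fun y => \prod_(i <- r | P i) F i y) x.
Proof.
move=> lF; elim: r => [|i r IH].
  by under [X in loclip X]eq_fun do rewrite big_nil; exact: loclip_cst.
under [X in loclip X]eq_fun do rewrite big_cons.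
by case: (P i) => //; exact: loclipM.
Qed.

Lemma loclipX f k x : loclip f x -> loclip (fun y => f y ^+ k) x.
Proof.
move=> lf; elim: k => [|k IH].
  by under eq_fun do rewrite expr0; exact: loclip_cst.
by under eq_fun do rewrite exprS; exact: loclipM.
Qed.

End Scalar.

Lemma loclip_inv (a : R) : a != 0 -> loclip (fun y : R => y^-1) a.
Proof.
move=> a0; have na : 0 < `|a| by rewrite normr_gt0.
exists (4 / `|a| ^+ 2), (`|a| / 2); split=> [||y z ya za].
- by rewrite divr_ge0// exprn_ge0.
- by rewrite divr_gt0.
have low w : `|w - a| < `|a| / 2 -> `|a| / 2 <= `|w|.
  by move=> wa; have := ler_normB w (w - a); rewrite subKr; lra.
have nz w : `|w - a| < `|a| / 2 -> w != 0.
  by move=> /low; rewrite -normr_gt0; apply: lt_le_trans; rewrite divr_gt0.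
have -> : y^-1 - z^-1 = (z - y) * (y^-1 * z^-1).
  by rewrite mulrBl mulrCA divff ?nz// mulr1 mulrA divff ?nz// mul1r.
rewrite normrM distrC mulrC ler_wpM2r// normrM !normfV.
have -> : 4 / `|a| ^+ 2 = (`|a| / 2)^-1 * (`|a| / 2)^-1.
  by field; rewrite gt_eqF.
by rewrite ler_pM ?invr_ge0// lef_pV2 ?posrE ?normr_gt0 ?nz ?divr_gt0//; exact: low.
Qed.

Lemma loclip_sqrt (a : R) : 0 < a -> loclip (@Num.sqrt R) a.
Proof.
move=> a0; exists (Num.sqrt a)^-1, (a / 2); split=> [||y z ya za].
- by rewrite invr_ge0 sqrtr_ge0.
- by rewrite divr_gt0.
have sa : 0 < Num.sqrt a by rewrite sqrtr_gt0.
have low w : `|w - a| < a / 2 -> 0 < w /\ Num.sqrt a / 2 <= Num.sqrt w.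
  move=> wa; have [w1 w2] : a / 4 <= w /\ 0 < w.
    by move: wa; rewrite ltr_norml => /andP[? ?]; split; lra.
  split => //; rewrite -(@ler_pXn2r _ 2) ?nnegrE ?sqrtr_ge0 ?divr_ge0//.
  by rewrite expr_div_n !sqr_sqrtr ?(ltW a0) ?(ltW w2)//; lra.
have [y0 ly] := low _ ya; have [z0 lz] := low _ za.
have yz : y - z = (Num.sqrt y - Num.sqrt z) * (Num.sqrt y + Num.sqrt z).
  by rewrite -subr_sqr !sqr_sqrtr ?(ltW y0) ?(ltW z0).
rewrite mulrC ler_pdivlMr// yz normrM ler_wpM2l//.
by rewrite ger0_norm ?addr_ge0 ?sqrtr_ge0//; lra.
Qed.

Section Differentiable.
Context {n : nat}.

(** The mean value theorem along the segment between two points bounds the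
    increment by the partial derivatives, which are bounded near [x]. *)
Lemma smooth_loclip (U : set 'rV[R]_n) (f : 'rV[R]_n -> R) (x : 'rV[R]_n) :
  open U -> U x -> smooth_on U f -> loclip f x.
Proof.
move=> oU Ux sf.
have bound i : \forall y \near x, `|partial i f y| <= `|partial i f x| + 1.
  have cf : {for x, continuous (partial i f)}.
    by apply: differentiable_continuous; exact: (sf [:: i]).
  have /cvgrPdist_le /(_ 1 ltr01) := cf.
  apply: filterS => y h; rewrite -[partial i f y](subKr (partial i f x)).
  by rewrite (le_trans (ler_normB _ _))// lerD2l.
have near_U : \forall y \near x, U y by exact: open_nbhs_nbhs.
have near_bound : \forall y \near x, forall i,
    `|partial i f y| <= `|partial i f x| + 1.
  exact: (@filter_forall _ _
    (fun i y => `|partial i f y| <= `|partial i f x| + 1) (nbhs x) _ bound).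
have /nbhs_ballP[e /= e0 he] : nbhs x (U `&`
    [set y | forall i, `|partial i f y| <= `|partial i f x| + 1]).
  exact: filterI.
exists (\sum_i (`|partial i f x| + 1)), e; split => //.
  by apply: sumr_ge0 => i _; rewrite addr_ge0.
move=> y z ye ze.
have inb (t : R) : 0 <= t <= 1 -> `|z + t *: (y - z) - x| < e.
  move=> /andP[t0 t1].
  have -> : z + t *: (y - z) - x = (1 - t) *: (z - x) + t *: (y - x).
    rewrite scalerBl scale1r !scalerBr !opprB; apply/rowP => j; rewrite !mxE.
    by ring.
  apply: (le_lt_trans (ler_normD _ _)); rewrite !normrZ.
  rewrite (ger0_norm t0) (@ger0_norm _ (1 - t)) ?subr_ge0//.
  have [t00|t_neq0] := eqVneq t 0; first by rewrite t00 subr0 mul1r mul0r addr0.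
  have tp : 0 < t by rewrite lt_def t_neq0.
  have h1 : t * `|y - x| < t * e by rewrite ltr_pM2l.
  have h2 : (1 - t) * `|z - x| <= (1 - t) * e by rewrite ler_wpM2l ?subr_ge0// ltW.
  by move: h1 h2; lra.
have inU (t : R) : 0 <= t <= 1 -> U (z + t *: (y - z)) /\
    forall i, `|partial i f (z + t *: (y - z))| <= `|partial i f x| + 1.
  by move=> /inb h; apply: he; rewrite -ball_normE /ball_/= distrC.
have [t t01] := @mean_value_line _ _ f z (y - z) (fun t ht => sf [::] _ (inU t ht).1).
rewrite (addrC z) subrK => ->.
rewrite derive_sum_partial; last exact: (sf [::] _ (inU t t01).1).
apply: (le_trans (ler_norm_sum _ _ _)); rewrite mulr_suml; apply: ler_sum => i _.
rewrite normrM mulrC ler_pM//; first exact: (inU t t01).2.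
exact: mx_entry_le_norm.
Qed.

End Differentiable.

End LocallyLipschitz.

(** * The Cauchy-Lipschitz theorem *)

Section CauchyLipschitz.
Context {R : realType}.

Lemma loclip_rV (V : normedModType R) (m : nat) (f : V -> 'rV[R]_m) (x : V) :
  (forall i, loclip (fun y => f y 0 i) x) -> loclip f x.
Proof.
move=> lf; have [K KP] := choice lf; have [e eP] := choice KP.
have K0 i : 0 <= K i by have [] := eP i.
have e0 i : 0 < e i by have [] := eP i.
(* [s^-1] is a positive lower bound of all the radii [e i]. *)
pose s := \sum_i (e i)^-1 + 1.
have es i : s^-1 <= e i.
  rewrite -[e i]invrK lef_pV2 ?posrE ?invr_gt0//; last first.
    by rewrite ltr_wpDl// sumr_ge0// => j _; rewrite invr_ge0 ltW.
  rewrite /s (bigD1 i)//= -addrA lerDl addr_ge0// sumr_ge0// => j _.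
  by rewrite invr_ge0 ltW.
exists (\sum_i K i), s^-1; split => [||y z ye ze].
- exact: sumr_ge0.
- by rewrite invr_gt0 ltr_wpDl// sumr_ge0// => j _; rewrite invr_ge0 ltW.
apply/mx_norm_leP => [|i j]; first by rewrite mulr_ge0// sumr_ge0.
rewrite !mxE ord1; have [_ _ /(_ y z) h] := eP j.
apply: le_trans (h (lt_le_trans ye (es j)) (lt_le_trans ze (es j))) _.
by rewrite ler_wpM2r// (bigD1 j)//= lerDl sumr_ge0.
Qed.

Section Clamp.
Context {m : nat}.
Variables (w0 : 'rV[R]_m) (r : R).

(** The nearest-point projection onto the closed ball for the sup norm: it
    extends a Lipschitz field on that ball to the whole space. *)
Definition clamp (w : 'rV[R]_m) : 'rV[R]_m :=
  \row_i Num.max (w0 0 i - r) (Num.min (w 0 i) (w0 0 i + r)).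

Lemma clamp_lip (v w : 'rV[R]_m) : `|clamp v - clamp w| <= `|v - w|.
Proof.
have mono (a b s t e : R) : 0 <= e -> s - t <= e ->
    Num.max a (Num.min s b) - Num.max a (Num.min t b) <= e.
  move=> e0 ste; rewrite lerBlDl ge_max; apply/andP; split.
    by rewrite -[leLHS]addr0 lerD// le_max lexx.
  have [tb|bt] := leP t b.
    by rewrite ge_min -lerBlDr le_max [_ <= t]lerBlDl -lerBlDr ste orbT.
  by rewrite ge_min -[b in _ || (b <= _)]addr0 lerD ?orbT// le_max lexx orbT.
apply/mx_norm_leP => // i j; rewrite !mxE.
have := mx_entry_le_norm (v - w) 0 j; rewrite !mxE !ler_norml.
move=> /andP[h1 h2]; apply/andP; split; last exact: mono.
by rewrite lerNl opprB; apply: mono => //; rewrite -[leRHS]opprK lerNr opprB.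
Qed.

Lemma clamp_dist (w : 'rV[R]_m) : 0 <= r -> `|clamp w - w0| <= r.
Proof.
move=> r0; apply/mx_norm_leP => // i j; rewrite !mxE ord1 ler_norml.
rewrite lerBrDl le_max lexx/= lerBlDl ge_max ge_min lexx orbT andbT.
by rewrite lerD2l ge0_cp.
Qed.

Lemma clamp_id (w : 'rV[R]_m) : `|w - w0| <= r -> clamp w = w.
Proof.
move=> wr; apply/rowP => i; rewrite mxE.
have := le_trans (mx_entry_le_norm (w - w0) 0 i) wr.
rewrite !mxE ler_norml => /andP[h1 h2].
by rewrite min_l ?max_r//; lra.
Qed.

End Clamp.

(** Picard's iteration is run on the field composed with the projection onto a
    small ball; the solution does not leave this ball in a short time [d], and
    there the two fields agree. *)
Lemma cauchy_lipschitz (m : nat) (V : 'rV[R]_m -> 'rV[R]_m) (w0 : 'rV[R]_m)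
    (r0 : R) : loclip V w0 -> 0 < r0 ->
  exists (d C : R) (z : R -> 'rV[R]_m),
    [/\ 0 < d, 0 <= C, z 0 = w0, forall t u, `|z t - z u| <= C * `|t - u| &
        forall t, 0 < t < d -> `|z t - w0| < r0 /\ forall i,
          is_derive t 1 (fun s => z s 0 i) (V (z t) 0 i)].
Proof.
move=> [K [e [K0 e0 VK]]] r00.
pose r := Num.min e r0 / 2.
have er0 : 0 < Num.min e r0 by rewrite lt_min e0.
have r_gt0 : 0 < r by rewrite divr_gt0.
have re : r < e.
  by have : Num.min e r0 <= e; [rewrite ge_min lexx|rewrite /r; lra].
have rr0 : r < r0.
  by have : Num.min e r0 <= r0; [rewrite ge_min lexx orbT|rewrite /r; lra].
pose W := V \o clamp w0 r; pose C := `|V w0| + K * r.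
have C0 : 0 <= C by rewrite addr_ge0 ?mulr_ge0// ltW.
have clampe w : `|clamp w0 r w - w0| < e.
  by apply: le_lt_trans re; exact/clamp_dist/ltW.
have W_lip x y : `|W x - W y| <= K * `|x - y|.
  apply: (le_trans (VK _ _ (clampe x) (clampe y))).
  by rewrite ler_wpM2l// clamp_lip.
have W_bound x : `|W x| <= C.
  have w00 : `|w0 - w0| < e by rewrite subrr normr0.
  rewrite -[W x](subrK (V w0)) /C addrC (le_trans (ler_normD _ _))//.
  rewrite lerD2l (le_trans (VK _ _ (clampe x) w00))// ler_wpM2l//.
  exact/clamp_dist/ltW.
pose d := Num.min (2^-1 / (K + 1)) (r / (C + 1)).
have d0 : 0 < d by rewrite lt_min !divr_gt0// ltr_wpDl.
have Kd : K * d <= 2^-1.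
  have : d <= 2^-1 / (K + 1) by rewrite ge_min lexx.
  rewrite ler_pdivlMr ?ltr_wpDl// mulrDr mulr1 mulrC.
  by apply: le_trans; rewrite lerDl ltW.
have Cd : C * d <= r.
  have : d <= r / (C + 1) by rewrite ge_min lexx orbT.
  rewrite ler_pdivlMr ?ltr_wpDl// mulrDr mulr1 mulrC.
  by apply: le_trans; rewrite lerDl ltW.
have [z [z0 z_lip z_der]] := picard_solution w0 C0 K0 (ltW d0) Kd W_bound W_lip.
exists d, C, z; split => // t td; have /andP[t0 t1] := td.
have zr : `|z t - w0| <= r.
  rewrite -z0 (le_trans (z_lip _ _))// subr0 ger0_norm ?(ltW t0)//.
  by apply: le_trans Cd; rewrite ler_wpM2l// ltW.
split; first exact: le_lt_trans rr0.
by move=> i; have := z_der t td i; rewrite /W/= clamp_id.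
Qed.

End CauchyLipschitz.

(** * Straight geodesics and sprays proportional to the velocity *)

Section StraightGeodesics.
Context {R : realType} {n : nat}.
Implicit Types (c : R -> 'rV[R]_n) (x y v : 'rV[R]_n).

(** Proportionality of vectors, expressed by the vanishing of minors because
    this is a closed condition. *)
Definition parallel (u v : 'rV[R]_n) : Prop :=
  forall i j, u 0 i * v 0 j = u 0 j * v 0 i.

Lemma parallel_trans (v u w : 'rV[R]_n) : v != 0 ->
  parallel u v -> parallel w v -> parallel u w.
Proof.
move=> /rV0Pn[k vk] uv wv i j.
apply: (mulfI (mulf_neq0 vk vk)).
have -> : v 0 k * v 0 k * (u 0 i * w 0 j) = (u 0 i * v 0 k) * (w 0 j * v 0 k).
  by ring.
rewrite (uv i k) (wv j k).
have -> : v 0 k * v 0 k * (u 0 j * w 0 i) = (u 0 j * v 0 k) * (w 0 i * v 0 k).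
  by ring.
by rewrite (uv j k) (wv i k); ring.
Qed.

Lemma derive0_constant (J : set R) (f : R -> R) : is_interval J ->
  (forall t, J t -> is_derive t 1 f 0) -> forall a b, J a -> J b -> f a = f b.
Proof.
move=> iJ df a b; wlog ab : a b / a <= b.
  by move=> H Ja Jb; have [/H|/ltW/H] := leP a b; [|move=> h; symmetry]; auto.
move=> Ja Jb.
have Jt (t : R) : t \in `[a, b] -> J t.
  by rewrite in_itv/= => ht; apply: iJ Ja Jb _ _.
have d (t : R) : t \in `]a, b[ -> is_derive t 1 f ((fun=> 0) t).
  by move=> tab; apply/df/Jt; exact: subset_itv_oo_cc.
have cf : {within `[a, b], continuous f}.
  by apply: derivable_within_continuous => t /Jt /df[].
have [t _ ] := MVT_segment ab d cf.
by rewrite mul0r => /eqP; rewrite subr_eq0 => /eqP.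
Qed.

Lemma is_derive_coord c (t : R) (i : 'I_n) : derivable c t 1 ->
  is_derive t 1 (fun s => c s 0 i) (derive1 c t 0 i).
Proof.
move=> dc; split; first exact: (derivable_mxP c t 1).1.
by rewrite derive1E derive_mx// mxE.
Qed.

Lemma derive1_rV c (t : R) (v : 'rV[R]_n) :
  (forall i, is_derive t 1 (fun s => c s 0 i) (v 0 i)) ->
  derivable c t 1 /\ derive1 c t = v.
Proof.
move=> h; have dc : derivable c t 1.
  by apply/derivable_mxP => i j; rewrite ord1; have [] := h j.
split=> //; rewrite derive1E derive_mx//; apply/rowP => i; rewrite mxE.
by have [] := h i.
Qed.

(** Differentiating the equations of the line containing the curve. *)
Lemma straight_derive_parallel c c1 c2 (J : set R) (p v : 'rV[R]_n) :
  open J -> (forall t, J t -> exists s : R, c t = p + s *: v) ->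
  (forall t, J t -> forall i, is_derive t 1 (fun s => c s 0 i) (c1 t 0 i)) ->
  (forall t, J t -> forall i, is_derive t 1 (fun s => c1 s 0 i) (c2 t 0 i)) ->
  forall t, J t -> c1 t != 0 -> parallel (c2 t) (c1 t).
Proof.
move=> oJ cline dc dc1 t Jt c1t.
have nJ (s : R) : J s -> \forall u \near s, J u.
  by move=> Js; exact: open_nbhs_nbhs.
have par1 s : J s -> parallel (c1 s) v.
  move=> Js i j.
  have d1 : is_derive s 1 (fun u => c u 0 i * v 0 j - c u 0 j * v 0 i)
      (c1 s 0 i * v 0 j - c1 s 0 j * v 0 i).
    by apply: is_derive_sub; apply: is_derive_mulr; exact: dc.
  have d2 : is_derive s 1 (fun u => c u 0 i * v 0 j - c u 0 j * v 0 i) 0.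
    apply: near_eq_is_derive (is_derive_cst (p 0 i * v 0 j - p 0 j * v 0 i) s 1).
    near=> u; have [a ->] : exists a : R, c u = p + a *: v.
      by apply: cline; near: u; exact: nJ.
    by rewrite !mxE /cst; ring.
  by apply/eqP; rewrite -subr_eq0 (is_derive_unique d1 d2).
have v0 : v != 0.
  apply: contraNneq c1t => v0; apply/eqP/rowP => i; rewrite mxE.
  have [_ <-] := dc t Jt i.
  have [_] : is_derive t 1 (fun u => c u 0 i) 0.
    apply: near_eq_is_derive (is_derive_cst (p 0 i) t 1).
    near=> u; have [a ->] : exists a : R, c u = p + a *: v.
      by apply: cline; near: u; exact: nJ.
    by rewrite v0 scaler0 addr0.
  by [].
apply: (parallel_trans v0); last exact: par1.
move=> i j.
have d1 : is_derive t 1 (fun u => c1 u 0 i * v 0 j - c1 u 0 j * v 0 i)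
    (c2 t 0 i * v 0 j - c2 t 0 j * v 0 i).
  by apply: is_derive_sub; apply: is_derive_mulr; exact: dc1.
have d2 : is_derive t 1 (fun u => c1 u 0 i * v 0 j - c1 u 0 j * v 0 i) 0.
  apply: near_eq_is_derive (is_derive_cst 0 t 1).
  near=> u; rewrite (par1 u _ i j) ?subrr//; near: u; exact: nJ.
by apply/eqP; rewrite -subr_eq0 (is_derive_unique d1 d2).
Unshelve. all: by end_near. Qed.

End StraightGeodesics.

Section StraightSpray.
Context {R : realType} {n : nat}.
Variables (F : 'rV[R]_n -> 'rV[R]_n -> R) (U : set 'rV[R]_n).
Hypothesis oU : open U.

Let lsubmx_lip (u v : 'rV[R]_(n + n)) : `|lsubmx u - lsubmx v| <= 1 * `|u - v|.
Proof.
rewrite mul1r; apply/mx_norm_leP => // i j; rewrite !mxE ord1.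
by have := mx_entry_le_norm (u - v) 0 (lshift n j); rewrite !mxE.
Qed.

Let rsubmx_lip (u v : 'rV[R]_(n + n)) : `|rsubmx u - rsubmx v| <= 1 * `|u - v|.
Proof.
rewrite mul1r; apply/mx_norm_leP => // i j; rewrite !mxE ord1.
by have := mx_entry_le_norm (u - v) 0 (rshift n j); rewrite !mxE.
Qed.

Let loclip_lsub w : loclip (lsubmx : 'rV[R]_(n + n) -> 'rV[R]_n) w.
Proof. exact: loclip_global lsubmx_lip. Qed.

Let loclip_rsub w : loclip (rsubmx : 'rV[R]_(n + n) -> 'rV[R]_n) w.
Proof. exact: loclip_global rsubmx_lip. Qed.

Lemma loclip_coord m (w : 'rV[R]_m) i : loclip (fun v : 'rV[R]_m => v 0 i) w.
Proof.
apply: (@loclip_global _ _ _ _ 1) => // y z; rewrite mul1r.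
by have := mx_entry_le_norm (y - z) 0 i; rewrite !mxE.
Qed.

Lemma loclip_rsub_coord (w : 'rV[R]_(n + n)) j :
  loclip (fun w : 'rV[R]_(n + n) => rsubmx w 0 j) w.
Proof.
exact: (@loclip_comp _ _ _ _ rsubmx (fun v : 'rV[R]_n => v 0 j) _
  (loclip_rsub _) (loclip_coord _ _)).
Qed.

Lemma loclip_lsub_comp (f : 'rV[R]_n -> R) (w : 'rV[R]_(n + n)) :
  loclip f (lsubmx w) -> loclip (fun w : 'rV[R]_(n + n) => f (lsubmx w)) w.
Proof. exact: (@loclip_comp _ _ _ _ lsubmx f _ (loclip_lsub _)). Qed.

(** The spray is seen as a function of one variable, the pair of the point and
    the direction. *)
Definition loclip_spray (x y : 'rV[R]_n) : Prop := forall i,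
  loclip (fun w : 'rV[R]_(n + n) => spray F (lsubmx w) (rsubmx w) 0 i)
    (row_mx x y).

(** The geodesic with initial velocity [y] at [x] exists for small positive
    times; it is straight, so its acceleration is parallel to its velocity, and
    this passes to the limit at time 0. *)
Lemma straight_spray_parallel (x y : 'rV[R]_n) : U x -> y != 0 ->
  loclip_spray x y -> geodesics_straight F U -> parallel (spray F x y) y.
Proof.
move=> Ux y0 lS straight.
pose S (w : 'rV[R]_(n + n)) := spray F (lsubmx w) (rsubmx w).
pose V (w : 'rV[R]_(n + n)) := row_mx (rsubmx w) (- 2 *: S w).
have lV : loclip V (row_mx x y).
  apply: loclip_rV => i; case: (split_ordP i) => j ->.
    under eq_fun do rewrite row_mxEl.
    exact: loclip_rsub_coord.
  under eq_fun do rewrite row_mxEr mxE.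
  by apply: loclipM; [exact: loclip_cst|exact: lS].
have /nbhs_ballP[r1 /= r10 ballU] : nbhs x U by exact: open_nbhs_nbhs.
have y_gt0 : 0 < `|y| by rewrite normr_gt0.
have r00 : 0 < Num.min r1 `|y| by rewrite lt_min r10.
have [d [C [z [d0 C0 z0 z_lip z_der]]]] := cauchy_lipschitz lV r00.
have z_in t : 0 < t < d -> U (lsubmx (z t)) /\ rsubmx (z t) != 0.
  move=> /z_der[]; rewrite lt_min => /andP[h1 h2] _; split.
    apply: ballU; rewrite -ball_normE /ball_/= distrC.
    apply: le_lt_trans h1; have := lsubmx_lip (z t) (row_mx x y).
    by rewrite row_mxKl mul1r.
  apply: contraTneq h2 => z_0; rewrite -leNgt.
  have := rsubmx_lip (z t) (row_mx x y).
  by rewrite row_mxKr mul1r z_0 sub0r normrN.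
pose c t := lsubmx (z t).
have dc t : 0 < t < d -> forall i,
    is_derive t 1 (fun s => c s 0 i) (rsubmx (z t) 0 i).
  move=> /z_der[_ h] i; have := h (lshift n i); rewrite row_mxEl.
  have -> // : (fun s => c s 0 i) = (fun s => z s 0 (lshift n i)).
  by apply/funext => s; rewrite mxE.
have dc1 t : 0 < t < d -> forall i,
    is_derive t 1 (fun s => rsubmx (z s) 0 i) ((- 2 *: S (z t)) 0 i).
  move=> /z_der[_ h] i; have := h (rshift n i); rewrite row_mxEr.
  have -> // : (fun s => rsubmx (z s) 0 i) = (fun s => z s 0 (rshift n i)).
  by apply/funext => s; rewrite mxE.
have open_itv : open (`]0, d[%classic : set R) by exact: interval_open.
have near_in t : 0 < t < d -> \forall s \near t, 0 < s < d.
  move=> td; have : nbhs t `]0, d[%classic.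
    by apply: open_nbhs_nbhs; split; [exact: open_itv|rewrite /= in_itv].
  by apply: filterS => s /=; rewrite in_itv.
have c1E t : 0 < t < d -> derivable c t 1 /\ derive1 c t = rsubmx (z t).
  by move=> td; apply: derive1_rV; exact: dc.
have c2E t : 0 < t < d ->
    derivable (derive1 c) t 1 /\ derive1 (derive1 c) t = - 2 *: S (z t).
  move=> td; apply: derive1_rV => i.
  apply: near_eq_is_derive (dc1 t td i).
  by near=> s; rewrite (c1E s _).2//; near: s; exact: near_in.
have geo : geodesic F U `]0, d[%classic c.
  split; [exact: open_itv|exact: interval_is_interval|].
  move=> t; rewrite /= in_itv => td.
  have [Uz z_neq0] := z_in t td; have [h1 h2] := c1E t td.
  have [h3 h4] := c2E t td.
  split => //; first by rewrite h2.
  by rewrite /derive1n/= h4 h2 scaleNr addNr.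
have [p [v line]] := straight _ _ geo.
have par t : 0 < t < d -> parallel (S (z t)) (rsubmx (z t)).
  move=> td i j; have Jt : `]0, d[%classic t by rewrite /= in_itv.
  have h1 (s : R) : `]0, d[%classic s -> forall k,
      is_derive s 1 (fun u => c u 0 k) (rsubmx (z s) 0 k).
    by rewrite /= in_itv; exact: dc.
  have h2 (s : R) : `]0, d[%classic s -> forall k,
      is_derive s 1 (fun u => rsubmx (z u) 0 k) ((- 2 *: S (z s)) 0 k).
    by rewrite /= in_itv; exact: dc1.
  have := straight_derive_parallel open_itv line h1 h2 Jt (z_in t td).2 i j.
  rewrite ![(_ *: S _) _ _]mxE -!mulrA => /mulfI; apply.
  by rewrite oppr_eq0.
move=> i j.
(* The minors vanish along the geodesic and are continuous at time 0. *)
pose minor w := S w 0 i * rsubmx w 0 j - S w 0 j * rsubmx w 0 i.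
have lm : loclip minor (row_mx x y).
  apply: loclipD; last apply: loclipN; apply: loclipM; try exact: lS.
    exact: loclip_rsub_coord.
  exact: loclip_rsub_coord.
apply: subr0_eq; apply/eqP; rewrite -normr_le0 leNgt; apply/negP => m0.
have minorE : `|minor (row_mx x y)| =
    `|spray F x y 0 i * y 0 j - spray F x y 0 j * y 0 i|.
  by rewrite /minor /S row_mxKl row_mxKr.
rewrite -minorE in m0.
have [e e0 he] := loclip_near_dist lm m0.
pose t := Num.min (d / 2) (e / (C + 1) / 2).
have eC : 0 < e / (C + 1) by rewrite divr_gt0// ltr_wpDl.
have t0 : 0 < t by rewrite lt_min (divr_gt0 d0)// (divr_gt0 eC).
have td : 0 < t < d.
  by rewrite t0/= (@le_lt_trans _ _ (d / 2)) ?ge_min ?lexx//; lra.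
have tC : t < e / (C + 1).
  apply: (@le_lt_trans _ _ (e / (C + 1) / 2)); last by lra.
  by rewrite ge_min lexx orbT.
have : `|z t - row_mx x y| < e.
  rewrite -z0 (le_lt_trans (z_lip _ _))// subr0 ger0_norm ?(ltW t0)//.
  move: tC; rewrite ltr_pdivlMr ?ltr_wpDl// mulrDr mulr1 mulrC.
  by apply: le_lt_trans; rewrite lerDl ltW.
move=> /he; rewrite {1}/minor (par t td i j) subrr sub0r normrN ltxx//.
Unshelve. all: by end_near. Qed.

(** Along a geodesic the acceleration is parallel to the velocity, so the unit
    velocity [u] is constant, and so are the components of the curve orthogonal
    to [u]. *)
Lemma spray_parallel_straight :
  (forall x y, U x -> y != 0 -> parallel (spray F x y) y) ->
  geodesics_straight F U.
Proof.
move=> par J c [oJ iJ geo].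
have [->|/set0P[t0 Jt0]] := eqVneq J set0; first by exists 0, 0.
pose v t := derive1 c t; pose N t := \sum_k v t 0 k ^+ 2.
have dc t i : J t -> is_derive t 1 (fun s => c s 0 i) (v t 0 i).
  by move=> /geo[_ h _ _ _]; exact: is_derive_coord.
have dv t i : J t -> is_derive t 1 (fun s => v s 0 i) (derive1 v t 0 i).
  by move=> /geo[_ _ h _ _]; exact: is_derive_coord.
have N0 t : J t -> 0 < N t.
  move=> /geo[_ _ _ /rV0Pn[k vk] _]; rewrite /N (bigD1 k)//=.
  apply: ltr_pwDl; first by rewrite exprn_even_gt0.
  by apply: sumr_ge0 => j _; exact: sqr_ge0.
have acc t : J t -> parallel (derive1 v t) (v t).
  move=> /geo[Uc _ _ v0]; rewrite /derive1n/= => /eqP.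
  rewrite addr_eq0 => /eqP e i j; have := par _ _ Uc v0 i j.
  move: e; rewrite -/(v t) => ->; move: (spray F (c t) (v t)) => s sv.
  by rewrite !mxE !mulNr -!mulrA sv.
have dN t : J t -> is_derive t 1 N (\sum_k 2 * v t 0 k * derive1 v t 0 k).
  move=> Jt; apply: is_derive_bigsum => k.
  by have := is_derive_exp 2 (dv t k Jt); rewrite expr1.
pose u t i := v t 0 i * (Num.sqrt (N t))^-1.
have du i t : J t -> is_derive t 1 (u ^~ i) 0.
  move=> Jt; have N_0 := N0 t Jt.
  have sN : Num.sqrt (N t) != 0 by rewrite sqrtr_eq0 -ltNge.
  have := is_derive_mul (dv t i Jt)
    (is_derive_inv (f := fun s => Num.sqrt (N s)) sN
      (is_derive_sqrt N_0 (dN t Jt))).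
  move=> /is_derive_eq; apply.
  rewrite sqr_sqrtr ?ltW//.
  have -> : \sum_k 2 * v t 0 k * derive1 v t 0 k =
      2 * \sum_k v t 0 k * derive1 v t 0 k.
    by rewrite mulr_sumr; apply: eq_bigr => k _; rewrite mulrA.
  have key : derive1 v t 0 i * N t =
      v t 0 i * \sum_k v t 0 k * derive1 v t 0 k.
    rewrite /N !mulr_sumr; apply: eq_bigr => k _.
    by rewrite expr2 mulrA (acc t Jt i k); ring.
  have {key}-> : derive1 v t 0 i =
      v t 0 i * (\sum_k v t 0 k * derive1 v t 0 k) / N t.
    by rewrite -key mulfK// gt_eqF.
  by field; rewrite sN gt_eqF.
have uE t i : J t -> u t i = u t0 i.
  by move=> Jt; exact: (derive0_constant iJ (du i) Jt Jt0).
have vE t i : J t -> v t 0 i = Num.sqrt (N t) * u t0 i.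
  move=> Jt; rewrite -(uE t)// /u mulrC mulfVK//.
  by rewrite sqrtr_eq0 -ltNge N0.
have u1 : \sum_k u t0 k ^+ 2 = 1.
  rewrite /u; under eq_bigr do rewrite exprMn exprVn.
  by rewrite -mulr_suml sqr_sqrtr ?ltW ?N0// mulfV// gt_eqF// N0.
have cE t i j : J t ->
    c t 0 i * u t0 j - c t 0 j * u t0 i = c t0 0 i * u t0 j - c t0 0 j * u t0 i.
  move=> Jt; apply: (derive0_constant (f := fun s =>
    c s 0 i * u t0 j - c s 0 j * u t0 i) iJ) => // s Js.
  have := is_derive_sub (is_derive_mulr (u t0 j) (dc s i Js))
    (is_derive_mulr (u t0 i) (dc s j Js)).
  by move=> /is_derive_eq; apply; rewrite !vE//; ring.
exists (c t0), (\row_i u t0 i) => t Jt.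
exists (\sum_k (c t 0 k - c t0 0 k) * u t0 k).
apply/rowP => i; rewrite !mxE -[LHS]mulr1 -u1 mulr_sumr.
rewrite -[c t0 0 i in RHS]mulr1 -u1 mulr_sumr mulr_suml -big_split/=.
apply: eq_bigr => k _; have := cE t i k Jt => h.
have -> : c t 0 i * u t0 k ^+ 2 = (c t 0 i * u t0 k - c t 0 k * u t0 i) * u t0 k
   + c t 0 k * u t0 i * u t0 k by ring.
by rewrite h; ring.
Qed.

End StraightSpray.

(** * The spray of a square metric *)

Section SquareEnergy.
Context {R : realType}.
Implicit Types (P B : R).

(** With A = P ^+ 2, these are the energy F ^+ 2 = (P + B) ^+ 4 / P ^+ 2 and its
    first and second partial derivatives with respect to A and B. *)
Definition sqL P B : R := ((P + B) ^+ 2 / P) ^+ 2.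
Definition sqLA P B : R := (P + B) ^+ 3 * (P - B) / P ^+ 4.
Definition sqLB P B : R := 4 * (P + B) ^+ 3 / P ^+ 2.
Definition sqLAA P B : R := (P + B) ^+ 2 * (B * (2 * B - P)) / P ^+ 6.
Definition sqLAB P B : R := (P + B) ^+ 2 * (2 * P - 4 * B) / P ^+ 4.
Definition sqLBB P B : R := 12 * (P + B) ^+ 2 / P ^+ 2.

Context {V : normedModType R}.
Variables (A B : V -> R) (x v : V) (dA dB : R).
Hypothesis A0 : 0 < A x.
Hypothesis hA : is_derive x v A dA.
Hypothesis hB : is_derive x v B dB.

Let P z := Num.sqrt (A z).
Let P0 : P x != 0. Proof. by rewrite sqrtr_eq0 -ltNge. Qed.
Let hP : is_derive x v P (dA / (2 * P x)). Proof. exact: is_derive_sqrt. Qed.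
Let hS := is_derive_add hP hB.
Let hPinv k : is_derive x v (fun z => (P z ^+ k)^-1)
  (- (k%:R * P x ^+ k.-1 * (dA / (2 * P x))) / (P x ^+ k) ^+ 2).
Proof.
apply: (is_derive_inv (f := fun z => P z ^+ k)); first by rewrite expf_neq0.
exact: is_derive_exp.
Qed.

Lemma is_derive_sqL : is_derive x v (fun z => sqL (P z) (B z))
  (sqLA (P x) (B x) * dA + sqLB (P x) (B x) * dB).
Proof.
have := is_derive_exp 2 (is_derive_mul (is_derive_exp 2 hS) (hPinv 1)).
move=> /is_derive_eq; apply; rewrite /sqLA /sqLB/=.
by field.
Qed.

Lemma is_derive_sqLA : is_derive x v (fun z => sqLA (P z) (B z))
  (sqLAA (P x) (B x) * dA + sqLAB (P x) (B x) * dB).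
Proof.
have := is_derive_mul
  (is_derive_mul (is_derive_exp 3 hS) (is_derive_sub hP hB)) (hPinv 4).
move=> /is_derive_eq; apply; rewrite /sqLAA /sqLAB/=.
by field.
Qed.

Lemma is_derive_sqLB : is_derive x v (fun z => sqLB (P z) (B z))
  (sqLAB (P x) (B x) * dA + sqLBB (P x) (B x) * dB).
Proof.
have := is_derive_mul (is_derive_mull 4 (is_derive_exp 3 hS)) (hPinv 2).
move=> /is_derive_eq; apply; rewrite /sqLBB /sqLAB/=.
by field.
Qed.

End SquareEnergy.

Section MatrixForm.
Context {R : realType} {n : nat}.
Implicit Types (M : 'M[R]_n) (b u v w : 'rV[R]_n).

Definition mxform M u v : R := (u *m M *m v^T) 0 0.
Definition rowform b v : R := (b *m v^T) 0 0.

Lemma mxformE M u v : mxform M u v = \sum_i \sum_j u 0 i * M i j * v 0 j.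
Proof.
rewrite /mxform mxE exchange_big/=; apply: eq_bigr => j _.
by rewrite !mxE mulr_suml.
Qed.

Lemma rowformE b v : rowform b v = \sum_j b 0 j * v 0 j.
Proof. by rewrite /rowform mxE; apply: eq_bigr => j _; rewrite mxE. Qed.

Lemma mxformDl M u1 u2 v : mxform M (u1 + u2) v = mxform M u1 v + mxform M u2 v.
Proof. by rewrite /mxform !mulmxDl mxE. Qed.

Lemma mxformDr M u v1 v2 : mxform M u (v1 + v2) = mxform M u v1 + mxform M u v2.
Proof. by rewrite /mxform linearD/= mulmxDr mxE. Qed.

Lemma mxformZl M k u v : mxform M (k *: u) v = k * mxform M u v.
Proof. by rewrite /mxform -!scalemxAl mxE. Qed.

Lemma mxformZr M k u v : mxform M u (k *: v) = k * mxform M u v.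
Proof. by rewrite /mxform linearZ/= -scalemxAr mxE. Qed.

Lemma mxformNl M u v : mxform M (- u) v = - mxform M u v.
Proof. by rewrite -scaleN1r mxformZl mulN1r. Qed.

Lemma mxformNr M u v : mxform M u (- v) = - mxform M u v.
Proof. by rewrite -scaleN1r mxformZr mulN1r. Qed.

Lemma mxform_addmx M N u v : mxform (M + N) u v = mxform M u v + mxform N u v.
Proof. by rewrite /mxform mulmxDr mulmxDl mxE. Qed.

Lemma mxform_scalemx k M u v : mxform (k *: M) u v = k * mxform M u v.
Proof. by rewrite /mxform -scalemxAr -scalemxAl mxE. Qed.

Lemma mxformC M u v : M^T = M -> mxform M u v = mxform M v u.
Proof.
move=> sM; rewrite /mxform.
have -> : (u *m M *m v^T) 0 0 = (u *m M *m v^T)^T 0 0 by rewrite [RHS]mxE.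
by rewrite !trmx_mul trmxK sM mulmxA.
Qed.

Lemma mxform_outer b w u v : mxform (b^T *m w) u v = rowform b u * rowform w v.
Proof.
rewrite /mxform mulmxA -mulmxA mxE big_ord1; congr (_ * _).
have -> : (u *m b^T) 0 0 = (u *m b^T)^T 0 0 by rewrite [RHS]mxE.
by rewrite trmx_mul trmxK.
Qed.

Lemma mxform_delta M i j : mxform M (delta_mx 0 i) (delta_mx 0 j) = M i j.
Proof. by rewrite /mxform -rowE trmx_delta -colE !mxE. Qed.

Lemma rowform_delta b j : rowform b (delta_mx 0 j) = b 0 j.
Proof. by rewrite /rowform trmx_delta -colE mxE. Qed.

Lemma rowformDl b w v : rowform (b + w) v = rowform b v + rowform w v.
Proof. by rewrite /rowform mulmxDl mxE. Qed.

Lemma rowformZl k b v : rowform (k *: b) v = k * rowform b v.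
Proof. by rewrite /rowform -scalemxAl mxE. Qed.

Lemma rowformDr b u v : rowform b (u + v) = rowform b u + rowform b v.
Proof. by rewrite /rowform linearD/= mulmxDr mxE. Qed.

Lemma rowformZr k b v : rowform b (k *: v) = k * rowform b v.
Proof. by rewrite /rowform linearZ/= -scalemxAr mxE. Qed.

Lemma rowformNr b v : rowform b (- v) = - rowform b v.
Proof. by rewrite -scaleN1r rowformZr mulN1r. Qed.

Lemma rowform_mulmx M u v : rowform (u *m M) v = mxform M u v.
Proof. by []. Qed.

Lemma rowform_ext b w : (forall v, rowform b v = rowform w v) -> b = w.
Proof. by move=> h; apply/rowP => i; rewrite -!rowform_delta h. Qed.

Lemma is_derive_entry y v j : is_derive y v (fun z : 'rV[R]_n => z 0 j) (v 0 j).
Proof.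
have [h1 h2] := is_derive_id y v.
split; first exact: (derivable_mxP id y v).1.
have := derive_mx h1; rewrite h2 => /(congr1 (fun w : 'rV[R]_n => w 0 j)).
by rewrite mxE => ->.
Qed.

Lemma is_derive_rowform b y v : is_derive y v (rowform b) (rowform b v).
Proof.
have -> : rowform b = (fun z => \sum_j b 0 j * z 0 j).
  by apply/funext => z; rewrite rowformE.
by apply: is_derive_bigsum => j; apply: is_derive_mull; exact: is_derive_entry.
Qed.

Lemma is_derive_mxform_quad M y v : M^T = M ->
  is_derive y v (fun z => mxform M z z) (2 * mxform M y v).
Proof.
move=> sM.
have -> : (fun z => mxform M z z) = (fun z : 'rV[R]_n =>
    \sum_j z 0 j * rowform (row j M) z).
  apply/funext => z; rewrite mxformE; apply: eq_bigr => j _.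
  by rewrite rowformE mulr_sumr; apply: eq_bigr => k _; rewrite mxE mulrA.
have := is_derive_bigsum (fun j => is_derive_mul (is_derive_entry y v j)
  (is_derive_rowform (row j M) y v)).
move=> /is_derive_eq; apply; rewrite big_split/=.
have E (p q : 'rV[R]_n) : \sum_j p 0 j * rowform (row j M) q = mxform M p q.
  rewrite mxformE; apply: eq_bigr => j _.
  by rewrite rowformE mulr_sumr; apply: eq_bigr => k _; rewrite mxE mulrA.
by rewrite !E (mxformC v y sM); ring.
Qed.

End MatrixForm.

Lemma posdef_unitmx (R : realType) (n : nat) (M : 'M[R]_n) :
  (forall v, v != 0 -> 0 < mxform M v v) -> M \in unitmx.
Proof.
move=> pM; rewrite -row_free_unit -kermx_eq0; apply/eqP/row_matrixP => i.
rewrite row0; apply/eqP/negPn/negP => /pM; rewrite /mxform.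
have -> : row i (kermx M) *m M = 0 by rewrite -row_mul mulmx_ker row0.
by rewrite mul0mx mxE ltxx.
Qed.

(** Equality in the Cauchy-Schwarz inequality is proportionality. *)
Lemma cauchy_schwarz_mxform (R : realType) (n : nat) (M : 'M[R]_n)
    (y v : 'rV[R]_n) : M^T = M -> (forall v, v != 0 -> 0 < mxform M v v) ->
  y != 0 ->
  let q := mxform M y y * mxform M v v - mxform M y v ^+ 2 in
  0 <= q /\ (q = 0 -> v = (mxform M y v / mxform M y y) *: y).
Proof.
move=> sM pM y0 q; have A0 := pM y y0.
pose w := mxform M y y *: v - mxform M y v *: y.
have qE : mxform M w w = mxform M y y * q.
  rewrite /w !(mxformDl, mxformDr, mxformNl, mxformNr, mxformZl, mxformZr).
  by rewrite (mxformC v y sM) /q; ring.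
have q0 : 0 <= mxform M w w.
  have [->|/pM/ltW//] := eqVneq w 0.
  by rewrite -(scale0r (0 : 'rV[R]_n)) mxformZl mul0r.
split; first by move: q0; rewrite qE pmulr_rge0.
move=> q_0; have : w = 0.
  apply/eqP/negPn/negP => /pM; rewrite qE q_0 mulr0 ltxx//.
move=> /subr0_eq e; rewrite mulrC -scalerA -e scalerA mulVf ?scale1r//.
by rewrite gt_eqF.
Qed.

Section DirectionalDerivative.
Context {R : realType} {n : nat}.
Implicit Types (a : 'rV[R]_n -> 'M[R]_n) (b : 'rV[R]_n -> 'rV[R]_n).
Implicit Types (x u v w : 'rV[R]_n).

Definition Dmx a x w : 'M[R]_n :=
  \sum_k w 0 k *: \matrix_(i, j) partial k (fun z => a z i j) x.

Definition Drow b x w : 'rV[R]_n :=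
  \sum_k w 0 k *: \row_j partial k (fun z => b z 0 j) x.

Lemma DmxE a x w i j :
  Dmx a x w i j = \sum_k w 0 k * partial k (fun z => a z i j) x.
Proof. by rewrite summxE; apply: eq_bigr => k _; rewrite !mxE. Qed.

Lemma DrowE b x w j :
  Drow b x w 0 j = \sum_k w 0 k * partial k (fun z => b z 0 j) x.
Proof. by rewrite summxE; apply: eq_bigr => k _; rewrite !mxE. Qed.

Lemma DmxD a x u v : Dmx a x (u + v) = Dmx a x u + Dmx a x v.
Proof.
by rewrite /Dmx -big_split; apply: eq_bigr => k _; rewrite mxE scalerDl.
Qed.

Lemma DmxZ a x k v : Dmx a x (k *: v) = k *: Dmx a x v.
Proof.
by rewrite /Dmx scaler_sumr; apply: eq_bigr => j _; rewrite mxE scalerA.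
Qed.

Lemma DrowD b x u v : Drow b x (u + v) = Drow b x u + Drow b x v.
Proof.
by rewrite /Drow -big_split; apply: eq_bigr => k _; rewrite mxE scalerDl.
Qed.

Lemma DrowZ b x k v : Drow b x (k *: v) = k *: Drow b x v.
Proof.
by rewrite /Drow scaler_sumr; apply: eq_bigr => j _; rewrite mxE scalerA.
Qed.

Lemma sum_delta (f : 'I_n -> R) k :
  \sum_j (delta_mx 0 k : 'rV[R]_n) 0 j * f j = f k.
Proof.
rewrite (bigD1 k)//= big1 ?addr0 ?mxE ?eqxx ?mul1r// => j jk.
by rewrite mxE (negbTE jk) mul0r.
Qed.

Lemma Dmx_delta a x k i j :
  Dmx a x (delta_mx 0 k) i j = partial k (fun z => a z i j) x.
Proof. by rewrite DmxE sum_delta. Qed.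

Lemma Drow_delta b x k j :
  Drow b x (delta_mx 0 k) 0 j = partial k (fun z => b z 0 j) x.
Proof. by rewrite DrowE sum_delta. Qed.

Lemma Dmx_sym a x w (U : set 'rV[R]_n) : open U -> U x ->
  (forall z, U z -> (a z)^T = a z) -> (Dmx a x w)^T = Dmx a x w.
Proof.
move=> oU Ux sa; apply/matrixP => i j; rewrite mxE !DmxE.
apply: eq_bigr => k _; congr (_ * _); apply: near_eq_partial.
by apply: (open_near oU Ux) => z Uz; rewrite -{1}(sa z Uz) mxE.
Qed.

Lemma is_derive_mxform a x w u v : (forall i j, differentiable (a ^~ i ^~ j) x) ->
  is_derive x w (fun z => mxform (a z) u v) (mxform (Dmx a x w) u v).
Proof.
move=> da; rewrite mxformE.
have -> : (fun z => mxform (a z) u v) =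
    (fun z => \sum_i \sum_j u 0 i * a z i j * v 0 j).
  by apply/funext => z; rewrite mxformE.
apply: is_derive_bigsum => i; apply: is_derive_bigsum => j.
rewrite DmxE; apply/is_derive_mulr/is_derive_mull.
exact: is_derive_sum_partial.
Qed.

Lemma is_derive_rowform_base b x w v : (forall j, differentiable (b ^~ 0 ^~ j) x) ->
  is_derive x w (fun z => rowform (b z) v) (rowform (Drow b x w) v).
Proof.
move=> db; rewrite rowformE.
have -> : (fun z => rowform (b z) v) = (fun z => \sum_j b z 0 j * v 0 j).
  by apply/funext => z; rewrite rowformE.
apply: is_derive_bigsum => j; rewrite DrowE; apply/is_derive_mulr.
exact: is_derive_sum_partial.
Qed.

Lemma linear_rowE (f : 'rV[R]_n -> R) v :
  (forall k u w, f (k *: u + w) = k * f u + f w) ->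
  f v = \sum_k v 0 k * f (delta_mx 0 k).
Proof.
move=> lf.
have f0 : f 0 = 0 by have := lf (-1) 0 0; rewrite scaler0 addr0; lra.
rewrite {1}(row_sum_delta v); elim: (index_enum _) => [|k s IH].
  by rewrite !big_nil.
by rewrite !big_cons lf IH.
Qed.

End DirectionalDerivative.

(** The expression in a chart of a Riemannian metric and a 1-form of norm less
    than 1. *)
Record square_data (R : realType) (n : nat) (U : set 'rV[R]_n)
    (a : 'rV[R]_n -> 'M[R]_n) (b : 'rV[R]_n -> 'rV[R]_n) : Prop := SquareData {
  sq_open : open U ;
  sq_smooth_mx : forall i j, smooth_on U (fun x => a x i j) ;
  sq_smooth_row : forall j, smooth_on U (fun x => b x 0 j) ;
  sq_sym : forall x, U x -> (a x)^T = a x ;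
  sq_pos : forall x, U x -> forall v, v != 0 -> 0 < mxform (a x) v v ;
  sq_norm : forall x, U x -> mxform (invmx (a x)) (b x) (b x) < 1 }.

Section SquareSpray.
Context {R : realType} {n : nat}.
Variables (U : set 'rV[R]_n).
Variables (a : 'rV[R]_n -> 'M[R]_n) (b : 'rV[R]_n -> 'rV[R]_n).
Implicit Types (x y u v w : 'rV[R]_n).

Definition alpha_of x y : R := Num.sqrt (mxform (a x) y y).

Definition square_fun x y : R :=
  (alpha_of x y + rowform (b x) y) ^+ 2 / alpha_of x y.

(** The contravariant vector of the 1-form [b]. *)
Definition sharp x : 'rV[R]_n := b x *m invmx (a x).

Hypothesis data : square_data U a b.

Section AtPoint.
Variables (x : 'rV[R]_n) (Ux : U x).

Let sa := sq_sym data Ux.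
Let pa := sq_pos data Ux.

Lemma metric_unit : a x \in unitmx. Proof. exact: posdef_unitmx. Qed.

Lemma mxform_sharp v : mxform (a x) (sharp x) v = rowform (b x) v.
Proof. by rewrite /mxform /sharp mulmxKV// metric_unit. Qed.

Lemma rowform_sharp_lt1 : rowform (b x) (sharp x) < 1.
Proof.
have -> : rowform (b x) (sharp x) = mxform (invmx (a x)) (b x) (b x).
  rewrite rowformE /mxform -/(sharp x) -[RHS]/(rowform (sharp x) (b x)).
  by rewrite rowformE; apply: eq_bigr => i _; rewrite mulrC.
exact: (sq_norm data Ux).
Qed.

Lemma form_lt_metric y : y != 0 -> rowform (b x) y ^+ 2 < mxform (a x) y y.
Proof.
move=> y0; have A0 := pa y0.
have [+ _] := cauchy_schwarz_mxform (sharp x) sa pa y0.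
rewrite mxform_sharp (mxformC _ (sharp x) sa) mxform_sharp subr_ge0 => h.
apply: le_lt_trans h _; rewrite -[ltRHS]mulr1 ltr_pM2l//.
exact: rowform_sharp_lt1.
Qed.

Section Direction.
Variables (y : 'rV[R]_n) (y0 : y != 0).

Let P := alpha_of x y.
Let B := rowform (b x) y.

Lemma alpha_gt0 : 0 < P. Proof. by rewrite sqrtr_gt0 pa. Qed.

Lemma sqr_alpha : P ^+ 2 = mxform (a x) y y.
Proof. by rewrite sqr_sqrtr// ltW// pa. Qed.

Lemma form_lt_alpha : - P < B /\ B < P.
Proof.
have : `|B| < P.
  rewrite -(@ltr_pXn2r _ 2) ?nnegrE ?(ltW alpha_gt0)// sqr_alpha real_normK ?num_real//.
  exact: form_lt_metric.
by move=> h; apply/andP; rewrite -ltr_norml.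
Qed.

End Direction.

(** The derivative of the energy F ^+ 2 with respect to [y], in the direction
    [v]. *)
Definition energy_y y v : R :=
  sqLA (alpha_of x y) (rowform (b x) y) * (2 * mxform (a x) y v)
  + sqLB (alpha_of x y) (rowform (b x) y) * rowform (b x) v.

Lemma is_derive_energy_y y v : y != 0 ->
  is_derive y v (fun z => square_fun x z ^+ 2) (energy_y y v).
Proof.
move=> y0; apply: (is_derive_sqL (A := fun z => mxform (a x) z z)
  (B := rowform (b x))) => //; first exact: pa.
- exact: is_derive_mxform_quad.
- exact: is_derive_rowform.
Qed.

Lemma near_neq0 y : y != 0 -> \forall z \near y, z != 0.
Proof.
move=> y0; apply/nbhs_ballP; exists `|y|; first by rewrite /= normr_gt0.
move=> z; rewrite -ball_normE /ball_/=; apply: contraTneq => ->.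
by rewrite subr0 ltxx.
Qed.

(** The fundamental tensor of the square metric. *)
Definition energy_yy y : 'M[R]_n :=
  let P := alpha_of x y in let B := rowform (b x) y in let yb := y *m a x in
  sqLA P B *: a x + (2 * sqLAA P B) *: (yb^T *m yb)
  + sqLAB P B *: (yb^T *m b x + (b x)^T *m yb)
  + (2^-1 * sqLBB P B) *: ((b x)^T *m b x).

Lemma energy_yyE y u v :
  mxform (energy_yy y) u v =
  sqLA (alpha_of x y) (rowform (b x) y) * mxform (a x) u v
  + 2 * sqLAA (alpha_of x y) (rowform (b x) y)
    * (mxform (a x) y u * mxform (a x) y v)
  + sqLAB (alpha_of x y) (rowform (b x) y)
    * (mxform (a x) y u * rowform (b x) v + rowform (b x) u * mxform (a x) y v)
  + 2^-1 * sqLBB (alpha_of x y) (rowform (b x) y)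
    * (rowform (b x) u * rowform (b x) v).
Proof.
by rewrite /energy_yy !(mxform_addmx, mxform_scalemx, mxform_outer)
  !rowform_mulmx.
Qed.

Lemma fundamental_tensorE y : y != 0 ->
  fundamental_tensor square_fun x y = energy_yy y.
Proof.
move=> y0; apply/matrixP => i j; rewrite mxE.
rewrite -[RHS]mxform_delta energy_yyE.
set u := delta_mx 0 i; set v := delta_mx 0 j.
have d : is_derive y u (partial j (fun z => square_fun x z ^+ 2))
   (2 * mxform (energy_yy y) u v).
  apply: (@near_eq_is_derive _ _ _ (energy_y ^~ v)).
    have := near_neq0 y0; apply: filterS => z z0.
    by have [_ <-] := is_derive_energy_y v z0.
  have hA := is_derive_mxform_quad y u sa.
  have hB := is_derive_rowform (b x) y u.
  have A0 := pa y0.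
  have hv : is_derive y u (fun z => 2 * mxform (a x) z v)
      (2 * mxform (a x) u v).
    apply: is_derive_mull.
    have -> : (fun z => mxform (a x) z v) = rowform (v *m a x).
      by apply/funext => z; rewrite (mxformC _ _ sa).
    by rewrite (mxformC _ _ sa); exact: is_derive_rowform.
  have := is_derive_add
    (is_derive_mul (is_derive_sqLA (A := fun z => mxform (a x) z z)
       (B := rowform (b x)) A0 hA hB) hv)
    (is_derive_mulr (rowform (b x) v)
       (is_derive_sqLB (A := fun z => mxform (a x) z z)
         (B := rowform (b x)) A0 hA hB)).
  move=> /is_derive_eq; apply; rewrite energy_yyE /=.
  by rewrite -/(alpha_of x y); field.
rewrite /partial -/u -/v.
have [_ ->] := d.
by rewrite mulKf ?energy_yyE.
Qed.

(** Strong convexity, by completing squares: up to a positive factor, the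
    fundamental tensor is the sum of the Cauchy-Schwarz defect of [y] and [v]
    and of two squares. *)
Lemma energy_yy_pos y v : y != 0 -> v != 0 -> 0 < mxform (energy_yy y) v v.
Proof.
move=> y0 v0; rewrite energy_yyE.
have P0 := alpha_gt0 y0; have PE := sqr_alpha y0.
have [BP1 BP2] := form_lt_alpha y0; have hB := form_lt_metric y0.
have [q0 qeq] := cauchy_schwarz_mxform v sa pa y0.
rewrite -PE in hB q0 qeq.
set P := alpha_of x y in P0 PE BP1 BP2 hB q0 qeq *.
set B := rowform (b x) y in BP1 BP2 hB *.
set c := mxform (a x) y v in q0 qeq *; set d := mxform (a x) v v in q0 qeq *.
set e := rowform (b x) v.
have -> : sqLA P B * d + 2 * sqLAA P B * (c * c) + sqLAB P B * (c * e + e * c)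
    + 2^-1 * sqLBB P B * (e * e) =
    (P + B) ^+ 2 / P ^+ 6 * ((P ^+ 2 - B ^+ 2) * (P ^+ 2 * d - c ^+ 2)
      + 2 * (B * c - P ^+ 2 * e) ^+ 2
      + ((P - B) * c + 2 * P ^+ 2 * e) ^+ 2).
  by rewrite /sqLA /sqLAA /sqLAB /sqLBB; field; rewrite gt_eqF.
rewrite pmulr_rgt0; last by rewrite divr_gt0 ?exprn_gt0//; lra.
have h1 : 0 <= (P ^+ 2 - B ^+ 2) * (P ^+ 2 * d - c ^+ 2).
  by rewrite mulr_ge0// subr_ge0 ltW.
have h2 : 0 <= 2 * (B * c - P ^+ 2 * e) ^+ 2 by rewrite mulr_ge0// sqr_ge0.
have h3 := sqr_ge0 ((P - B) * c + 2 * P ^+ 2 * e).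
have [q_0|q_neq0] := eqVneq (P ^+ 2 * d - c ^+ 2) 0; last first.
  have h1' : 0 < (P ^+ 2 - B ^+ 2) * (P ^+ 2 * d - c ^+ 2).
    by apply: mulr_gt0; [rewrite subr_gt0|rewrite lt_def q_neq0].
  by move: h1' h2 h3; lra.
have vE := qeq q_0; set k := c / P ^+ 2 in vE.
have k0 : k != 0 by apply: contraNneq v0 => k0; rewrite vE k0 scale0r.
have cE : c = k * P ^+ 2 by rewrite /c vE mxformZr PE.
have eE : e = k * B by rewrite /e vE rowformZr.
have h3' : 0 < ((P - B) * c + 2 * P ^+ 2 * e) ^+ 2.
  rewrite exprn_even_gt0//= cE eE.
  have -> : (P - B) * (k * P ^+ 2) + 2 * P ^+ 2 * (k * B) = k * (P ^+ 2 * (P + B)).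
    by ring.
  have PB0 : 0 < P + B by lra.
  by rewrite mulf_neq0// mulf_neq0 ?expf_neq0 ?(gt_eqF P0) ?(gt_eqF PB0).
by move: h1 h2 h3'; lra.
Qed.

(** The Euler-Lagrange covector of the energy F ^+ 2 at velocity [y] and zero
    acceleration, evaluated at [v]. *)
Definition euler_form y v : R :=
  let P := alpha_of x y in let B := rowform (b x) y in
  let DA := mxform (Dmx a x y) y y in let DB := rowform (Drow b x y) y in
  (sqLAA P B * DA + sqLAB P B * DB) * (2 * mxform (a x) y v)
  + sqLA P B * (2 * mxform (Dmx a x y) y v)
  + (sqLAB P B * DA + sqLBB P B * DB) * rowform (b x) v
  + sqLB P B * rowform (Drow b x y) v
  - (sqLA P B * mxform (Dmx a x v) y y + sqLB P B * rowform (Drow b x v) y).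

Lemma euler_form_linear y k u v :
  euler_form y (k *: u + v) = k * euler_form y u + euler_form y v.
Proof.
rewrite /euler_form !(DmxD, DmxZ, DrowD, DrowZ, mxformDr, mxformZr, rowformDr,
  rowformZr, mxform_addmx, mxform_scalemx, rowformDl, rowformZl).
by ring.
Qed.

Let da i j : differentiable (a ^~ i ^~ j) x.
Proof. exact: (sq_smooth_mx data i j [::]). Qed.

Let db j : differentiable (b ^~ 0 ^~ j) x.
Proof. exact: (sq_smooth_row data j [::]). Qed.

Lemma is_derive_energy_x y w : y != 0 ->
  is_derive x w (fun u => square_fun u y ^+ 2)
    (sqLA (alpha_of x y) (rowform (b x) y) * mxform (Dmx a x w) y y
     + sqLB (alpha_of x y) (rowform (b x) y) * rowform (Drow b x w) y).
Proof.
move=> y0; apply: (is_derive_sqL (A := fun u => mxform (a u) y y)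
  (B := fun u => rowform (b u) y)); first exact: pa.
- exact: is_derive_mxform.
- exact: is_derive_rowform_base.
Qed.

End AtPoint.

Lemma is_derive_energy_xy x y v w : U x -> y != 0 ->
  is_derive x w (fun u => energy_y u y v)
    ((sqLAA (alpha_of x y) (rowform (b x) y) * mxform (Dmx a x w) y y
      + sqLAB (alpha_of x y) (rowform (b x) y) * rowform (Drow b x w) y)
       * (2 * mxform (a x) y v)
     + sqLA (alpha_of x y) (rowform (b x) y) * (2 * mxform (Dmx a x w) y v)
     + ((sqLAB (alpha_of x y) (rowform (b x) y) * mxform (Dmx a x w) y y
         + sqLBB (alpha_of x y) (rowform (b x) y) * rowform (Drow b x w) y)
        * rowform (b x) v
        + sqLB (alpha_of x y) (rowform (b x) y) * rowform (Drow b x w) v)).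
Proof.
move=> Ux y0.
have da i j : differentiable (a ^~ i ^~ j) x by exact: (sq_smooth_mx data i j [::]).
have db j : differentiable (b ^~ 0 ^~ j) x by exact: (sq_smooth_row data j [::]).
have A0 := sq_pos data Ux y0.
have hA := is_derive_mxform w y y da.
have hB := is_derive_rowform_base w y db.
exact: is_derive_add
  (is_derive_mul (is_derive_sqLA (A := fun u => mxform (a u) y y)
     (B := fun u => rowform (b u) y) A0 hA hB)
     (is_derive_mull 2 (is_derive_mxform w y v da)))
  (is_derive_mul (is_derive_sqLB (A := fun u => mxform (a u) y y)
     (B := fun u => rowform (b u) y) A0 hA hB)
     (is_derive_rowform_base w v db)).
Qed.

(** The mixed derivatives of the energy in the coordinate directions add up to
    one derivative in the direction [y], as they depend linearly on it. *)
Lemma spray_squareE x y : U x -> y != 0 ->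
  spray square_fun x y =
  4^-1 *: ((\row_l euler_form x y (delta_mx 0 l)) *m (invmx (energy_yy x y))^T).
Proof.
move=> Ux y0; apply/rowP => i; rewrite !mxE fundamental_tensorE//.
congr (_ * _); apply: eq_bigr => l _; rewrite !mxE mulrC; congr (_ * _).
set v := delta_mx 0 l.
have near_x k : partial k (fun u => partial l (fun z => square_fun u z ^+ 2) y) x
    = partial k (fun u => energy_y u y v) x.
  apply: near_eq_partial; apply: (open_near (sq_open data) Ux) => u Uu.
  by have [_ <-] := is_derive_energy_y Uu v y0.
under eq_bigr do rewrite near_x.
have -> : partial l (fun u => square_fun u y ^+ 2) x =
    sqLA (alpha_of x y) (rowform (b x) y) * mxform (Dmx a x v) y y
     + sqLB (alpha_of x y) (rowform (b x) y) * rowform (Drow b x v) y.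
  by have [_ <-] := is_derive_energy_x Ux v y0.
rewrite /euler_form; congr (_ - _).
pose f w := (sqLAA (alpha_of x y) (rowform (b x) y) * mxform (Dmx a x w) y y
      + sqLAB (alpha_of x y) (rowform (b x) y) * rowform (Drow b x w) y)
       * (2 * mxform (a x) y v)
     + sqLA (alpha_of x y) (rowform (b x) y) * (2 * mxform (Dmx a x w) y v)
     + ((sqLAB (alpha_of x y) (rowform (b x) y) * mxform (Dmx a x w) y y
         + sqLBB (alpha_of x y) (rowform (b x) y) * rowform (Drow b x w) y)
        * rowform (b x) v
        + sqLB (alpha_of x y) (rowform (b x) y) * rowform (Drow b x w) v).
transitivity (f y); last by rewrite /f addrA.
rewrite (@linear_rowE _ _ f y).
  apply: eq_bigr => k _; rewrite mulrC; congr (_ * _).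
  by rewrite /partial; have [_ ->] := is_derive_energy_xy v (delta_mx 0 k) Ux y0.
move=> k u w; rewrite /f !(DmxD, DmxZ, DrowD, DrowZ, mxform_addmx,
  mxform_scalemx, rowformDl, rowformZl).
by ring.
Qed.

(** The spray is the Euler covector with its index raised by the fundamental
    tensor, under which [y] corresponds to half the differential of the energy. *)
Lemma spray_parallelP x y : U x -> y != 0 ->
  parallel (spray square_fun x y) y <->
  exists k, forall v, euler_form x y v = k * energy_y x y v.
Proof.
move=> Ux y0; rewrite spray_squareE//.
set g := energy_yy x y; set E := \row_l _.
have gu : g \in unitmx.
  by apply: posdef_unitmx => v v0; exact: energy_yy_pos.
have sg : g^T = g.
  rewrite /g /energy_yy; move: (y *m a x) => yb.
  rewrite !(linearD, linearZ)/= !trmx_mul !trmxK (sq_sym data Ux).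
  by rewrite [(b x)^T *m yb + _]addrC scalerDr.
have EE v : rowform E v = euler_form x y v.
  rewrite (linear_rowE v (@euler_form_linear x y)) rowformE.
  by apply: eq_bigr => l _; rewrite mxE mulrC.
have gy v : mxform g y v = 2^-1 * energy_y x y v.
  have P0 := alpha_gt0 Ux y0; have PE := sqr_alpha Ux y0.
  rewrite /g energy_yyE /energy_y -PE /sqLA /sqLAA /sqLAB /sqLBB /sqLB.
  by field; rewrite gt_eqF.
rewrite trmx_inv sg; split.
- move=> par; have /rV0Pn[k0 hk0] := y0.
  set S := 4^-1 *: _ in par.
  have SE : S = (S 0 k0 / y 0 k0) *: y.
    apply/rowP => i; rewrite [RHS]mxE; apply: (mulIf hk0).
    by rewrite (par i k0) mulrAC mulfVK.
  have E4 : E = 4 *: (S *m g).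
    by rewrite /S -scalemxAl mulmxKV// scalerA mulfV ?scale1r.
  exists (2 * (S 0 k0 / y 0 k0)) => v; rewrite -EE E4 {1}SE.
  by rewrite -scalemxAl !rowformZl rowform_mulmx gy; field.
- move=> [k hk].
  have -> : E = (2 * k) *: (y *m g).
    apply: rowform_ext => v; rewrite EE hk rowformZl rowform_mulmx gy.
    by field.
  rewrite -scalemxAl mulmxK// scalerA => i j; rewrite !mxE.
  by ring.
Qed.

End SquareSpray.

(** * Regularity of the spray and characterization of straight geodesics *)

Section LoclipMatrix.
Context {R : realType} {V : normedModType R}.
Variable w0 : V.

Lemma loclip_det n (M : V -> 'M[R]_n) :
  (forall i j, loclip (fun w => M w i j) w0) -> loclip (fun w => \det (M w)) w0.
Proof.
move=> lM; apply: loclip_sum => s; apply: loclipM; first exact: loclip_cst.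
by apply: loclip_prod => i; exact: lM.
Qed.

Lemma loclip_adj n (M : V -> 'M[R]_n) :
  (forall i j, loclip (fun w => M w i j) w0) ->
  forall i j, loclip (fun w => (\adj (M w)) i j) w0.
Proof.
move=> lM i j; under eq_fun do rewrite mxE.
apply: loclipM; first exact: loclip_cst.
apply: loclip_det => k l; under eq_fun do rewrite !mxE; exact: lM.
Qed.

Lemma loclip_div (f g : V -> R) : loclip f w0 -> loclip g w0 -> g w0 != 0 ->
  loclip (fun w => f w / g w) w0.
Proof.
move=> lf lg g0; apply: loclipM => //.
exact: (loclip_comp lg (loclip_inv g0)).
Qed.

Lemma loclip_mxform n (M : V -> 'M[R]_n) (u v : V -> 'rV[R]_n) :
  (forall i j, loclip (fun w => M w i j) w0) ->
  (forall i, loclip (fun w => u w 0 i) w0) ->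
  (forall i, loclip (fun w => v w 0 i) w0) ->
  loclip (fun w => mxform (M w) (u w) (v w)) w0.
Proof.
move=> lM lu lv; under eq_fun do rewrite mxformE.
by apply: loclip_sum => i; apply: loclip_sum => j; apply: loclipM => //;
  exact: loclipM.
Qed.

Lemma loclip_rowform n (u v : V -> 'rV[R]_n) :
  (forall i, loclip (fun w => u w 0 i) w0) ->
  (forall i, loclip (fun w => v w 0 i) w0) ->
  loclip (fun w => rowform (u w) (v w)) w0.
Proof.
move=> lu lv; under eq_fun do rewrite rowformE.
by apply: loclip_sum => i; exact: loclipM.
Qed.

End LoclipMatrix.

Section SquareStraight.
Context {R : realType} {n : nat}.
Variables (U : set 'rV[R]_n).
Variables (a : 'rV[R]_n -> 'M[R]_n) (b : 'rV[R]_n -> 'rV[R]_n).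
Hypothesis data : square_data U a b.

(** Cramer's formula for the inverse of the fundamental tensor expresses the
    spray by locally Lipschitz functions. *)
Lemma loclip_spray_square x y : U x -> y != 0 ->
  loclip_spray (square_fun a b) x y.
Proof.
move=> Ux y0 i; set w0 : 'rV[R]_(n + n) := row_mx x y.
have lx0 : lsubmx w0 = x by rewrite row_mxKl.
have ry0 : rsubmx w0 = y by rewrite row_mxKr.
have oU := sq_open data.
have l_base (f : 'rV[R]_n -> R) : smooth_on U f ->
    loclip (fun w : 'rV[R]_(n + n) => f (lsubmx w)) w0.
  by move=> sf; apply: loclip_lsub_comp; rewrite lx0; exact: smooth_loclip sf.
have smooth_partial (f : 'rV[R]_n -> R) k : smooth_on U f -> smooth_on U (partial k f).
  by move=> sf s z Uz; have := sf (rcons s k) z Uz; rewrite -cats1 foldr_cat.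
have la k l : loclip (fun w : 'rV[R]_(n + n) => a (lsubmx w) k l) w0.
  by apply: (l_base (fun z => a z k l)); exact: (sq_smooth_mx data).
have lb l : loclip (fun w : 'rV[R]_(n + n) => b (lsubmx w) 0 l) w0.
  by apply: (l_base (fun z => b z 0 l)); exact: (sq_smooth_row data).
have ly l : loclip (fun w : 'rV[R]_(n + n) => rsubmx w 0 l) w0.
  exact: loclip_rsub_coord.
have lDa (v : 'rV[R]_(n + n) -> 'rV[R]_n) k l :
    (forall j, loclip (fun w => v w 0 j) w0) ->
    loclip (fun w => Dmx a (lsubmx w) (v w) k l) w0.
  move=> lv; under eq_fun do rewrite DmxE.
  apply: loclip_sum => j; apply: loclipM => //.
  by apply: l_base; apply: smooth_partial; exact: (sq_smooth_mx data).
have lDb (v : 'rV[R]_(n + n) -> 'rV[R]_n) l :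
    (forall j, loclip (fun w => v w 0 j) w0) ->
    loclip (fun w => Drow b (lsubmx w) (v w) 0 l) w0.
  move=> lv; under eq_fun do rewrite DrowE.
  apply: loclip_sum => j; apply: loclipM => //.
  by apply: l_base; apply: smooth_partial; exact: (sq_smooth_row data).
pose P (w : 'rV[R]_(n + n)) := alpha_of a (lsubmx w) (rsubmx w).
pose B (w : 'rV[R]_(n + n)) := rowform (b (lsubmx w)) (rsubmx w).
have P0 : P w0 != 0 by rewrite /P lx0 ry0 gt_eqF// (alpha_gt0 data Ux y0).
have lP : loclip P w0.
  apply: (loclip_comp (g := @Num.sqrt R)
    (f := fun w : 'rV[R]_(n + n) => mxform (a (lsubmx w)) (rsubmx w) (rsubmx w))).
    exact: loclip_mxform.
  by apply: loclip_sqrt; rewrite lx0 ry0; exact: (sq_pos data).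
have lB : loclip B w0 by exact: loclip_rowform.
have lPB : loclip (fun w => P w + B w) w0 by exact: loclipD.
have lPX k : loclip (fun w => P w ^+ k) w0 by exact: loclipX.
have lPBX k : loclip (fun w => (P w + B w) ^+ k) w0 by exact: loclipX.
have PX0 k : P w0 ^+ k != 0 by rewrite expf_neq0.
have lc (c : R) : loclip (fun _ : 'rV[R]_(n + n) => c) w0 by exact: loclip_cst.
have lLA : loclip (fun w => sqLA (P w) (B w)) w0.
  apply: loclip_div => //; apply: loclipM => //.
  by apply: loclipD => //; exact: loclipN.
have lLB : loclip (fun w => sqLB (P w) (B w)) w0.
  by apply: loclip_div => //; exact: loclipM.
have lLAA : loclip (fun w => sqLAA (P w) (B w)) w0.
  apply: loclip_div => //; apply: loclipM => //; apply: loclipM => //.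
  by apply: loclipD; [exact: loclipM|exact: loclipN].
have lLAB : loclip (fun w => sqLAB (P w) (B w)) w0.
  apply: loclip_div => //; apply: loclipM => //; apply: loclipD.
    exact: loclipM.
  by apply: loclipN; exact: loclipM.
have lLBB : loclip (fun w => sqLBB (P w) (B w)) w0.
  by apply: loclip_div => //; exact: loclipM.
have lE (v : 'rV[R]_n) :
    loclip (fun w => euler_form a b (lsubmx w) (rsubmx w) v) w0.
  have lv j : loclip (fun _ : 'rV[R]_(n + n) => v 0 j) w0 by exact: lc.
  have lDA := loclip_mxform (fun k l => lDa _ k l ly) ly ly.
  have lDB := loclip_rowform (fun l => lDb _ l ly) ly.
  apply: loclipD.
    apply: loclipD; first (apply: loclipD; first (apply: loclipD)).
    - apply: loclipM; first by apply: loclipD; exact: loclipM.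
      by apply: loclipM => //; exact: loclip_mxform.
    - apply: loclipM => //; apply: loclipM => //.
      by apply: loclip_mxform => // k l; exact: lDa.
    - apply: loclipM; first by apply: loclipD; exact: loclipM.
      exact: loclip_rowform.
    - apply: loclipM => //.
      by apply: loclip_rowform => // l; exact: lDb.
  apply: loclipN; apply: loclipD; apply: loclipM => //.
    by apply: loclip_mxform => // k l; exact: lDa.
  by apply: loclip_rowform => // l; exact: lDb.
pose g (w : 'rV[R]_(n + n)) := energy_yy a b (lsubmx w) (rsubmx w).
have lg k l : loclip (fun w => g w k l) w0.
  under eq_fun do rewrite -mxform_delta /g energy_yyE.
  have ld k' j : loclip (fun _ : 'rV[R]_(n + n) => (delta_mx 0 k' : 'rV[R]_n) 0 j) w0.
    exact: lc.
  have l1 k' : loclip (fun w : 'rV[R]_(n + n) =>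
      mxform (a (lsubmx w)) (rsubmx w) (delta_mx 0 k')) w0.
    exact: loclip_mxform.
  have l2 k' : loclip (fun w : 'rV[R]_(n + n) =>
      rowform (b (lsubmx w)) (delta_mx 0 k')) w0.
    exact: loclip_rowform.
  apply: loclipD; first (apply: loclipD; first (apply: loclipD)).
  - apply: loclipM => //; exact: loclip_mxform.
  - by apply: loclipM; apply: loclipM.
  - by apply: loclipM => //; apply: loclipD; apply: loclipM.
  - by apply: loclipM; apply: loclipM.
have gu z v : U z -> v != 0 -> energy_yy a b z v \in unitmx.
  by move=> Uz v0; apply: posdef_unitmx => u u0; exact: (energy_yy_pos data).
have near_ok : \forall w \near w0, U (lsubmx w) /\ rsubmx w != 0.
  have [r1 /= r10 ballU] : exists2 r : R, 0 < r & ball x r `<=` U.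
    by apply/nbhs_ballP; exact: open_nbhs_nbhs.
  have y_gt0 : 0 < `|y| by rewrite normr_gt0.
  apply/nbhs_ballP; exists (Num.min r1 `|y|); first by rewrite /= lt_min r10.
  move=> w; rewrite -ball_normE /ball_/= lt_min => /andP[h1 h2]; split.
    apply: ballU; rewrite -ball_normE /ball_/= -lx0.
    apply: le_lt_trans h1; apply/mx_norm_leP => // k l; rewrite !mxE ord1.
    by have := mx_entry_le_norm (w0 - w) 0 (lshift n l); rewrite !mxE.
  apply: contraTneq h2 => w_0; rewrite -leNgt.
  apply/mx_norm_leP => // k l; rewrite ord1.
  have := mx_entry_le_norm (w0 - w) 0 (rshift n l).
  have := congr1 (fun u : 'rV[R]_n => u 0 l) w_0; rewrite -ry0 !mxE => ->.
  by rewrite subr0.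
apply: (@loclip_near_eq _ _ _ (fun w => 4^-1 * \sum_l
    euler_form a b (lsubmx w) (rsubmx w) (delta_mx 0 l) *
      ((\adj (g w)) i l / \det (g w)))).
  apply: loclipM => //; apply: loclip_sum => l; apply: loclipM => //.
  apply: loclip_div; [exact: loclip_adj|exact: loclip_det|].
  by have := gu _ _ Ux y0; rewrite unitmxE unitfE /g lx0 ry0.
apply: filterS near_ok => w [Uw w_0].
rewrite (spray_squareE data Uw w_0) [RHS]mxE [X in _ = _ * X]mxE.
congr (_ * _); apply: eq_bigr => l _.
rewrite [X in _ = X * _]mxE [X in _ = _ * X]mxE; congr (_ * _).
by rewrite /invmx (gu _ _ Uw w_0) [RHS]mxE mulrC.
Qed.

(** Hamel's criterion: the geodesics are straight exactly when the straight
    lines, suitably parametrized, satisfy the Euler-Lagrange equations. *)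
Lemma straight_squareP :
  geodesics_straight (square_fun a b) U <->
  forall x y, U x -> y != 0 ->
    exists k, forall v, euler_form a b x y v = k * energy_y a b x y v.
Proof.
split=> [straight x y Ux y0|h].
  apply/(spray_parallelP data Ux y0).
  apply: (straight_spray_parallel (sq_open data) Ux y0 _ straight).
  exact: loclip_spray_square.
apply: spray_parallel_straight => x y Ux y0.
exact/(spray_parallelP data Ux y0)/h.
Qed.

End SquareStraight.

(** * The pointwise equations of a projectively flat square metric *)

Lemma poly6_eq0 (R : realFieldType) (c0 c1 c2 c3 c4 c5 c6 : R) :
  (forall p, c0 + c1 * p + c2 * p ^+ 2 + c3 * p ^+ 3 + c4 * p ^+ 4 + c5 * p ^+ 5
     + c6 * p ^+ 6 = 0) ->
  [/\ c0 = 0, c1 = 0, c2 = 0 & c3 = 0] /\ [/\ c4 = 0, c5 = 0 & c6 = 0].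
Proof.
move=> h; have := h 0; have := h 1; have := h (-1); have := h 2; have := h (-2).
have := h 3; have := h (-3) => h1 h2 h3 h4 h5 h6 h7.
by split; split; lra.
Qed.

(** The polynomial [B * (1 - B) * p ^+ 2 + (1 + 2 * B) * m] has no common root
    with [B * p ^+ 2 + m], so it divides the quadratic polynomial [r]. *)
Lemma divides_quadratic (R : realFieldType)
    (B m r11 r12 r22 g0 g1 g2 h0 h1 h2 h3 : R) : 0 < B < 1 -> 0 < m ->
  (forall p, let A := B * p ^+ 2 + m in
    ((1 + 2 * B) * A - 3 * (p * B) ^+ 2)
      * (A * (g2 * p ^+ 2 + g1 * p + g0)
         - (h3 * p ^+ 3 + h2 * p ^+ 2 + h1 * p + h0) * (p * B))
    + 4 * (r11 * p ^+ 2 + 2 * r12 * p + r22) * A * (A * B - (p * B) ^+ 2) = 0) ->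
  r12 = 0 /\ r22 * (B * (1 - B)) = r11 * ((1 + 2 * B) * m).
Proof.
move=> /andP[B0 B1] m0 h.
pose d2 := B * (1 - B); pose d0 := (1 + 2 * B) * m; pose M := 4 * (m * B).
pose n4 := B * g2 - h3 * B; pose n3 := B * g1 - h2 * B.
pose n2 := B * g0 + m * g2 - h1 * B; pose n1 := m * g1 - h0 * B.
pose n0 := m * g0.
have [|[e0 e1 e2 e3] [e4 e5 e6]] := @poly6_eq0 R (d0 * n0 + r22 * m * M)
  (d0 * n1 + 2 * r12 * m * M) (d0 * n2 + d2 * n0 + (r22 * B + r11 * m) * M)
  (d0 * n3 + d2 * n1 + 2 * r12 * B * M) (d0 * n4 + d2 * n2 + r11 * B * M)
  (d2 * n3) (d2 * n4).
  move=> p; rewrite -[RHS](h p) /d0 /d2 /M /n0 /n1 /n2 /n3 /n4 /=; ring.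
have d20 : d2 != 0 by rewrite gt_eqF// mulr_gt0//; lra.
have M0 : M != 0 by rewrite gt_eqF// !mulr_gt0.
have n30 : n3 = 0 by apply: (mulfI d20); rewrite e5 mulr0.
have n40 : n4 = 0 by apply: (mulfI d20); rewrite e6 mulr0.
have q0 : B * d0 - m * d2 != 0.
  have -> : B * d0 - m * d2 = 3 * (B * B * m) by rewrite /d0 /d2; ring.
  by rewrite gt_eqF// !mulr_gt0.
rewrite n30 in e3; rewrite n40 in e4; split.
  apply: (mulfI (mulf_neq0 (mulf_neq0 M0 q0) (_ : 2 != 0))) => //.
  rewrite mulr0.
  have -> : M * (B * d0 - m * d2) * 2 * r12 =
     d0 * (d0 * 0 + d2 * n1 + 2 * r12 * B * M) - d2 * (d0 * n1 + 2 * r12 * m * M).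
    by ring.
  by rewrite e3 e1; ring.
rewrite -/d0 -/d2; apply: (mulfI (mulf_neq0 M0 q0)); apply/eqP.
rewrite -subr_eq0; apply/eqP.
have -> : M * (B * d0 - m * d2) * (r22 * d2) - M * (B * d0 - m * d2) * (r11 * d0)
  = d0 * d2 * (d0 * n2 + d2 * n0 + (r22 * B + r11 * m) * M)
    - d0 ^+ 2 * (d0 * 0 + d2 * n2 + r11 * B * M)
    - d2 ^+ 2 * (d0 * n0 + r22 * m * M) by ring.
by rewrite e0 e2 e4; ring.
Qed.

Section PointEquations.
Context {R : realType} {n : nat}.
Variables (U : set 'rV[R]_n).
Variables (a : 'rV[R]_n -> 'M[R]_n) (b : 'rV[R]_n -> 'rV[R]_n).
Implicit Types (x y u v w : 'rV[R]_n).

(** Four times the spray of the metric, with its index lowered. *)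
Definition metric_spray x y v : R :=
  2 * mxform (Dmx a x y) y v - mxform (Dmx a x v) y y.

(** The exterior derivative of the 1-form. *)
Definition curl x u v : R := rowform (Drow b x u) v - rowform (Drow b x v) u.

(** The symmetrized covariant derivative of the 1-form, for the Levi-Civita
    connection. *)
Definition sym_cov x u v : R :=
  2^-1 * (rowform (Drow b x u) v + rowform (Drow b x v) u)
  - 2^-1 * (mxform (Dmx a x u) v (sharp a b x) + mxform (Dmx a x v) u (sharp a b x)
     - mxform (Dmx a x (sharp a b x)) u v).

(** The quadratic form to which the covariant derivative of the 1-form of a
    projectively flat square metric is proportional. *)
Definition flat_quadratic x y : R :=
  (1 + 2 * rowform (b x) (sharp a b x)) * mxform (a x) y y
  - 3 * rowform (b x) y ^+ 2.

(** The Euler-Lagrange covector of F itself, instead of its energy, multiplied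
    by alpha ^+ 5 / 2 to clear the denominators. *)
Definition hamel_form x y v : R :=
  let A := mxform (a x) y y in let B := rowform (b x) y in
  let DA := mxform (Dmx a x y) y y in let DB := rowform (Drow b x y) y in
  (A - B ^+ 2) * A * metric_spray x y v / 4
  + (alpha_of a x y + B) * A ^+ 2 * curl x y v
  + ((3 * B ^+ 2 - A) * DA / 4 - B * A * DB) * mxform (a x) y v
  + (A ^+ 2 * DB - B * A * DA / 2) * rowform (b x) v.

Hypothesis data : square_data U a b.

Variables (x : 'rV[R]_n).
Hypothesis Ux : U x.

Let sa := sq_sym data Ux.
Let pa := sq_pos data Ux.
Let sDa w : (Dmx a x w)^T = Dmx a x w.
Proof. exact: Dmx_sym (sq_open data) Ux (@sq_sym _ _ _ _ _ data). Qed.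

Local Notation e := (sharp a b x).
Local Notation Bn := (rowform (b x) e).

Lemma rowform_sharp_gt0 : b x != 0 -> 0 < Bn.
Proof.
move=> b0; rewrite -(mxform_sharp data Ux); apply: pa.
apply: contraNneq b0 => e0; have := metric_unit data Ux => au.
by rewrite -[b x](mulmxKV au) -/e e0 mul0mx.
Qed.

(** The Cauchy-Schwarz inequality bounds the form below by (1 - B) A, where B < 1
    is the squared norm of [b]. *)
Lemma flat_quadratic_gt0 y : y != 0 -> 0 < flat_quadratic x y.
Proof.
move=> y0; rewrite /flat_quadratic.
have [+ _] := cauchy_schwarz_mxform e sa pa y0.
rewrite (mxform_sharp data Ux) (mxformC _ _ sa) (mxform_sharp data Ux) subr_ge0.
have A0 := pa y0; have := rowform_sharp_lt1 data Ux.
move: (mxform _ y y) A0 Bn => A A0 B B1 h; have : A * B < A * 1.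
  by rewrite ltr_pM2l.
by move: h; lra.
Qed.

(** Homogeneity: evaluating the covectors at [v = y] determines the factor [k],
    and with this factor the difference of the two sides is a multiple of the
    Euler-Lagrange covector of F. *)
Lemma hamelP y : y != 0 ->
  (exists k, forall v, euler_form a b x y v = k * energy_y a b x y v) <->
  forall v, hamel_form x y v = 0.
Proof.
move=> y0; have P0 := alpha_gt0 data Ux y0; have PE := sqr_alpha data Ux y0.
have [BP1 BP2] := form_lt_alpha data Ux y0.
have eulerE v : euler_form a b x y v =
    sqLA (alpha_of a x y) (rowform (b x) y) * metric_spray x y v
    + sqLB (alpha_of a x y) (rowform (b x) y) * curl x y v
    + (sqLAA (alpha_of a x y) (rowform (b x) y) * mxform (Dmx a x y) y y
       + sqLAB (alpha_of a x y) (rowform (b x) y) * rowform (Drow b x y) y)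
      * (2 * mxform (a x) y v)
    + (sqLAB (alpha_of a x y) (rowform (b x) y) * mxform (Dmx a x y) y y
       + sqLBB (alpha_of a x y) (rowform (b x) y) * rowform (Drow b x y) y)
      * rowform (b x) v.
  by rewrite /euler_form /metric_spray /curl /=; ring.
set P := alpha_of a x y in P0 PE BP1 BP2 eulerE *.
set B := rowform (b x) y in BP1 BP2 eulerE *.
set DA := mxform (Dmx a x y) y y in eulerE *.
set DB := rowform (Drow b x y) y in eulerE *.
have PB0 : P + B != 0 by rewrite gt_eqF//; lra.
have P_neq0 : P != 0 by rewrite gt_eqF.
pose k := (sqLA P B * DA + sqLB P B * DB) / (2 * (P + B) ^+ 4 / P ^+ 2).
have key v : euler_form a b x y v - k * energy_y a b x y v =
    4 * (P + B) ^+ 2 / P ^+ 6 * hamel_form x y v.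
  rewrite eulerE /energy_y /hamel_form -/P -/B -/DA -/DB -PE /k.
  rewrite /sqLAA /sqLAB /sqLBB /sqLA /sqLB.
  by field; rewrite PB0 P_neq0.
split=> [[k' hk'] v|h].
  have curl_yy : curl x y y = 0 by rewrite /curl subrr.
  have spray_yy : metric_spray x y y = DA by rewrite /metric_spray -/DA; ring.
  have kk : k' = k.
    have := hk' y; rewrite eulerE curl_yy spray_yy /energy_y -PE -/P -/B => hy.
    have c0 : 2 * (P + B) ^+ 4 / P ^+ 2 != 0.
      by rewrite !mulf_neq0 ?invr_neq0 ?expf_neq0.
    apply: (mulIf c0); rewrite /k mulfVK//.
    have -> : k' * (2 * (P + B) ^+ 4 / P ^+ 2) =
        k' * (sqLA P B * (2 * P ^+ 2) + sqLB P B * B).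
      by rewrite /sqLA /sqLB; field.
    by rewrite -hy /sqLAA /sqLAB /sqLBB /sqLA /sqLB; field.
  have := key v; rewrite hk' kk subrr => /esym/eqP.
  by rewrite mulf_eq0 !mulf_eq0 invr_eq0 !expf_eq0/= (negbTE PB0) (negbTE P_neq0)
    pnatr_eq0/= => /eqP.
by exists k => v; apply/eqP; rewrite -subr_eq0 key h mulr0.
Qed.

Section Necessary.
Hypothesis hamel : forall y, y != 0 -> forall v, hamel_form x y v = 0.

(** Only the exterior derivative changes sign relatively to the other terms
    under [y |-> - y]. *)
Lemma hamel_closed u v : curl x u v = 0.
Proof.
have [->|u0] := eqVneq u 0.
  rewrite /curl -(scale0r (0 : 'rV[R]_n)) DrowZ rowformZl rowformZr.
  by rewrite !mul0r subrr.
have Nu0 : - u != 0 by rewrite oppr_eq0.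
have P0 := alpha_gt0 data Ux u0; have PE := sqr_alpha data Ux u0.
have PN : alpha_of a x (- u) = alpha_of a x u.
  by rewrite /alpha_of mxformNl mxformNr opprK.
have := hamel Nu0 v; have := hamel u0 v.
rewrite /hamel_form /metric_spray /curl PN.
have -> : Dmx a x (- u) = (-1) *: Dmx a x u by rewrite -scaleN1r DmxZ.
have -> : Drow b x (- u) = (-1) *: Drow b x u by rewrite -scaleN1r DrowZ.
rewrite !(mxform_scalemx, rowformZl, mxformNl, mxformNr, rowformNr) -PE.
move: (alpha_of a x u) P0 => P P0 h1 h2.
have c0 : 2 * P ^+ 5 != 0 by rewrite mulf_neq0 ?expf_neq0 ?gt_eqF.
apply: (mulfI c0); rewrite mulr0.
by move: h1 h2; lra.
Qed.

Lemma sym_cov_quad y : sym_cov x y y = rowform (Drow b x y) y - metric_spray x y e / 2.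
Proof. by rewrite /sym_cov /metric_spray; field. Qed.

(** Evaluated on the dual vector of [b], Hamel's equations contain only the
    components of the spray along this vector and along [y]. *)
Lemma hamel_contracted y :
  flat_quadratic x y * (mxform (a x) y y * metric_spray x y e
     - mxform (Dmx a x y) y y * rowform (b x) y)
  + 4 * sym_cov x y y * mxform (a x) y y
    * (mxform (a x) y y * Bn - rowform (b x) y ^+ 2) = 0.
Proof.
have [->|y0] := eqVneq y 0.
  rewrite -(scale0r (0 : 'rV[R]_n)) !mxformZl !rowformZr !DmxZ !mxform_scalemx.
  by ring.
have A0 := pa y0; have := hamel y0 e.
rewrite /hamel_form hamel_closed (mxformC y e sa) (mxform_sharp data Ux).
have -> : rowform (Drow b x y) y = sym_cov x y y + metric_spray x y e / 2.
  by rewrite sym_cov_quad subrK.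
rewrite /flat_quadratic; move: (mxform (a x) y y) A0 => A A0 h.
by rewrite -[RHS](mulr0 4) -[in RHS]h; field.
Qed.

(** It suffices to consider the planes spanned by the dual vector [e] of [b] and
    a vector [u] orthogonal to it. On the line [p *: e + u] the contracted
    equation is a polynomial identity in [p]. *)
Lemma sym_cov_eq_nonzero : b x != 0 -> exists t, forall y,
  sym_cov x y y = t * flat_quadratic x y.
Proof.
move=> b0; have B0 := rowform_sharp_gt0 b0; have B1 := rowform_sharp_lt1 data Ux.
exists (sym_cov x e e / (Bn * (1 - Bn))) => y.
have Bn0 : Bn != 0 by rewrite gt_eqF.
have B10 : 1 - Bn != 0 by rewrite gt_eqF// subr_gt0.
have d0 : Bn * (1 - Bn) != 0 by rewrite mulf_neq0.
have [p0 [u [bu yE]]] : exists p0 u, rowform (b x) u = 0 /\ y = p0 *: e + u.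
  exists (rowform (b x) y / Bn), (y - (rowform (b x) y / Bn) *: e).
  split; last by rewrite addrC subrK.
  by rewrite rowformDr rowformNr rowformZr mulfVK ?subrr// gt_eqF.
have scE p : sym_cov x (p *: e + u) (p *: e + u) =
    p ^+ 2 * sym_cov x e e + 2 * p * sym_cov x e u + sym_cov x u u.
  rewrite /sym_cov !(DmxD, DmxZ, DrowD, DrowZ, mxformDr, mxformZr, mxformDl,
    mxformZl, rowformDr, rowformZr, mxform_addmx, mxform_scalemx, rowformDl,
    rowformZl) !(mxformC u e (sDa _)).
  by field.
have AE p : mxform (a x) (p *: e + u) (p *: e + u) = Bn * p ^+ 2 + mxform (a x) u u.
  rewrite !(mxformDr, mxformZr, mxformDl, mxformZl) (mxformC u e sa).
  by rewrite !(mxform_sharp data Ux) bu; ring.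
have bE p : rowform (b x) (p *: e + u) = p * Bn.
  by rewrite rowformDr rowformZr bu addr0.
rewrite yE scE /flat_quadratic AE bE.
have [u0|u0] := eqVneq u 0.
  rewrite u0 -(scale0r (0 : 'rV[R]_n)) mxformZl /sym_cov.
  rewrite !(DmxZ, DrowZ, mxformZr, mxformZl, rowformZr, mxform_scalemx, rowformZl).
  by field; rewrite ?Bn0 ?B10.
have m0 := pa u0; have B01 : 0 < Bn < 1 by rewrite B0.
have [|r12 r22] := @divides_quadratic R Bn (mxform (a x) u u) (sym_cov x e e)
  (sym_cov x e u) (sym_cov x u u)
  (metric_spray x u e)
  (2 * mxform (Dmx a x e) u e + 2 * mxform (Dmx a x u) e e
     - 2 * mxform (Dmx a x e) e u)
  (metric_spray x e e)
  (mxform (Dmx a x u) u u)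
  (mxform (Dmx a x e) u u + 2 * mxform (Dmx a x u) e u)
  (2 * mxform (Dmx a x e) e u + mxform (Dmx a x u) e e)
  (mxform (Dmx a x e) e e) B01 m0.
  move=> p /=; rewrite -[RHS](hamel_contracted (p *: e + u)).
  rewrite /flat_quadratic AE bE scE /metric_spray.
  rewrite !(DmxD, DmxZ, mxformDr, mxformZr, mxformDl, mxformZl, mxform_addmx,
    mxform_scalemx) !(mxformC u e (sDa _)).
  by ring.
rewrite r12.
have -> : sym_cov x u u =
    sym_cov x e e * ((1 + 2 * Bn) * mxform (a x) u u) / (Bn * (1 - Bn)).
  by rewrite -r22 mulfK.
by field; rewrite ?Bn0 ?B10.
Qed.

(** Once the covariant derivative of [b] is known, the contracted equation gives
    the component of the spray along the dual vector of [b]; Hamel's equations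
    are then solved for the spray, with the positive coefficient (A - b ^ 2) A. *)
Lemma hamel_spray t y : y != 0 ->
  (forall y, sym_cov x y y = t * flat_quadratic x y) ->
  exists k, forall v,
    metric_spray x y v + 4 * t * mxform (a x) y y * rowform (b x) v
    = k * mxform (a x) y v.
Proof.
move=> y0 ht; have A0 := pa y0; have D0 := flat_quadratic_gt0 y0.
have hB := form_lt_metric data Ux y0.
pose A := mxform (a x) y y; pose B := rowform (b x) y.
pose DA := mxform (Dmx a x y) y y; pose DB := rowform (Drow b x y) y.
have gE : A * metric_spray x y e = DA * B - 4 * t * A * (A * Bn - B ^+ 2).
  have D_neq0 : flat_quadratic x y != 0 by rewrite gt_eqF.
  apply: (mulfI D_neq0); have := hamel_contracted y.
  by rewrite ht -/A -/B -/DA => h; move: h; lra.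
have DBE : A * DB = t * A * (A - B ^+ 2) + DA * B / 2.
  have -> : DB = t * flat_quadratic x y + metric_spray x y e / 2.
    by rewrite -ht sym_cov_quad subrK.
  have -> : A * (t * flat_quadratic x y + metric_spray x y e / 2) =
     t * A * flat_quadratic x y + A * metric_spray x y e / 2 by ring.
  by rewrite gE /flat_quadratic -/A -/B; field.
exists (- 4 * ((3 * B ^+ 2 - A) * DA / 4 - B * A * DB) / ((A - B ^+ 2) * A)) => v.
have c0 : (A - B ^+ 2) * A != 0.
  by rewrite mulf_neq0 ?gt_eqF// subr_gt0.
apply: (mulfI c0); rewrite [in RHS]mulrA [(A - B ^+ 2) * A * (_ / _)]mulrC mulfVK//.
have := hamel y0 v; rewrite /hamel_form hamel_closed -/A -/B -/DA -/DB.
have -> : A ^+ 2 * DB = A * (A * DB) by ring.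
by rewrite DBE => h; apply/eqP; rewrite -subr_eq0 -(mulr0 4) -h; apply/eqP; field.
Qed.

End Necessary.

Lemma hamel_sufficient t : (forall u v, curl x u v = 0) ->
  (forall y, sym_cov x y y = t * flat_quadratic x y) ->
  (forall y, y != 0 -> exists k, forall v,
    metric_spray x y v + 4 * t * mxform (a x) y y * rowform (b x) v
    = k * mxform (a x) y v) ->
  forall y, y != 0 -> forall v, hamel_form x y v = 0.
Proof.
move=> hcurl hsym hspray y y0 v; have A0 := pa y0.
have [k hk] := hspray y y0.
pose A := mxform (a x) y y; pose B := rowform (b x) y.
pose DA := mxform (Dmx a x y) y y; pose DB := rowform (Drow b x y) y.
have sE w : metric_spray x y w = k * mxform (a x) y w - 4 * t * A * rowform (b x) w.
  by rewrite -hk addrK.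
have DAE : DA = k * A - 4 * t * A * B.
  by rewrite -sE /metric_spray -/DA; ring.
have DBE : DB = t * flat_quadratic x y + metric_spray x y e / 2.
  by rewrite -hsym sym_cov_quad subrK.
have {}DBE : DB = t * ((1 + 2 * Bn) * A - 3 * B ^+ 2)
    + (k * B - 4 * t * A * Bn) / 2.
  by rewrite DBE /flat_quadratic sE (mxformC y e sa) (mxform_sharp data Ux).
rewrite /hamel_form hcurl -/A -/B -/DA -/DB sE DAE DBE.
by field.
Qed.

End PointEquations.

(** * Smooth functions *)

Lemma near_eq_differentiable (R : realType) (V W : normedModType R)
    (f g : V -> W) (x : V) :
  (\near x, f x = g x) -> differentiable f x -> differentiable g x.
Proof.
move=> fg df; have e : f x = g x by exact: nbhs_singleton fg.
have H : g \o shift x = cst (g x) + 'd f x +o_ 0 id.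
  apply/eqaddoP => eps eps0.
  have /diff_locallyP[_ /eqaddoP /(_ _ eps0)] := df.
  have : \forall y \near 0, f (y + x) = g (y + x).
    have := fg; rewrite (near_shift 0) subr0 => h.
    by apply: filterS h => y; rewrite /= .
  by apply: filterS2 => y; rewrite !fctE /= /cst => <-; rewrite e.
have E : 'd g x = 'd f x :> (V -> W).
  by apply: diff_unique H; exact: diff_continuous.
by apply/diff_locallyP; rewrite E; split => //; exact: diff_continuous.
Qed.

Section SmoothAlgebra.
Context {R : realType} {n : nat}.
Variable U : set 'rV[R]_n.
Hypothesis oU : open U.
Implicit Types (f g : 'rV[R]_n -> R).

(** The functions obtained from smooth ones by field operations and square
    roots. Up to equality on [U] this class is stable under partial
    derivatives, hence it consists of smooth functions. *)
Inductive smooth_closure : ('rV[R]_n -> R) -> Prop :=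
| SmoothBase f : smooth_on U f -> smooth_closure f
| SmoothAdd f g : smooth_closure f -> smooth_closure g ->
    smooth_closure (fun x => f x + g x)
| SmoothMul f g : smooth_closure f -> smooth_closure g ->
    smooth_closure (fun x => f x * g x)
| SmoothInv f : smooth_closure f -> (forall x, U x -> f x != 0) ->
    smooth_closure (fun x => (f x)^-1)
| SmoothSqrt f : smooth_closure f -> (forall x, U x -> 0 < f x) ->
    smooth_closure (fun x => Num.sqrt (f x)).

Lemma foldr_partial_eq_on f g s : (forall x, U x -> f x = g x) ->
  forall x, U x -> foldr (@partial R n) f s x = foldr (@partial R n) g s x.
Proof.
move=> fg; elim: s => [|i s IH] x Ux /=; first exact: fg.
by apply: near_eq_partial; apply: (open_near oU Ux).
Qed.

Lemma smooth_eq_on f g : (forall x, U x -> f x = g x) ->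
  smooth_on U f -> smooth_on U g.
Proof.
move=> fg sf s x Ux; apply: near_eq_differentiable (sf s x Ux).
by apply: (open_near oU Ux) => z Uz; exact: foldr_partial_eq_on.
Qed.

Lemma smooth_partial f i : smooth_on U f -> smooth_on U (partial i f).
Proof.
by move=> sf s z Uz; have := sf (rcons s i) z Uz; rewrite -cats1 foldr_cat.
Qed.

Lemma smooth_cst c : smooth_on U (fun=> c).
Proof.
suff h s : exists d, foldr (@partial R n) (fun=> c) s = (fun=> d).
  by move=> s x _; have [d ->] := h s; exact: differentiable_cst.
elim: s => [|i s [d IH]] /=; first by exists c.
exists 0; rewrite IH; apply/funext => x.
by rewrite /partial (derive_cst (d : R)).
Qed.

Lemma smooth_closure_differentiable f x : smooth_closure f -> U x ->
  differentiable f x.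
Proof.
move=> sf Ux; elim: sf => {f}.
- by move=> f sf; exact: (sf [::]).
- by move=> f g _ df _ dg; exact: differentiableD.
- by move=> f g _ df _ dg; exact: differentiableM.
- by move=> f _ df f0; apply: differentiableV => //; exact: f0.
- move=> f _ df f0; apply: (differentiable_comp df).
  by apply/derivable1_diffP; have [] := is_derive1_sqrt (f0 x Ux).
Qed.

Lemma smooth_closure_partial f i : smooth_closure f ->
  exists2 g, smooth_closure g & forall x, U x -> partial i f x = g x.
Proof.
have dp g x : smooth_closure g -> U x ->
    is_derive x (delta_mx 0 i) g (partial i g x).
  by move=> sg Ux; apply: is_derive_partial; exact: smooth_closure_differentiable.
elim=> {f}.
- move=> f sf; exists (partial i f) => //.
  by apply: SmoothBase; exact: smooth_partial.
- move=> f g sf [f' sf' f'E] sg [g' sg' g'E].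
  exists (fun x => f' x + g' x); first exact: SmoothAdd.
  move=> x Ux; rewrite -f'E// -g'E//.
  by have [_] := is_derive_add (dp f x sf Ux) (dp g x sg Ux).
- move=> f g sf [f' sf' f'E] sg [g' sg' g'E].
  exists (fun x => f' x * g x + f x * g' x).
    by apply: SmoothAdd; exact: SmoothMul.
  move=> x Ux; rewrite -f'E// -g'E//.
  by have [_] := is_derive_mul (dp f x sf Ux) (dp g x sg Ux).
- move=> f sf [f' sf' f'E] f0.
  exists (fun x => -1 * f' x * ((f x)^-1 * (f x)^-1)).
    apply: SmoothMul; first by apply: SmoothMul => //; exact/SmoothBase/smooth_cst.
    by apply: SmoothMul; exact: SmoothInv.
  move=> x Ux; rewrite -f'E//.
  have [_ ] := is_derive_inv (f0 x Ux) (dp f x sf Ux).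
  by rewrite /partial => ->; rewrite expr2 invfM mulN1r.
- move=> f sf [f' sf' f'E] f0.
  exists (fun x => f' x * (2^-1 * (Num.sqrt (f x))^-1)).
    apply: SmoothMul => //; apply: SmoothMul; first exact/SmoothBase/smooth_cst.
    apply: SmoothInv; first exact: SmoothSqrt.
    by move=> x Ux; rewrite sqrtr_eq0 -ltNge f0.
  move=> x Ux; rewrite -f'E//.
  have [_ ] := is_derive_sqrt (f0 x Ux) (dp f x sf Ux).
  by rewrite /partial => ->; rewrite invfM.
Qed.

Lemma smooth_closure_smooth f : smooth_closure f -> smooth_on U f.
Proof.
move=> sf s; elim/last_ind: s f sf => [|s i IH] f sf x Ux.
  exact: smooth_closure_differentiable.
have [g sg gE] := smooth_closure_partial i sf.
rewrite -cats1 foldr_cat/=.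
apply: near_eq_differentiable (IH g sg x Ux).
by apply: (open_near oU Ux) => z Uz; rewrite (foldr_partial_eq_on _ gE).
Qed.

Lemma smoothD f g : smooth_on U f -> smooth_on U g ->
  smooth_on U (fun x => f x + g x).
Proof.
by move=> sf sg; apply/smooth_closure_smooth/SmoothAdd; exact: SmoothBase.
Qed.

Lemma smoothM f g : smooth_on U f -> smooth_on U g ->
  smooth_on U (fun x => f x * g x).
Proof.
by move=> sf sg; apply/smooth_closure_smooth/SmoothMul; exact: SmoothBase.
Qed.

Lemma smoothV f : smooth_on U f -> (forall x, U x -> f x != 0) ->
  smooth_on U (fun x => (f x)^-1).
Proof.
move=> sf f0; apply/smooth_closure_smooth/SmoothInv => //.
exact: SmoothBase.
Qed.

Lemma smooth_sqrt f : smooth_on U f -> (forall x, U x -> 0 < f x) ->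
  smooth_on U (fun x => Num.sqrt (f x)).
Proof.
move=> sf f0; apply/smooth_closure_smooth/SmoothSqrt => //.
exact: SmoothBase.
Qed.

Lemma smoothN f : smooth_on U f -> smooth_on U (fun x => - f x).
Proof.
move=> sf; have -> : (fun x => - f x) = (fun x => -1 * f x).
  by apply/funext => x; rewrite mulN1r.
by apply: smoothM => //; exact: smooth_cst.
Qed.

Lemma smooth_sum (I : Type) (r : seq I) (F : I -> 'rV[R]_n -> R) :
  (forall i, smooth_on U (F i)) -> smooth_on U (fun x => \sum_(i <- r) F i x).
Proof.
move=> sF; elim: r => [|i r IH].
  have -> : (fun x => \sum_(i <- [::]) F i x) = (fun=> 0).
    by apply/funext => x; rewrite big_nil.
  exact: smooth_cst.
have -> : (fun x => \sum_(j <- i :: r) F j x) =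
    (fun x => F i x + \sum_(j <- r) F j x).
  by apply/funext => x; rewrite big_cons.
exact: smoothD.
Qed.

Lemma smooth_prod (I : Type) (r : seq I) (F : I -> 'rV[R]_n -> R) :
  (forall i, smooth_on U (F i)) -> smooth_on U (fun x => \prod_(i <- r) F i x).
Proof.
move=> sF; elim: r => [|i r IH].
  have -> : (fun x => \prod_(i <- [::]) F i x) = (fun=> 1).
    by apply/funext => x; rewrite big_nil.
  exact: smooth_cst.
have -> : (fun x => \prod_(j <- i :: r) F j x) =
    (fun x => F i x * \prod_(j <- r) F j x).
  by apply/funext => x; rewrite big_cons.
exact: smoothM.
Qed.

Lemma smooth_det m (M : 'rV[R]_n -> 'M[R]_m) :
  (forall i j, smooth_on U (fun x => M x i j)) -> smooth_on U (fun x => \det (M x)).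
Proof.
move=> sM; rewrite /determinant.
apply: smooth_sum => s; apply: smoothM; first exact: smooth_cst.
by apply: smooth_prod => i; exact: sM.
Qed.

Lemma smooth_ext f g : (forall x, f x = g x) -> smooth_on U f -> smooth_on U g.
Proof. by move=> /funext ->. Qed.

Lemma smooth_invmx m (M : 'rV[R]_n -> 'M[R]_m) :
  (forall i j, smooth_on U (fun x => M x i j)) ->
  (forall x, U x -> M x \in unitmx) ->
  forall i j, smooth_on U (fun x => invmx (M x) i j).
Proof.
move=> sM uM i j.
have s : smooth_on U (fun x => (\det (M x))^-1 * (\adj (M x)) i j).
  apply: smoothM.
    apply: smoothV; first exact: smooth_det.
    by move=> x /uM; rewrite unitmxE unitfE.
  apply: (@smooth_ext (fun x => (-1) ^+ (j + i) * \det (row' j (col' i (M x))))).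
    by move=> x; rewrite mxE.
  apply: smoothM; first exact: smooth_cst.
  apply: smooth_det => k l.
  apply: (@smooth_ext (fun x => M x (lift j k) (lift i l))) => //.
  by move=> x; rewrite !mxE.
by apply: smooth_eq_on s => x Ux; rewrite /invmx (uM x Ux) [RHS]mxE.
Qed.

Lemma smooth_mxform m (M : 'rV[R]_n -> 'M[R]_m) (u v : 'rV[R]_n -> 'rV[R]_m) :
  (forall i j, smooth_on U (fun x => M x i j)) ->
  (forall i, smooth_on U (fun x => u x 0 i)) ->
  (forall i, smooth_on U (fun x => v x 0 i)) ->
  smooth_on U (fun x => mxform (M x) (u x) (v x)).
Proof.
move=> sM su sv; apply: (@smooth_ext
    (fun x => \sum_i \sum_j u x 0 i * M x i j * v x 0 j)).
  by move=> x; rewrite mxformE.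
apply: (@smooth_sum _ _ (fun i x => \sum_j u x 0 i * M x i j * v x 0 j)) => i.
apply: (@smooth_sum _ _ (fun j x => u x 0 i * M x i j * v x 0 j)) => j.
by apply: smoothM => //; exact: smoothM.
Qed.

Lemma smooth_rowform m (u v : 'rV[R]_n -> 'rV[R]_m) :
  (forall i, smooth_on U (fun x => u x 0 i)) ->
  (forall i, smooth_on U (fun x => v x 0 i)) ->
  smooth_on U (fun x => rowform (u x) (v x)).
Proof.
move=> su sv; apply: (@smooth_ext (fun x => \sum_j u x 0 j * v x 0 j)).
  by move=> x; rewrite rowformE.
by apply: (@smooth_sum _ _ (fun j x => u x 0 j * v x 0 j)) => j; exact: smoothM.
Qed.

End SmoothAlgebra.

(** * The covariant derivative of the 1-form on a chart *)

Section MetricCalculus.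
Context {R : realType} {n : nat}.
Variables (U : set 'rV[R]_n).
Variables (a : 'rV[R]_n -> 'M[R]_n) (b : 'rV[R]_n -> 'rV[R]_n).
Hypothesis oU : open U.
Hypothesis smooth_a : forall i j, smooth_on U (fun x => a x i j).
Hypothesis smooth_b : forall j, smooth_on U (fun x => b x 0 j).
Hypothesis sym_a : forall x, U x -> (a x)^T = a x.
Hypothesis pos_a : forall x, U x -> forall v, v != 0 -> 0 < mxform (a x) v v.
Implicit Types (x y u v w : 'rV[R]_n).

Local Notation e := (sharp a b).

Lemma unit_a x : U x -> a x \in unitmx.
Proof. by move=> Ux; apply: posdef_unitmx; exact: pos_a. Qed.

Lemma sharpE x v : U x -> mxform (a x) (e x) v = rowform (b x) v.
Proof. by move=> Ux; rewrite /mxform /sharp mulmxKV// unit_a. Qed.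

Lemma smooth_sharp j : smooth_on U (fun x => e x 0 j).
Proof.
apply: (@smooth_ext _ _ _ (fun x => \sum_k b x 0 k * invmx (a x) k j)).
  by move=> x; rewrite mxE.
apply: smooth_sum => // k; apply: smoothM => //.
by apply: smooth_invmx => // x; exact: unit_a.
Qed.

Lemma smooth_Dmx w i j : smooth_on U (fun x => Dmx a x w i j).
Proof.
apply: (@smooth_ext _ _ _
    (fun x => \sum_k w 0 k * partial k (fun z => a z i j) x)).
  by move=> x; rewrite DmxE.
apply: smooth_sum => // k; apply: smoothM => //; first exact: smooth_cst.
exact: smooth_partial.
Qed.

Lemma smooth_Drow w j : smooth_on U (fun x => Drow b x w 0 j).
Proof.
apply: (@smooth_ext _ _ _
    (fun x => \sum_k w 0 k * partial k (fun z => b z 0 j) x)).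
  by move=> x; rewrite DrowE.
apply: smooth_sum => // k; apply: smoothM => //; first exact: smooth_cst.
exact: smooth_partial.
Qed.

Lemma smooth_norm : smooth_on U (fun x => rowform (b x) (e x)).
Proof. by apply: smooth_rowform => // j; exact: smooth_sharp. Qed.

Lemma smooth_flat_quadratic y : smooth_on U (fun x => flat_quadratic a b x y).
Proof.
have sc (z : 'rV[R]_n) j : smooth_on U (fun=> z 0 j) by exact: smooth_cst.
apply: smoothD => //.
  apply: smoothM => //; last exact: smooth_mxform.
  apply: smoothD => //; first exact: smooth_cst.
  by apply: smoothM => //; [exact: smooth_cst|exact: smooth_norm].
apply: smoothN => //; apply: smoothM => //; first exact: smooth_cst.
by apply: (@smoothM _ _ _ _ (fun x => rowform (b x) y)
  (fun x => rowform (b x) y)) => //; exact: smooth_rowform.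
Qed.

Lemma smooth_sym_cov u v : smooth_on U (fun x => sym_cov a b x u v).
Proof.
have sc (z : 'rV[R]_n) j : smooth_on U (fun=> z 0 j) by exact: smooth_cst.
have sD w1 w2 : smooth_on U (fun x => rowform (Drow b x w1) w2).
  by apply: smooth_rowform => // j; exact: smooth_Drow.
have sA w1 w2 : smooth_on U (fun x => mxform (Dmx a x w1) w2 (e x)).
  by apply: smooth_mxform => // *; [exact: smooth_Dmx|exact: smooth_sharp].
have sE : smooth_on U (fun x => mxform (Dmx a x (e x)) u v).
  apply: smooth_mxform => // i j.
  apply: (@smooth_ext _ _ _
      (fun x => \sum_k e x 0 k * partial k (fun z => a z i j) x)).
    by move=> x; rewrite DmxE.
  apply: smooth_sum => // k; apply: smoothM => //; first exact: smooth_sharp.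
  exact: smooth_partial.
apply: smoothD => //.
  by apply: smoothM => //; [exact: smooth_cst|exact: smoothD].
apply: smoothN => //; apply: smoothM => //; first exact: smooth_cst.
by apply: smoothD => //; [exact: smoothD|exact: smoothN].
Qed.

(** Differentiate [b = e *m a] and contract with [e]: the derivative of [e]
    can be eliminated without differentiating the inverse matrix. *)
Lemma is_derive_norm x w : U x -> (forall u v, curl b x u v = 0) ->
  is_derive x w (fun z => rowform (b z) (e z)) (2 * sym_cov a b x (e x) w).
Proof.
move=> Ux curl0.
have da i j : differentiable (a ^~ i ^~ j) x by exact: (smooth_a i j [::]).
have db j : differentiable (b ^~ 0 ^~ j) x by exact: (smooth_b j [::]).
have de j : differentiable (e ^~ 0 ^~ j) x by exact: (smooth_sharp j [::]).
have bE : Drow b x w = Drow e x w *m a x + e x *m Dmx a x w.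
  apply/rowP => j; rewrite DrowE -(derive_sum_partial _ (db j)).
  have -> : 'D_w (fun z => b z 0 j) x = 'D_w (fun z => \sum_k e z 0 k * a z k j) x.
    apply: near_eq_derive; apply: (open_near oU Ux) => z Uz.
    by rewrite -[b z](mulmxKV (unit_a Uz)) -/(e z) mxE.
  have [_ ->] := is_derive_bigsum (fun k => is_derive_mul
    (is_derive_sum_partial w (de k)) (is_derive_sum_partial w (da k j))).
  rewrite !mxE big_split/=; congr (_ + _); apply: eq_bigr => k _.
    by rewrite DrowE.
  by rewrite DmxE.
have := is_derive_bigsum (fun j => is_derive_mul
    (is_derive_sum_partial w (db j)) (is_derive_sum_partial w (de j))).
have -> : (fun z => \sum_i b z 0 i * e z 0 i) = (fun z => rowform (b z) (e z)).
  by apply/funext => z; rewrite rowformE.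
move=> /is_derive_eq; apply; rewrite big_split/=.
have -> : \sum_i (\sum_k w 0 k * partial k (fun z => b z 0 i) x) * e x 0 i =
    rowform (Drow b x w) (e x).
  by rewrite rowformE; apply: eq_bigr => i _; rewrite DrowE.
have -> : \sum_i b x 0 i * (\sum_k w 0 k * partial k (fun z => e z 0 i) x) =
    rowform (b x) (Drow e x w).
  by rewrite rowformE; apply: eq_bigr => i _; rewrite DrowE.
have h1 : rowform (b x) (Drow e x w) =
    rowform (Drow b x w) (e x) - mxform (Dmx a x w) (e x) (e x).
  rewrite bE rowformDl !rowform_mulmx addrK -sharpE//.
  exact: mxformC (sym_a Ux).
rewrite h1 /sym_cov; have := curl0 w (e x); rewrite /curl => hc.
have -> : rowform (Drow b x (e x)) w = rowform (Drow b x w) (e x).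
  by apply/esym/subr0_eq.
have sD : (Dmx a x (e x))^T = Dmx a x (e x) by exact: Dmx_sym oU Ux sym_a.
by rewrite (mxformC w (e x) sD); field.
Qed.

Lemma sym_covC x u v : U x -> sym_cov a b x u v = sym_cov a b x v u.
Proof.
move=> Ux; rewrite /sym_cov.
have sD w : (Dmx a x w)^T = Dmx a x w by exact: Dmx_sym oU Ux sym_a.
by rewrite (mxformC v u (sD _)); ring.
Qed.

Lemma sym_cov_polar x t : U x ->
  (forall y, sym_cov a b x y y = t * flat_quadratic a b x y) ->
  forall u v, sym_cov a b x u v =
    t * ((1 + 2 * rowform (b x) (e x)) * mxform (a x) u v
         - 3 * rowform (b x) u * rowform (b x) v).
Proof.
move=> Ux h u v; have := h (u + v); have := h u; have := h v.
have -> : sym_cov a b x (u + v) (u + v) =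
    sym_cov a b x u u + 2 * sym_cov a b x u v + sym_cov a b x v v.
  have := sym_covC v u Ux; rewrite /sym_cov.
  rewrite !(DmxD, DrowD, mxformDr, mxformDl, rowformDr, mxform_addmx, rowformDl).
  by move=> hh; lra.
rewrite /flat_quadratic !(mxformDr, mxformDl, rowformDr).
rewrite (mxformC v u (sym_a Ux)); set k := 1 + 2 * _.
by move=> h1 h2 h3; nra.
Qed.

End MetricCalculus.

Section FlatOnChart.
Context {R : realType} {n : nat}.
Variables (U : set 'rV[R]_n).
Variables (a : 'rV[R]_n -> 'M[R]_n) (b : 'rV[R]_n -> 'rV[R]_n).
Hypothesis data : square_data U a b.

(** At a zero of [b] the Hamel equations at that point leave the covariant
    derivative of [b] free. There it is constrained by continuity, unless [b]
    vanishes around the point, in which case it is zero. *)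
Lemma hamel_sym_cov :
  (forall x y, U x -> y != 0 -> forall v, hamel_form a b x y v = 0) ->
  forall x, U x -> exists t, forall y,
    sym_cov a b x y y = t * flat_quadratic a b x y.
Proof.
move=> hamel x Ux.
have oU := sq_open data.
have prop y z : sym_cov a b x y y * flat_quadratic a b x z =
    sym_cov a b x z z * flat_quadratic a b x y.
  pose phi x := sym_cov a b x y y * flat_quadratic a b x z -
    sym_cov a b x z z * flat_quadratic a b x y.
  apply: subr0_eq; apply/eqP/negPn/negP => phi0.
  have sphi : smooth_on U phi.
    have sS w : smooth_on U (fun x => sym_cov a b x w w).
      by apply: smooth_sym_cov => //; [exact: (sq_smooth_mx data)|
        exact: (sq_smooth_row data)|exact: (sq_pos data)].
    have sF w : smooth_on U (fun x => flat_quadratic a b x w).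
      by apply: smooth_flat_quadratic => //; [exact: (sq_smooth_mx data)|
        exact: (sq_smooth_row data)|exact: (sq_pos data)].
    by apply: smoothD => //; [exact: smoothM|apply: smoothN => //; exact: smoothM].
  have near_phi : \forall u \near x, phi u != 0.
    have cphi : {for x, continuous phi}.
      by apply: differentiable_continuous; exact: (sphi [::]).
    have phi_gt0 : 0 < `|phi x| by rewrite normr_gt0.
    have /cvgrPdist_lt /(_ _ phi_gt0) := cphi.
    by apply: filterS => u; apply: contraTneq => ->; rewrite subr0 ltxx.
  have near_b : \forall u \near x, b u = 0.
    have near_U : \forall u \near x, U u by exact: open_nbhs_nbhs.
    apply: filterS2 near_U near_phi => u Uu; apply: contra_neq_eq => bu.
    have [t ht] := sym_cov_eq_nonzero data Uu (fun y => hamel u y Uu) bu.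
    by rewrite /phi !ht; ring.
  have bx : b x = 0 by exact: nbhs_singleton near_b.
  have Db w : Drow b x w = 0.
    apply/rowP => j; rewrite DrowE mxE big1// => k _.
    have -> : partial k (fun z => b z 0 j) x = partial k (fun=> 0) x.
      by apply: near_eq_partial; apply: filterS near_b => u ->; rewrite mxE.
    by rewrite /partial (derive_cst (0 : R)) mulr0.
  have sc0 w : sym_cov a b x w w = 0.
    have b0 : rowform (0 : 'rV[R]_n) w = 0 by rewrite /rowform mul0mx mxE.
    rewrite /sym_cov Db b0 /sharp bx mul0mx -(scale0r (0 : 'rV[R]_n)).
    by rewrite DmxZ !(mxformZr, mxform_scalemx); ring.
  by move: phi0; rewrite !sc0 !mul0r subrr eqxx.
have [[y0 y00]|n0] := pselect (exists y : 'rV[R]_n, y != 0).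
  exists (sym_cov a b x y0 y0 / flat_quadratic a b x y0) => y.
  have D0 := flat_quadratic_gt0 data Ux y00.
  by rewrite mulrAC prop mulfK// gt_eqF.
exists 0 => y; have -> : y = 0.
  by apply/eqP/negPn/negP => y_0; apply: n0; exists y.
rewrite mul0r /sym_cov -(scale0r (0 : 'rV[R]_n)).
by rewrite !(DmxZ, DrowZ, mxformZl, rowformZr, mxform_scalemx); ring.
Qed.

End FlatOnChart.

(** * Conformal changes of the metric and rescalings of the 1-form *)

Section Conformal.
Context {R : realType} {n : nat}.
Variables (U : set 'rV[R]_n).
Variables (a a' : 'rV[R]_n -> 'M[R]_n) (b b' : 'rV[R]_n -> 'rV[R]_n).
Variables (c h : 'rV[R]_n -> R) (x : 'rV[R]_n) (dc dh : 'rV[R]_n -> R).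
Hypotheses (oU : open U) (Ux : U x) (c0 : c x != 0).
Hypothesis a'E : forall z, U z -> a' z = c z ^+ 2 *: a z.
Hypothesis b'E : forall z, U z -> b' z = h z *: b z.
Hypothesis da : forall i j, differentiable (fun z => a z i j) x.
Hypothesis db : forall j, differentiable (fun z => b z 0 j) x.
Hypothesis hc : forall w, is_derive x w c (dc w).
Hypothesis hh : forall w, is_derive x w h (dh w).
Hypothesis diff_c : differentiable c x.
Hypothesis diff_h : differentiable h x.
Hypothesis unit_ax : a x \in unitmx.
Implicit Types (y u v w : 'rV[R]_n).

Let dcE w : dc w = \sum_k w 0 k * partial k c x.
Proof. exact: is_derive_unique (hc w) (is_derive_sum_partial w diff_c). Qed.

Let dhE w : dh w = \sum_k w 0 k * partial k h x.
Proof. exact: is_derive_unique (hh w) (is_derive_sum_partial w diff_h). Qed.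

Lemma Dmx_conformal w :
  Dmx a' x w = c x ^+ 2 *: Dmx a x w + (2 * c x * dc w) *: a x.
Proof.
apply/matrixP => i j; rewrite !mxE !DmxE dcE !mulr_sumr mulr_suml -big_split/=.
apply: eq_bigr => k _.
have -> : partial k (fun z => a' z i j) x =
    partial k (fun z => c z ^+ 2 * a z i j) x.
  apply: near_eq_partial; apply: (open_near oU Ux) => z Uz.
  by rewrite a'E// mxE.
have [_] := is_derive_mul (is_derive_exp 2 (is_derive_partial k diff_c))
  (is_derive_partial k (da i j)).
by rewrite /partial => ->; rewrite expr1; ring.
Qed.

Lemma Drow_conformal w : Drow b' x w = h x *: Drow b x w + dh w *: b x.
Proof.
apply/rowP => j; rewrite !mxE !DrowE dhE !mulr_sumr mulr_suml -big_split/=.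
apply: eq_bigr => k _.
have -> : partial k (fun z => b' z 0 j) x = partial k (fun z => h z * b z 0 j) x.
  apply: near_eq_partial; apply: (open_near oU Ux) => z Uz.
  by rewrite b'E// mxE.
have [_] := is_derive_mul (is_derive_partial k diff_h) (is_derive_partial k (db j)).
by rewrite /partial => ->; ring.
Qed.

Lemma sharp_conformal : sharp a' b' x = (h x / c x ^+ 2) *: sharp a b x.
Proof.
have c20 : c x ^+ 2 != 0 by rewrite expf_neq0.
rewrite /sharp a'E// b'E// invmxZ ?unitmxZ ?unitfE//.
by rewrite -scalemxAl -scalemxAr scalerA.
Qed.

Lemma metric_spray_conformal y v : metric_spray a' x y v =
  c x ^+ 2 * metric_spray a x y v + 4 * c x * dc y * mxform (a x) y v
  - 2 * c x * dc v * mxform (a x) y y.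
Proof.
by rewrite /metric_spray !Dmx_conformal !(mxform_addmx, mxform_scalemx); ring.
Qed.

Lemma curl_conformal u v : curl b' x u v =
  h x * curl b x u v + dh u * rowform (b x) v - dh v * rowform (b x) u.
Proof. by rewrite /curl !Drow_conformal !(rowformDl, rowformZl); ring. Qed.

Lemma sym_cov_conformal u v : sym_cov a' b' x u v =
  h x * sym_cov a b x u v
  + 2^-1 * (dh u * rowform (b x) v + dh v * rowform (b x) u)
  - h x / c x * (dc u * mxform (a x) v (sharp a b x)
                 + dc v * mxform (a x) u (sharp a b x)
                 - dc (sharp a b x) * mxform (a x) u v).
Proof.
rewrite /sym_cov sharp_conformal !Drow_conformal DmxZ !Dmx_conformal.
rewrite !(mxform_addmx, mxform_scalemx, mxformZr, rowformDl, rowformZl).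
by field.
Qed.

End Conformal.

(** * The equivalence on a chart *)

Section ChartEquations.
Context {R : realType} {n : nat}.
Implicit Types (a : 'rV[R]_n -> 'M[R]_n) (b : 'rV[R]_n -> 'rV[R]_n).
Implicit Types (x y u v w : 'rV[R]_n).

(** The spray of the metric is proportional to the direction, that is, the
    Riemannian case of the condition for straight geodesics. *)
Definition metric_flat_at a x : Prop := forall y, y != 0 ->
  exists k, forall v, metric_spray a x y v = k * mxform (a x) y v.

Definition closed_at b x : Prop := forall u v, curl b x u v = 0.

Definition conformal_at a b x (t : R) : Prop :=
  forall u v, sym_cov a b x u v = t * mxform (a x) u v.

Definition norm2 a b x : R := rowform (b x) (sharp a b x).

Variable U : set 'rV[R]_n.

Section Forward.
Variables (a : 'rV[R]_n -> 'M[R]_n) (b : 'rV[R]_n -> 'rV[R]_n).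
Hypothesis data : square_data U a b.
Hypothesis straight : geodesics_straight (square_fun a b) U.

(** The differentials of the conformal factor [1 - B] and of its square root are
    multiples of [b], by the equation for the covariant derivative of [b]. The
    exponents 1 and 1 / 2 make the terms in [b] cancel both in the spray of the
    metric and in the covariant derivative of the 1-form. *)
Theorem square_straight_decomposition x : U x ->
  let abar z := (1 - norm2 a b z) ^+ 2 *: a z in
  let bbar z := Num.sqrt (1 - norm2 a b z) *: b z in
  [/\ metric_flat_at abar x, closed_at bbar x &
      exists t, conformal_at abar bbar x t].
Proof.
move=> Ux abar bbar.
have oU := sq_open data; have sa := sq_smooth_mx data.
have sb := sq_smooth_row data; have ya := @sq_sym _ _ _ _ _ data.
have pa := @sq_pos _ _ _ _ _ data.
have ham z y : U z -> y != 0 -> forall v, hamel_form a b z y v = 0.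
  by move=> Uz y0; apply/(hamelP data Uz y0)/(straight_squareP data).1.
have hamx y : y != 0 -> forall v, hamel_form a b x y v = 0 by exact: ham.
have curl0 : closed_at b x by exact: (hamel_closed data Ux hamx).
have [t ht] := hamel_sym_cov data ham Ux.
have polar := sym_cov_polar oU ya Ux ht.
have k0 : 0 < 1 - norm2 a b x by rewrite subr_gt0; exact: (rowform_sharp_lt1 data).
have bE v : mxform (a x) (sharp a b x) v = rowform (b x) v.
  exact: (mxform_sharp data Ux).
have bE' v : mxform (a x) v (sharp a b x) = rowform (b x) v.
  by rewrite (mxformC _ _ (ya x Ux)).
pose dc w := - (2 * t * (1 - norm2 a b x) * rowform (b x) w).
have hc w : is_derive x w (fun z => 1 - norm2 a b z) (dc w).
  have := is_derive_sub (is_derive_cst (1 : R) x w)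
    (is_derive_norm oU sa sb ya pa w Ux curl0).
  move=> /is_derive_eq; apply; rewrite polar bE /dc /norm2; ring.
pose s := Num.sqrt (1 - norm2 a b x).
have s0 : s != 0 by rewrite sqrtr_eq0 -ltNge.
have s2 : 1 - norm2 a b x = s ^+ 2 by rewrite sqr_sqrtr// ltW.
pose dh w := - (t * s * rowform (b x) w).
have hh w : is_derive x w (fun z => Num.sqrt (1 - norm2 a b z)) (dh w).
  have := is_derive_sqrt (f := fun z => 1 - norm2 a b z) k0 (hc w).
  by move=> /is_derive_eq; apply; rewrite -/s /dh /dc s2; field.
have sN : smooth_on U (norm2 a b) by exact: smooth_norm.
have s1N : smooth_on U (fun z => 1 - norm2 a b z).
  by apply: smoothD => //; [exact: smooth_cst|exact: smoothN].
have sS : smooth_on U (fun z => Num.sqrt (1 - norm2 a b z)).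
  apply: smooth_sqrt => // z Uz; rewrite subr_gt0.
  exact: (rowform_sharp_lt1 data).
have dx (f : 'rV[R]_n -> R) : smooth_on U f -> differentiable f x.
  by move=> sf; exact: (sf [::]).
have c0 : 1 - norm2 a b x != 0 by rewrite gt_eqF.
have ua := metric_unit data Ux.
have da i j := dx _ (sa i j); have db j := dx _ (sb j).
split.
- move=> y y0; have [k hk] := hamel_spray data Ux hamx y0 ht.
  exists (k + 4 * (1 - norm2 a b x)^-1 * dc y) => v.
  rewrite (metric_spray_conformal (c := fun z => 1 - norm2 a b z) oU Ux
    (fun _ _ => erefl) da hc (dx _ s1N)).
  have -> : metric_spray a x y v =
      k * mxform (a x) y v - 4 * t * mxform (a x) y y * rowform (b x) v.
    by rewrite -hk addrK.
  by rewrite /abar mxform_scalemx /dc; field.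
- move=> u v.
  rewrite (curl_conformal (h := fun z => Num.sqrt (1 - norm2 a b z)) oU Ux
    (fun _ _ => erefl) db hh (dx _ sS)).
  by rewrite curl0 /dh; ring.
- exists (t * s / (s ^+ 2) ^+ 2) => u v.
  rewrite (sym_cov_conformal (c := fun z => 1 - norm2 a b z)
    (h := fun z => Num.sqrt (1 - norm2 a b z)) oU Ux c0
    (fun _ _ => erefl) (fun _ _ => erefl) da db hc hh (dx _ s1N) (dx _ sS) ua).
  rewrite polar !bE' /abar mxform_scalemx /dc /dh -/s -/(norm2 a b x) s2.
  have -> : norm2 a b x = 1 - s ^+ 2 by rewrite -s2 opprB addrC subrK.
  by field.
Qed.

End Forward.

Section Backward.
Variables (a abar : 'rV[R]_n -> 'M[R]_n) (b bbar : 'rV[R]_n -> 'rV[R]_n).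
Hypothesis data : square_data U a b.
Hypothesis sa : forall i j, smooth_on U (fun x => abar x i j).
Hypothesis sb : forall j, smooth_on U (fun x => bbar x 0 j).
Hypothesis ya : forall x, U x -> (abar x)^T = abar x.
Hypothesis pa : forall x, U x -> forall v, v != 0 -> 0 < mxform (abar x) v v.
Hypothesis aE : forall x, U x -> a x = (1 + norm2 abar bbar x) ^+ 2 *: abar x.
Hypothesis bE : forall x, U x ->
  b x = Num.sqrt (1 + norm2 abar bbar x) *: bbar x.

Lemma norm2_ge0 x : U x -> 0 <= norm2 abar bbar x.
Proof.
move=> Ux; rewrite /norm2 -(@sharpE _ _ U abar bbar pa x _ Ux).
have [->|/(pa Ux)/ltW//] := eqVneq (sharp abar bbar x) 0.
by rewrite -(scale0r (0 : 'rV[R]_n)) mxformZl mul0r.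
Qed.

(** The same cancellation read backwards: here the differential of the factor
    [1 + B] is a multiple of [bbar] because [bbar] is closed and conformal. *)
Theorem square_decomposition_hamel x (t : R) : U x ->
  metric_flat_at abar x -> closed_at bbar x -> conformal_at abar bbar x t ->
  forall y, y != 0 -> forall v, hamel_form a b x y v = 0.
Proof.
move=> Ux flat curl0 conf; have oU := sq_open data.
have k0 z : U z -> 0 < 1 + norm2 abar bbar z.
  by move=> Uz; rewrite ltr_pwDl// norm2_ge0.
have eE v : mxform (abar x) (sharp abar bbar x) v = rowform (bbar x) v.
  exact: (@sharpE _ _ U abar bbar pa x _ Ux).
have eE' v : mxform (abar x) v (sharp abar bbar x) = rowform (bbar x) v.
  by rewrite (mxformC _ _ (ya Ux)).
pose dc w := 2 * t * rowform (bbar x) w.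
have hc w : is_derive x w (fun z => 1 + norm2 abar bbar z) (dc w).
  have := is_derive_add (is_derive_cst (1 : R) x w)
    (is_derive_norm oU sa sb ya pa w Ux curl0).
  by move=> /is_derive_eq; apply; rewrite conf eE /dc; ring.
pose s := Num.sqrt (1 + norm2 abar bbar x).
have s0 : s != 0 by rewrite sqrtr_eq0 -ltNge k0.
have s2 : 1 + norm2 abar bbar x = s ^+ 2 by rewrite sqr_sqrtr// ltW// k0.
pose dh w := t / s * rowform (bbar x) w.
have hh w : is_derive x w (fun z => Num.sqrt (1 + norm2 abar bbar z)) (dh w).
  have := is_derive_sqrt (f := fun z => 1 + norm2 abar bbar z) (k0 x Ux) (hc w).
  by move=> /is_derive_eq; apply; rewrite -/s /dh /dc; field.
have sN : smooth_on U (norm2 abar bbar) by exact: smooth_norm.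
have s1N : smooth_on U (fun z => 1 + norm2 abar bbar z).
  by apply: smoothD => //; exact: smooth_cst.
have sS : smooth_on U (fun z => Num.sqrt (1 + norm2 abar bbar z)).
  exact: smooth_sqrt.
have dx (f : 'rV[R]_n -> R) : smooth_on U f -> differentiable f x.
  by move=> sf; exact: (sf [::]).
have c0 : 1 + norm2 abar bbar x != 0 by rewrite gt_eqF// k0.
have ua : abar x \in unitmx by exact: (unit_a pa Ux).
have da i j := dx _ (sa i j); have db j := dx _ (sb j).
have NE : norm2 abar bbar x = s ^+ 2 - 1 by rewrite -s2 addrC addKr.
apply: (hamel_sufficient data Ux (t := t / s ^+ 3)).
- move=> u v; rewrite (curl_conformal oU Ux bE db hh (dx _ sS)) curl0 /dh.
  by field.
- move=> y; rewrite (sym_cov_conformal oU Ux c0 aE bE da db hc hh (dx _ s1N)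
    (dx _ sS) ua) conf !eE' /flat_quadratic.
  rewrite (sharp_conformal Ux c0 aE bE ua) rowformZr aE// bE//.
  rewrite !rowformZl mxform_scalemx -/(norm2 abar bbar x) -/s /dc /dh.
  by rewrite -/(norm2 abar bbar x) s2 NE; field.
- move=> y y0; have [k hk] := flat y y0.
  exists (k + 4 * (s ^+ 2)^-1 * dc y) => v.
  rewrite (metric_spray_conformal oU Ux aE da hc (dx _ s1N)) hk aE// bE//.
  by rewrite rowformZl !mxform_scalemx -/s s2 /dc; field.
Qed.

End Backward.

Section Riemannian.
Variables (a : 'rV[R]_n -> 'M[R]_n).
Hypothesis oU : open U.
Hypothesis sa : forall i j, smooth_on U (fun x => a x i j).
Hypothesis ya : forall x, U x -> (a x)^T = a x.
Hypothesis pa : forall x, U x -> forall v, v != 0 -> 0 < mxform (a x) v v.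

(** A Riemannian metric is the square metric whose 1-form is zero. *)
Theorem riemannian_straightP :
  geodesics_straight (alpha_of a) U <-> forall x, U x -> metric_flat_at a x.
Proof.
pose z0 : 'rV[R]_n -> 'rV[R]_n := fun=> 0.
have rf0 w : rowform (0 : 'rV[R]_n) w = 0 by rewrite /rowform mul0mx mxE.
have data : square_data U a z0.
  split=> //; first by move=> j; exact: smooth_cst.
  move=> x _; rewrite /z0 -(scale0r (0 : 'rV[R]_n)) mxformZl mul0r.
  exact: ltr01.
have -> : alpha_of a = square_fun a z0.
  apply/funext => x; apply/funext => y; rewrite /square_fun rf0 addr0.
  have [->|al0] := eqVneq (alpha_of a x y) 0; first by rewrite invr0 mulr0.
  by rewrite expr2 mulfK.
have Dz w x : Drow z0 x w = 0.
  apply/rowP => j; rewrite [RHS]mxE DrowE big1// => k _.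
  have -> : partial k (fun z => z0 z 0 j) x = partial k (fun=> 0) x.
    by apply: near_eq_partial; near=> z; rewrite mxE.
  by rewrite /partial (derive_cst (0 : R)) mulr0.
have curl0 x : closed_at z0 x by move=> u v; rewrite /curl !Dz !rf0 subrr.
have sc0 x y : sym_cov a z0 x y y = 0 * flat_quadratic a z0 x y.
  rewrite mul0r /sym_cov !Dz !rf0 /sharp mul0mx -(scale0r (0 : 'rV[R]_n)).
  by rewrite DmxZ !(mxformZr, mxform_scalemx); ring.
split=> [straight x Ux y y0|flat].
  have hamx v : v != 0 -> forall w, hamel_form a z0 x v w = 0.
    by move=> v0; apply/(hamelP data Ux v0)/(straight_squareP data).1.
  have [k hk] := hamel_spray data Ux hamx y0 (sc0 x).
  by exists k => v; rewrite -hk mulr0 !mul0r addr0.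
apply/(straight_squareP data) => x y Ux y0; apply/(hamelP data Ux y0).
apply: (hamel_sufficient data Ux (curl0 x) (sc0 x)) => // {y0} {}y y0.
have [k hk] := flat x Ux y y0.
by exists k => v; rewrite hk mulr0 !mul0r addr0.
Unshelve. all: by end_near. Qed.

End Riemannian.

End ChartEquations.

(** * Changes of coordinates *)

Section Clairaut.
Context {R : realType} {n : nat}.
Variable U : set 'rV[R]_n.
Hypothesis oU : open U.

(** Two applications of the mean value theorem evaluate the second difference
    of [f] on a small square of side [s] with sides along the [i]-th and
    [j]-th axes. *)
Lemma second_difference (f : 'rV[R]_n -> R) (x : 'rV[R]_n) (r s : R) i j :
  smooth_on U f -> ball x r `<=` U -> 0 < s -> 2 * s < r ->
  exists2 z, ball x r z &
    f (x + s *: delta_mx 0 i + s *: delta_mx 0 j) - f (x + s *: delta_mx 0 i)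
      - (f (x + s *: delta_mx 0 j) - f x)
    = s * (s * partial j (partial i f) z).
Proof.
move=> sf xrU s0 sr.
set u : 'rV[R]_n := delta_mx 0 i; set v : 'rV[R]_n := delta_mx 0 j.
have n1 k : `|(delta_mx 0 k : 'rV[R]_n)| <= 1.
  apply/mx_norm_leP => // p q; rewrite mxE ord1 eqxx/=.
  by case: eqP => _; rewrite ?normr1// normr0.
have near (t t' : R) : 0 <= t <= 1 -> 0 <= t' <= 1 ->
    ball x r (x + t *: (s *: u) + t' *: (s *: v)).
  move=> /andP[t0 t1] /andP[t'0 t'1].
  rewrite -ball_normE /ball_/= -addrA opprD addNKr normrN.
  apply: le_lt_trans (ler_normD _ _) _; rewrite !scalerA !normrZ.
  rewrite !ger0_norm ?mulr_ge0 ?(ltW s0)//.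
  have h1 : t * s * `|u| <= s.
    by apply: le_trans (ler_piMr _ (n1 i)) _;
      rewrite ?mulr_ge0 ?(ltW s0)// ler_piMl// ltW.
  have h2 : t' * s * `|v| <= s.
    by apply: le_trans (ler_piMr _ (n1 j)) _;
      rewrite ?mulr_ge0 ?(ltW s0)// ler_piMl// ltW.
  by move: h1 h2; lra.
have df z : ball x r z -> differentiable f z by move=> /xrU /(sf [::]).
have shift (w z : 'rV[R]_n) : differentiable f (z + w) ->
    differentiable (fun z => f (z + w)) z.
  by move=> d; apply: (differentiable_comp (f := fun z => z + w) (g := f)).
have b01 : 0 <= (1 : R) <= 1 by rewrite ler01 lexx.
have b00 : 0 <= (0 : R) <= 1 by rewrite ler01 lexx.
have near1 (t : R) : 0 <= t <= 1 -> ball x r (x + t *: (s *: u)).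
  by move=> ht; have := near t 0 ht b00; rewrite scale0r addr0.
have near2 (t : R) : 0 <= t <= 1 -> ball x r (x + t *: (s *: u) + s *: v).
  by move=> ht; have := near t 1 ht b01; rewrite scale1r.
have [|t t01 e1] := @mean_value_line _ _ (fun z => f (z + s *: v) - f z) x (s *: u).
  move=> t ht; apply: differentiableB; last by apply: df; exact: near1.
  by apply: shift; apply: df; exact: near2.
have [|t' t'01 e2] := @mean_value_line _ _ (partial i f) (x + t *: (s *: u)) (s *: v).
  by move=> t' ht'; apply: (sf [:: i]); apply: xrU; exact: near.
exists (x + t *: (s *: u) + t' *: (s *: v)); first exact: near.
rewrite [LHS]e1.
have DZ (g : 'rV[R]_n -> R) z k : differentiable g z ->
    'D_(s *: delta_mx 0 k) g z = s * partial k g z.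
  by move=> dg; rewrite /partial !deriveE// linearZ.
rewrite DZ; last first.
  apply: differentiableB; last by apply: df; exact: near1.
  by apply: shift; apply: df; exact: near2.
congr (_ * _); rewrite -DZ; last first.
  by apply: (sf [:: i]); apply: xrU; exact: near.
rewrite -e2 /partial.
have d2 : is_derive (x + t *: (s *: u)) u (fun z => f (z + s *: v))
    (partial i f (x + t *: (s *: u) + s *: v)).
  have dz : differentiable f (x + t *: (s *: u) + s *: v).
    by apply: df; exact: near2.
  split; first by apply: diff_derivable; exact: (shift (s *: v)).
  rewrite /partial /derive /=.
  have -> // : (fun h : R => h^-1 *: (f (h *: u + (x + t *: (s *: u)) + s *: v)
      - f (x + t *: (s *: u) + s *: v))) =
    (fun h : R => h^-1 *: (f (h *: u + (x + t *: (s *: u) + s *: v))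
      - f (x + t *: (s *: u) + s *: v))).
  by apply/funext => h; rewrite [h *: u + (_ + s *: v)]addrA.
have d1 : is_derive (x + t *: (s *: u)) u f (partial i f (x + t *: (s *: u))).
  by apply: is_derive_partial; apply: df; exact: near1.
by have [_ ->] := is_derive_sub d2 d1.
Qed.

Let dist_le_of_half (e X1 X2 P1 P2 : R) : P1 = P2 -> `|X1 - P2| < e / 2 ->
  `|X2 - P1| < e / 2 -> `|X1 - X2| <= e.
Proof.
move=> -> k1 k2; have -> : X1 - X2 = (X1 - P2) - (X2 - P2) by ring.
by apply: le_trans (ler_normB _ _) _; move: k1 k2; lra.
Qed.

(** The second difference does not depend on the order of the axes, and both
    second derivatives are continuous. *)
Lemma partialC (f : 'rV[R]_n -> R) (x : 'rV[R]_n) i j :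
  smooth_on U f -> U x -> partial i (partial j f) x = partial j (partial i f) x.
Proof.
move=> sf Ux; apply/eqP; rewrite -subr_eq0 -normr_le0.
apply/ler_addgt0Pl => _/posnumP[e]; rewrite addr0.
have cont k l : {for x, continuous (partial k (partial l f))}.
  by apply: differentiable_continuous; exact: (sf [:: k; l]).
have e2 : 0 < e%:num / 2 by rewrite divr_gt0.
have near_U : \forall z \near x, U z by exact: open_nbhs_nbhs.
have /cvgrPdist_lt /(_ _ e2) near_ij := cont i j.
have /cvgrPdist_lt /(_ _ e2) near_ji := cont j i.
have /nbhs_ballP[r /= r0 hr] : nbhs x (U `&`
    ([set z | `|partial i (partial j f) x - partial i (partial j f) z|
        < e%:num / 2]
     `&` [set z | `|partial j (partial i f) x - partial j (partial i f) z|
        < e%:num / 2])).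
  exact: (filterI near_U (filterI near_ij near_ji)).
pose s := r / 4; have s0 : 0 < s by rewrite divr_gt0.
have sr : 2 * s < r by rewrite /s; lra.
have rU : ball x r `<=` U by move=> z /hr[].
have [z1 /hr[_ [_ h1]] e1] := second_difference i j sf rU s0 sr.
have [z2 /hr[_ [h2 _]] e2'] := second_difference j i sf rU s0 sr.
have zz : partial j (partial i f) z1 = partial i (partial j f) z2.
  apply: (mulfI (lt0r_neq0 s0)); apply: (mulfI (lt0r_neq0 s0)).
  apply: (etrans (esym e1)); apply: etrans e2'; clear.
  rewrite (addrAC x).
  move: (f (_ + _ + _)) (f (_ + _)) (f (_ + _)) (f x) => A B C D.
  by ring.
exact: dist_le_of_half zz h2 h1.
Qed.

End Clairaut.

Section ChainRule.
Context {R : realType} {n m : nat}.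
Implicit Types (f : 'rV[R]_n -> 'rV[R]_m) (x w : 'rV[R]_n).

Lemma differentiable_rV f x :
  (forall j, differentiable (fun z => f z 0 j) x) -> differentiable f x.
Proof.
move=> df.
have -> : f = \sum_(j < m) (fun z => f z 0 j *: (delta_mx 0 j : 'rV[R]_m)).
  by apply/funext => z; rewrite fct_sumE -row_sum_delta.
by apply: differentiable_sum => j; exact: differentiableZl.
Qed.

Lemma jacobianE f x i j : differentiable f x ->
  'J f x i j = partial i (fun z => f z 0 j) x.
Proof.
move=> df; rewrite /jacobian /lin1_mx mxE -deriveE// derive_mx ?mxE//.
exact: diff_derivable.
Qed.

Lemma is_derive_comp_rV f (g : 'rV[R]_m -> R) x w : differentiable f x ->
  differentiable g (f x) ->
  is_derive x w (fun z => g (f z)) (\sum_p (w *m 'J f x) 0 p * partial p g (f x)).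
Proof.
move=> df dg; have dgf : differentiable (g \o f) x by exact: differentiable_comp.
split; first exact: diff_derivable.
rewrite -derive_sum_partial// -deriveEjacobian// (deriveE _ dgf).
by rewrite (deriveE _ dg) (deriveE _ df) diff_comp.
Qed.

End ChainRule.

Section ChangeOfCoordinates.
Context {R : realType} {n : nat}.
Variables (V W : set 'rV[R]_n) (f : 'rV[R]_n -> 'rV[R]_n).
Variables (a a' : 'rV[R]_n -> 'M[R]_n) (b b' : 'rV[R]_n -> 'rV[R]_n).
Hypotheses (oV : open V) (oW : open W).
Hypothesis fVW : forall z, V z -> W (f z).
Hypothesis smooth_f : forall j, smooth_on V (fun z => f z 0 j).
Hypothesis smooth_a : forall i j, smooth_on V (fun z => a z i j).
Hypothesis smooth_b : forall j, smooth_on V (fun z => b z 0 j).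
Hypothesis smooth_a' : forall i j, smooth_on W (fun z => a' z i j).
Hypothesis smooth_b' : forall j, smooth_on W (fun z => b' z 0 j).
Hypothesis sym_a' : forall z, W z -> (a' z)^T = a' z.
Hypothesis unit_a : forall z, V z -> a z \in unitmx.
Hypothesis aE : forall z, V z -> a z = 'J f z *m a' (f z) *m ('J f z)^T.
Hypothesis bE : forall z, V z -> b z = b' (f z) *m ('J f z)^T.
Implicit Types (x y u v w : 'rV[R]_n).

Lemma jacobian_unit x : V x -> 'J f x \in unitmx.
Proof. by move=> Vx; have := unit_a Vx; rewrite aE// !unitmx_mul => /andP[/andP[]]. Qed.

Lemma sharp_change x : V x -> sharp a b x *m 'J f x = sharp a' b' (f x).
Proof.
move=> Vx; have uJ := jacobian_unit Vx; have := unit_a Vx.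
rewrite /sharp aE// bE// !unitmx_mul => /andP[/andP[_ ua'] uJT].
have -> : invmx ('J f x *m a' (f x) *m ('J f x)^T) =
    invmx ('J f x)^T *m (invmx (a' (f x)) *m invmx ('J f x)).
  have uM : 'J f x *m a' (f x) *m ('J f x)^T \in unitmx.
    by rewrite !unitmx_mul uJ ua'.
  apply: (can_inj (mulKmx uM)); rewrite mulmxV// !mulmxA.
  by rewrite mulmxK// mulmxK// mulmxV.
by rewrite !mulmxA mulmxK// mulmxKV.
Qed.

Lemma mxform_change x u v : V x ->
  mxform (a x) u v = mxform (a' (f x)) (u *m 'J f x) (v *m 'J f x).
Proof. by move=> Vx; rewrite /mxform aE// trmx_mul !mulmxA. Qed.

Lemma rowform_change x v : V x ->
  rowform (b x) v = rowform (b' (f x)) (v *m 'J f x).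
Proof. by move=> Vx; rewrite /rowform bE// trmx_mul !mulmxA. Qed.

Lemma norm2_change x : V x -> norm2 a b x = norm2 a' b' (f x).
Proof. by move=> Vx; rewrite /norm2 rowform_change// sharp_change. Qed.

(** The second differential of the change of coordinates, as a bilinear map. *)
Definition hessian x u w : 'rV[R]_n :=
  \row_p \sum_i u 0 i * \sum_k w 0 k * partial k (partial i (fun z => f z 0 p)) x.

Lemma hessianC x u w : V x -> hessian x u w = hessian x w u.
Proof.
move=> Vx; apply/rowP => p; rewrite !mxE.
under eq_bigr do rewrite mulr_sumr.
rewrite exchange_big/=; apply: eq_bigr => k _; rewrite mulr_sumr.
apply: eq_bigr => i _; rewrite (partialC oV i k (smooth_f p) Vx); ring.
Qed.

Let diff_f x : V x -> differentiable f x.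
Proof. by move=> Vx; apply: differentiable_rV => j; exact: (smooth_f j [::]). Qed.

Lemma is_derive_mul_jacobian x u w p : V x ->
  is_derive x w (fun z => (u *m 'J f z) 0 p) (hessian x u w 0 p).
Proof.
move=> Vx; rewrite mxE.
have := is_derive_bigsum (fun i => is_derive_mull (u 0 i)
   (is_derive_sum_partial w (smooth_f p [:: i] Vx))).
apply: near_eq_is_derive; apply: (open_near oV Vx) => z Vz.
by rewrite mxE; apply: eq_bigr => i _; rewrite jacobianE//; exact: diff_f.
Qed.

Lemma Dmx_change x u v w : V x -> mxform (Dmx a x w) u v =
  mxform (Dmx a' (f x) (w *m 'J f x)) (u *m 'J f x) (v *m 'J f x)
  + mxform (a' (f x)) (hessian x u w) (v *m 'J f x)
  + mxform (a' (f x)) (u *m 'J f x) (hessian x v w).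
Proof.
move=> Vx; have da i j : differentiable (a ^~ i ^~ j) x.
  exact: (smooth_a i j [::]).
apply: is_derive_unique (is_derive_mxform w u v da) _.
have da' i j : is_derive x w (fun z => a' (f z) i j)
    (Dmx a' (f x) (w *m 'J f x) i j).
  rewrite DmxE; apply: (is_derive_comp_rV (g := fun y => a' y i j)).
    exact: diff_f.
  by apply: (smooth_a' i j [::]); exact: fVW.
have := is_derive_bigsum (fun i => is_derive_bigsum (fun j => is_derive_mul
  (is_derive_mul (is_derive_mul_jacobian u w i Vx) (da' i j))
  (is_derive_mul_jacobian v w j Vx))).
move=> h; have {h} : is_derive x w (fun z => mxform (a z) u v)
    (\sum_i \sum_j ((hessian x u w 0 i * a' (f x) i j + (u *m 'J f x) 0 i *
       Dmx a' (f x) (w *m 'J f x) i j) * (v *m 'J f x) 0 j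
       + (u *m 'J f x) 0 i * a' (f x) i j * hessian x v w 0 j)).
  apply: near_eq_is_derive h; apply: (open_near oV Vx) => z Vz.
  by rewrite mxform_change// mxformE.
move=> /is_derive_eq; apply.
rewrite !mxformE -!big_split; apply: eq_bigr => i _.
by rewrite -!big_split; apply: eq_bigr => j _ /=; ring.
Qed.

Lemma Drow_change x v w : V x -> rowform (Drow b x w) v =
  rowform (Drow b' (f x) (w *m 'J f x)) (v *m 'J f x)
  + rowform (b' (f x)) (hessian x v w).
Proof.
move=> Vx; have db j : differentiable (b ^~ 0 ^~ j) x.
  exact: (smooth_b j [::]).
apply: is_derive_unique (is_derive_rowform_base w v db) _.
have db' j : is_derive x w (fun z => b' (f z) 0 j)
    (Drow b' (f x) (w *m 'J f x) 0 j).
  rewrite DrowE; apply: (is_derive_comp_rV (g := fun y => b' y 0 j)).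
    exact: diff_f.
  by apply: (smooth_b' j [::]); exact: fVW.
have := is_derive_bigsum (fun j => is_derive_mul (db' j)
  (is_derive_mul_jacobian v w j Vx)).
move=> h; have {h} : is_derive x w (fun z => rowform (b z) v)
    (\sum_j (Drow b' (f x) (w *m 'J f x) 0 j * (v *m 'J f x) 0 j
       + b' (f x) 0 j * hessian x v w 0 j)).
  apply: near_eq_is_derive h; apply: (open_near oV Vx) => z Vz.
  by rewrite rowform_change// rowformE.
by move=> /is_derive_eq; apply; rewrite !rowformE -big_split.
Qed.

Lemma curl_change x u v : V x ->
  curl b x u v = curl b' (f x) (u *m 'J f x) (v *m 'J f x).
Proof.
move=> Vx; rewrite /curl (Drow_change v u Vx) (Drow_change u v Vx).
by rewrite (hessianC u v Vx) opprD addrACA subrr addr0.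
Qed.

(** The second differential enters the Christoffel symbols and the derivative
    of the 1-form in the same way, so that the covariant derivative is a
    tensor. *)
Lemma sym_cov_change x u v : V x ->
  sym_cov a b x u v = sym_cov a' b' (f x) (u *m 'J f x) (v *m 'J f x).
Proof.
move=> Vx; have sa := sym_a' (fVW Vx); rewrite /sym_cov.
set e := sharp a b x; set e' := sharp a' b' (f x).
rewrite (Drow_change v u Vx) (Drow_change u v Vx) (Dmx_change v e u Vx).
rewrite (Dmx_change u e v Vx) (Dmx_change u v e Vx).
have -> : e *m 'J f x = e' by exact: sharp_change.
have h1 w : mxform (a' (f x)) w e' = rowform (b' (f x)) w.
  rewrite (mxformC _ _ sa) /mxform /e' /sharp mulmxKV//.
  by have := unit_a Vx; rewrite aE// !unitmx_mul => /andP[/andP[]].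
rewrite !h1 (hessianC u v Vx) (hessianC u e Vx) (hessianC v e Vx).
rewrite (mxformC (v *m _) (hessian x e u) sa).
by field.
Qed.

End ChangeOfCoordinates.

(** * Manifolds *)

Section Charts.
Context {R : realType} {n : nat} {M : manifold R n}.
Implicit Types (phi psi : chart R n M) (a : riemannian_metric M).
Implicit Types (b : one_form M).

Lemma chart_imgP phi x : chart_img phi x ->
  chart_dom phi (chart_inv phi x) /\ chart_fun phi (chart_inv phi x) = x.
Proof. by move=> [p dp <-]; rewrite (chart_funK dp). Qed.

Lemma overlap_img phi psi x : overlap phi psi x -> chart_img phi x.
Proof. by move=> [p [dp _] <-]; exists p. Qed.

Lemma transition_img phi psi x : overlap phi psi x ->
  chart_img psi (transition phi psi x).
Proof.
by move=> [p [dp dp'] <-]; rewrite /transition/= (chart_funK dp); exists p.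
Qed.

(** The inverse of a chart is continuous at interior points of its image, and
    the image is open. *)
Lemma overlap_open phi psi : open (overlap phi psi).
Proof.
rewrite openE => x xo; have [p [dp dp'] px] := xo.
have ximg : chart_img phi x := overlap_img xo.
have oimg : open (chart_img phi) by exact: chart_img_open.
have cinv : {for x, continuous (chart_inv phi)}.
  have := @chart_inv_continuous R n M phi; rewrite -/(chart_img phi).
  by rewrite continuous_open_subspace// => /(_ x); apply; rewrite inE.
have near_img : \forall z \near x, chart_img phi z by exact: open_nbhs_nbhs.
have near_psi : \forall z \near x, chart_dom psi (chart_inv phi z).
  apply: cinv; apply: open_nbhs_nbhs; split; first exact: chart_dom_open.
  by rewrite -px (chart_funK dp).
apply: filterS2 near_img near_psi => z zimg zpsi.
have [h1 h2] := chart_imgP zimg.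
by exists (chart_inv phi z).
Qed.

Lemma smooth_transition phi psi j : atlas phi -> atlas psi ->
  smooth_on (overlap phi psi) (fun x => transition phi psi x 0 j).
Proof. by move=> hphi hpsi; exact: (atlas_compatible hphi hpsi j).1. Qed.

Lemma smooth_subset (U V : set 'rV[R]_n) (f : 'rV[R]_n -> R) :
  V `<=` U -> smooth_on U f -> smooth_on V f.
Proof. by move=> VU sf s x /VU; exact: sf. Qed.

Lemma rowformC (u v : 'rV[R]_n) : rowform u v = rowform v u.
Proof. by rewrite !rowformE; apply: eq_bigr => i _; rewrite mulrC. Qed.

Lemma norm2E (A : 'rV[R]_n -> 'M[R]_n) (B : 'rV[R]_n -> 'rV[R]_n) x :
  norm2 A B x = mxform (invmx (A x)) (B x) (B x).
Proof. by rewrite /norm2 rowformC. Qed.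

Lemma metric_pos_mxform a phi x : atlas phi -> chart_img phi x ->
  forall v, v != 0 -> 0 < mxform (a phi x) v v.
Proof. by move=> hphi ximg v v0; exact: metric_pos. Qed.

Lemma metric_unitmx a phi x : atlas phi -> chart_img phi x ->
  a phi x \in unitmx.
Proof. by move=> hphi ximg; apply: posdef_unitmx; exact: metric_pos_mxform. Qed.

Lemma norm2_form_ge0 a b phi x : atlas phi -> chart_img phi x ->
  0 <= norm2 (a phi) (b phi) x.
Proof.
move=> hphi ximg; rewrite /norm2.
have -> : rowform (b phi x) (sharp (a phi) (b phi) x) =
    mxform (a phi x) (sharp (a phi) (b phi) x) (sharp (a phi) (b phi) x).
  by rewrite /mxform {2}/sharp mulmxKV// metric_unitmx.
have [->|v0] := eqVneq (sharp (a phi) (b phi) x) 0.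
  by rewrite -(scale0r (0 : 'rV[R]_n)) mxformZl mul0r.
by apply/ltW; exact: metric_pos_mxform.
Qed.

Lemma sqr_form_norm a b phi x : atlas phi -> chart_img phi x ->
  form_norm a b phi x ^+ 2 = norm2 (a phi) (b phi) x.
Proof.
move=> hphi ximg; rewrite /form_norm sqr_sqrtr -/(mxform _ _ _) -?norm2E//.
exact: norm2_form_ge0.
Qed.

Section Transformation.
Variables (a : riemannian_metric M) (b : one_form M) (phi psi : chart R n M).
Variables (x : 'rV[R]_n).
Hypotheses (hphi : atlas phi) (hpsi : atlas psi) (xo : overlap phi psi x).

Let f := transition phi psi.
Let fV z : overlap phi psi z -> chart_img psi (f z) := @transition_img phi psi z.
Let oV : open (overlap phi psi) := @overlap_open phi psi.
Let sf j := smooth_transition j hphi hpsi.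
Let sub : overlap phi psi `<=` chart_img phi := @overlap_img phi psi.
Let sa i j : smooth_on (overlap phi psi) (fun z => a phi z i j).
Proof. exact: smooth_subset sub (metric_smooth a hphi i j). Qed.
Let sb j : smooth_on (overlap phi psi) (fun z => b phi z 0 j).
Proof. exact: smooth_subset sub (form_smooth b hphi j). Qed.
Let ua z : overlap phi psi z -> a phi z \in unitmx.
Proof. by move=> /sub; exact: metric_unitmx. Qed.
Let aE z (zo : overlap phi psi z) := metric_tensor a hphi hpsi zo.
Let bE z (zo : overlap phi psi z) := form_tensor b hphi hpsi zo.

Lemma norm2_transition :
  norm2 (a phi) (b phi) x = norm2 (a psi) (b psi) (f x).
Proof. exact: (norm2_change ua aE bE xo). Qed.

Lemma closed_at_transition : closed_at (b psi) (f x) -> closed_at (b phi) x.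
Proof.
move=> cl u v.
by rewrite (curl_change oV fV sf sb (form_smooth b hpsi) bE u v xo) cl.
Qed.

Lemma conformal_at_transition t :
  conformal_at (a psi) (b psi) (f x) t -> conformal_at (a phi) (b phi) x t.
Proof.
move=> cf u v.
rewrite (sym_cov_change oV fV sf sa sb (metric_smooth a hpsi)
  (form_smooth b hpsi) (Defs.metric_sym a hpsi) ua aE bE u v xo) cf.
by rewrite (mxform_change aE u v xo).
Qed.

End Transformation.

Lemma covariant_derivative_sym a b phi x i j : atlas phi -> chart_img phi x ->
  2^-1 * (covariant_derivative a b phi x i j + covariant_derivative a b phi x j i)
  = sym_cov (a phi) (b phi) x (delta_mx 0 i) (delta_mx 0 j).
Proof.
move=> hphi ximg.
have oU : open (chart_img phi) by exact: chart_img_open.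
set e := sharp (a phi) (b phi) x.
have gammaE k l : \sum_(p < n) christoffel a phi x p k l * b phi x 0 p =
    2^-1 * \sum_q e 0 q * (Dmx (a phi) x (delta_mx 0 k) l q
      + Dmx (a phi) x (delta_mx 0 l) k q - partial q (fun z => a phi z k l) x).
  under eq_bigr do rewrite /christoffel -mulrA mulr_suml.
  rewrite -mulr_sumr; congr (_ * _); rewrite exchange_big/=.
  apply: eq_bigr => q _; rewrite !Dmx_delta /e /sharp mxE mulr_suml.
  by apply: eq_bigr => p _; ring.
have sumE k l : \sum_q e 0 q * (Dmx (a phi) x (delta_mx 0 k) l q
      + Dmx (a phi) x (delta_mx 0 l) k q - partial q (fun z => a phi z k l) x) =
    mxform (Dmx (a phi) x (delta_mx 0 k)) (delta_mx 0 l) e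
    + mxform (Dmx (a phi) x (delta_mx 0 l)) (delta_mx 0 k) e
    - mxform (Dmx (a phi) x e) (delta_mx 0 k) (delta_mx 0 l).
  have mE (A : 'M[R]_n) r : mxform A (delta_mx 0 r) e = \sum_q e 0 q * A r q.
    rewrite -rowform_mulmx rowformC rowformE -rowE.
    by apply: eq_bigr => q _; rewrite [X in _ * X]mxE.
  rewrite !mE mxform_delta DmxE -big_split -sumrB.
  apply: eq_bigr => q _ /=; ring.
have sD w : (Dmx (a phi) x w)^T = Dmx (a phi) x w.
  exact: (Dmx_sym w oU ximg (Defs.metric_sym a hphi)).
rewrite /covariant_derivative !gammaE !sumE /sym_cov -/e !rowform_delta.
rewrite !Drow_delta (mxformC (delta_mx 0 j) (delta_mx 0 i) (sD e)).
by field.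
Qed.

Lemma bilinear_delta (f g : 'rV[R]_n -> 'rV[R]_n -> R) :
  (forall k u v w, f (k *: u + v) w = k * f u w + f v w) ->
  (forall k u v w, f w (k *: u + v) = k * f w u + f w v) ->
  (forall k u v w, g (k *: u + v) w = k * g u w + g v w) ->
  (forall k u v w, g w (k *: u + v) = k * g w u + g w v) ->
  (forall i j, f (delta_mx 0 i) (delta_mx 0 j) = g (delta_mx 0 i) (delta_mx 0 j)) ->
  forall u v, f u v = g u v.
Proof.
move=> f1 f2 g1 g2 fg u v.
rewrite (linear_rowE (f := f ^~ v) u) => [|k p q]; last exact: f1.
rewrite (linear_rowE (f := g ^~ v) u) => [|k p q]; last exact: g1.
apply: eq_bigr => i _; congr (_ * _).
rewrite (linear_rowE (f := f _) v) => [|k p q]; last exact: f2.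
rewrite (linear_rowE (f := g _) v) => [|k p q]; last exact: g2.
by apply: eq_bigr => j _; rewrite fg.
Qed.

Lemma conformal_atP a b phi x t : atlas phi -> chart_img phi x ->
  conformal_at (a phi) (b phi) x t <->
  forall i j, 2^-1 * (covariant_derivative a b phi x i j
      + covariant_derivative a b phi x j i) = t * a phi x i j.
Proof.
move=> hphi ximg; split=> [cf i j|cf].
  by rewrite covariant_derivative_sym// cf mxform_delta.
apply: (bilinear_delta (f := sym_cov (a phi) (b phi) x)
  (g := fun u v => t * mxform (a phi x) u v)) => [k u v w|k u v w|k u v w|k u v w|i j].
- rewrite /sym_cov !(DmxD, DmxZ, DrowD, DrowZ, mxformDl, mxformZl, mxform_addmx,
    mxform_scalemx, rowformDl, rowformZl, rowformDr, rowformZr).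
  by ring.
- rewrite /sym_cov !(DmxD, DmxZ, DrowD, DrowZ, mxformDl, mxformZl, mxformDr,
    mxformZr, mxform_addmx, mxform_scalemx, rowformDl, rowformZl, rowformDr,
    rowformZr).
  by ring.
- by rewrite mxformDl mxformZl; ring.
- by rewrite mxformDr mxformZr; ring.
- by rewrite -covariant_derivative_sym// cf mxform_delta.
Qed.

Lemma closed_atP b phi x : closed_at (b phi) x <->
  forall i j, partial j (fun z => b phi z 0 i) x = partial i (fun z => b phi z 0 j) x.
Proof.
split=> [cl i j|cl].
  apply: subr0_eq; rewrite -[RHS](cl (delta_mx 0 j) (delta_mx 0 i)) /curl.
  by rewrite !rowform_delta !Drow_delta.
apply: (bilinear_delta (f := curl (b phi) x) (g := fun _ _ => 0))
  => [k u v w|k u v w|k u v w|k u v w|i j].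
- by rewrite /curl DrowD DrowZ !(rowformDl, rowformZl, rowformDr, rowformZr); ring.
- by rewrite /curl DrowD DrowZ !(rowformDl, rowformZl, rowformDr, rowformZr); ring.
- by rewrite mulr0 addr0.
- by rewrite mulr0 addr0.
- by rewrite /curl !rowform_delta !Drow_delta cl subrr.
Qed.

Lemma sym_mx_ext (A B : 'M[R]_n) : A^T = A -> B^T = B ->
  (forall y, mxform A y y = mxform B y y) -> A = B.
Proof.
move=> sA sB AB; apply/matrixP => i j; rewrite -!mxform_delta.
set u := delta_mx 0 i; set v := delta_mx 0 j.
have := AB (u + v); rewrite !(mxformDl, mxformDr) (mxformC v u sA).
by rewrite (mxformC v u sB) !AB; lra.
Qed.

End Charts.

(** * The decomposition on a manifold *)

Section Decomposition.
Context {R : realType} {n : nat} {M : manifold R n}.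
Variables (alpha : riemannian_metric M) (beta : one_form M).
Hypothesis hbeta : forall phi, atlas phi -> forall x, chart_img phi x ->
  form_norm alpha beta phi x < 1.

Lemma square_data_chart phi : atlas phi ->
  square_data (chart_img phi) (alpha phi) (beta phi).
Proof.
move=> hphi; split.
- exact: chart_img_open.
- exact: metric_smooth.
- exact: form_smooth.
- exact: Defs.metric_sym.
- by move=> x ximg; exact: metric_pos_mxform.
- move=> x ximg; rewrite -norm2E -sqr_form_norm//.
  by rewrite expr_lt1// ?hbeta// sqrtr_ge0.
Qed.

Let N phi := norm2 (alpha phi) (beta phi).
Let abar_comp phi z := (1 - N phi z) ^+ 2 *: alpha phi z.
Let bbar_comp phi z := Num.sqrt (1 - N phi z) *: beta phi z.

Let kappa_gt0 phi x : atlas phi -> chart_img phi x -> 0 < 1 - N phi x.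
Proof.
move=> hphi ximg; rewrite subr_gt0.
exact: (rowform_sharp_lt1 (square_data_chart hphi)).
Qed.

Let smooth_kappa phi : atlas phi ->
  smooth_on (chart_img phi) (fun z => 1 - N phi z).
Proof.
move=> hphi; have oU : open (chart_img phi) by exact: chart_img_open.
apply: smoothD => //; first exact: smooth_cst.
apply: smoothN => //; apply: smooth_norm => //.
- exact: metric_smooth.
- exact: form_smooth.
- by move=> x ximg; exact: metric_pos_mxform.
Qed.

Let abar_smooth phi : atlas phi -> forall i j,
  smooth_on (chart_img phi) (fun x => abar_comp phi x i j).
Proof.
move=> hphi i j; have oU : open (chart_img phi) by exact: chart_img_open.
apply: (@smooth_ext _ _ _
    (fun x => (1 - N phi x) * (1 - N phi x) * alpha phi x i j)).
  by move=> x; rewrite mxE expr2.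
apply: smoothM => //; last exact: metric_smooth.
by apply: smoothM => //; exact: smooth_kappa.
Qed.

Let abar_sym phi : atlas phi -> forall x, chart_img phi x ->
  (abar_comp phi x)^T = abar_comp phi x.
Proof. by move=> hphi x ximg; rewrite linearZ/= Defs.metric_sym. Qed.

Let abar_pos phi : atlas phi -> forall x, chart_img phi x ->
  forall y : 'rV[R]_n, y != 0 -> 0 < (y *m abar_comp phi x *m y^T) 0 0.
Proof.
move=> hphi x ximg y y0; rewrite -/(mxform _ _ _) mxform_scalemx mulr_gt0//.
  by rewrite exprn_gt0// kappa_gt0.
exact: metric_pos.
Qed.

Let abar_tensor phi psi : atlas phi -> atlas psi ->
  forall x, overlap phi psi x -> abar_comp phi x =
    'J (transition phi psi) x *m abar_comp psi (transition phi psi x)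
      *m ('J (transition phi psi) x)^T.
Proof.
move=> hphi hpsi x xo; rewrite /abar_comp -scalemxAr -scalemxAl.
by rewrite /N (norm2_transition alpha beta hphi hpsi xo) -metric_tensor.
Qed.

Let bbar_smooth phi : atlas phi -> forall i,
  smooth_on (chart_img phi) (fun x => bbar_comp phi x 0 i).
Proof.
move=> hphi i; have oU : open (chart_img phi) by exact: chart_img_open.
apply: (@smooth_ext _ _ _
    (fun x => Num.sqrt (1 - N phi x) * beta phi x 0 i)).
  by move=> x; rewrite mxE.
apply: smoothM => //; last exact: form_smooth.
apply: smooth_sqrt => //; first exact: smooth_kappa.
by move=> x; exact: kappa_gt0.
Qed.

Let bbar_tensor phi psi : atlas phi -> atlas psi ->
  forall x, overlap phi psi x -> bbar_comp phi x =
    bbar_comp psi (transition phi psi x) *m ('J (transition phi psi) x)^T.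
Proof.
move=> hphi hpsi x xo; rewrite /bbar_comp -scalemxAl.
by rewrite /N (norm2_transition alpha beta hphi hpsi xo) -form_tensor.
Qed.

(** The deformation factors are functions on the manifold, since the norm of the
    1-form does not depend on the chart; so the deformed components still
    transform as tensors. *)
Definition reduced_metric : riemannian_metric M :=
  RiemannianMetric abar_smooth abar_sym abar_pos abar_tensor.

Definition reduced_form : one_form M := OneForm bbar_smooth bbar_tensor.

Lemma sqr_reduced_norm phi x : atlas phi -> chart_img phi x ->
  1 + form_norm reduced_metric reduced_form phi x ^+ 2 = (1 - N phi x)^-1.
Proof.
move=> hphi ximg; have k0 := kappa_gt0 hphi ximg.
rewrite sqr_form_norm// /norm2 /= /sharp.
have kn0 : 1 - N phi x != 0 by rewrite gt_eqF.
have c20 : (1 - N phi x) ^+ 2 != 0 by rewrite expf_neq0.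
have ua := metric_unitmx alpha hphi ximg.
rewrite /abar_comp /bbar_comp invmxZ ?unitmxZ ?unitfE//.
rewrite -scalemxAl -scalemxAr !(rowformZl, rowformZr).
rewrite -/(sharp (alpha phi) (beta phi) x) -/(norm2 _ _ _) -/(N phi x).
have s2 : Num.sqrt (1 - N phi x) * Num.sqrt (1 - N phi x) = 1 - N phi x.
  by rewrite -expr2 sqr_sqrtr// ltW.
rewrite [X in 1 + X](_ : _ = Num.sqrt (1 - N phi x) * Num.sqrt (1 - N phi x)
    * N phi x / (1 - N phi x) ^+ 2); last by ring.
by rewrite s2; field.
Qed.

(** The chart with straight geodesics around a point gives the required
    properties there, and they are carried over to all the other charts. The
    factor of the conformal form is chosen at each point of the manifold from
    such a chart. *)
Lemma flat_square_decomposition :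
  locally_projectively_flat (square_metric alpha beta) ->
  square_decomposition alpha beta reduced_metric reduced_form.
Proof.
move=> flat.
have local phi : atlas phi ->
    geodesics_straight (square_metric alpha beta phi) (chart_img phi) ->
    forall x, chart_img phi x ->
    [/\ metric_flat_at (reduced_metric phi) x, closed_at (reduced_form phi) x &
      exists t, conformal_at (reduced_metric phi) (reduced_form phi) x t].
  move=> hphi straight x ximg.
  exact: (square_straight_decomposition (square_data_chart hphi) straight ximg).
have at_point p : exists psi, [/\ atlas psi, chart_dom psi p,
    closed_at (reduced_form psi) (chart_fun psi p) &
    exists t, conformal_at (reduced_metric psi) (reduced_form psi)
      (chart_fun psi p) t].
  have [psi [hpsi dp straight]] := flat p; exists psi.
  have pimg : chart_img psi (chart_fun psi p) by exists p.
  by have [_ cl cf] := local psi hpsi straight (chart_fun psi p) pimg.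
have over (phi psi : chart R n M) p : chart_dom phi p -> chart_dom psi p ->
    overlap phi psi (chart_fun phi p) /\
    transition phi psi (chart_fun phi p) = chart_fun psi p.
  by move=> dp dp'; split; [exists p|rewrite /transition/= (chart_funK dp)].
have conf_ex p : exists t, forall phi, atlas phi -> chart_dom phi p ->
    conformal_at (reduced_metric phi) (reduced_form phi) (chart_fun phi p) t.
  have [psi [hpsi dpsi _ [t cf]]] := at_point p; exists t => phi hphi dphi.
  have [xo xE] := over phi psi p dphi dpsi.
  by apply: (conformal_at_transition hphi hpsi xo); rewrite xE.
split.
- move=> p; have [phi [hphi dp straight]] := flat p; exists phi.
  split; [exact: hphi|exact: dp|].
  apply/(riemannian_straightP (a := reduced_metric phi)).
  + exact: chart_img_open.
  + exact: metric_smooth.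
  + exact: Defs.metric_sym.
  + by move=> x ximg; exact: metric_pos_mxform.
  + by move=> x ximg; have [] := local phi hphi straight x ximg.
- move=> phi hphi x ximg; have [dp pE] := chart_imgP ximg.
  apply: (closed_atP reduced_form phi x).1.
  have [psi [hpsi dpsi cl _]] := at_point (chart_inv phi x).
  have [] := over phi psi _ dp dpsi; rewrite pE => xo xE.
  by apply: (closed_at_transition hphi hpsi xo); rewrite xE.
- have [c hc] := choice conf_ex; exists c => phi hphi x ximg.
  have [dp pE] := chart_imgP ximg.
  apply: (conformal_atP reduced_metric reduced_form _ hphi ximg).1.
  by rewrite -{1}pE; exact: hc.
- move=> phi hphi x ximg y; rewrite sqr_reduced_norm//.
  have k0 := kappa_gt0 hphi ximg.
  rewrite /metric_fun /= -!/(mxform _ _ _) mxform_scalemx.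
  by rewrite sqrtrM ?exprn_ge0 ?ltW// sqrtr_sqr gtr0_norm// mulKf// gt_eqF.
- move=> phi hphi x ximg y; rewrite sqr_reduced_norm//.
  have k0 := kappa_gt0 hphi ximg.
  rewrite /form_fun /= -!/(rowform _ _) rowformZl mulrA -sqrtrM ?invr_ge0 ?ltW//.
  by rewrite mulVf ?gt_eqF// sqrtr1 mul1r.
Qed.

(** The chart in which the geodesics of [abar] are straight also works for the
    square metric. The components of [alpha] and [beta] are recovered from the
    two equations between functions of the direction by polarization. *)
Lemma square_decomposition_flat (abar : riemannian_metric M) (bbar : one_form M) :
  square_decomposition alpha beta abar bbar ->
  locally_projectively_flat (square_metric alpha beta).
Proof.
move=> [flat closed [c conf] aE bE] p.
have [phi [hphi dp straight]] := flat p; exists phi.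
split; [exact: hphi|exact: dp|].
have data := square_data_chart hphi.
have oU : open (chart_img phi) by exact: chart_img_open.
have pos_bar x : chart_img phi x -> forall v, v != 0 -> 0 < mxform (abar phi x) v v.
  by move=> ximg; exact: metric_pos_mxform.
have mu0 x : chart_img phi x -> 0 < 1 + norm2 (abar phi) (bbar phi) x.
  by move=> ximg; rewrite ltr_pwDl// norm2_form_ge0.
have aE' x : chart_img phi x ->
    alpha phi x = (1 + norm2 (abar phi) (bbar phi) x) ^+ 2 *: abar phi x.
  move=> ximg; apply: sym_mx_ext.
  - exact: Defs.metric_sym.
  - by rewrite linearZ/= Defs.metric_sym.
  move=> y; rewrite mxform_scalemx.
  have [->|y0] := eqVneq y 0.
    by rewrite -(scale0r (0 : 'rV[R]_n)) !mxformZl !mul0r mulr0.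
  have := congr1 (fun r => r ^+ 2) (aE phi hphi x ximg y).
  have h1 : 0 <= mxform (alpha phi x) y y.
    by apply/ltW; exact: metric_pos_mxform.
  have h2 : 0 <= mxform (abar phi x) y y by exact/ltW/pos_bar.
  by rewrite /= exprMn sqr_form_norm// !sqr_sqrtr.
have bE' x : chart_img phi x ->
    beta phi x = Num.sqrt (1 + norm2 (abar phi) (bbar phi) x) *: bbar phi x.
  move=> ximg; apply: rowform_ext => y; rewrite rowformZl.
  by have := bE phi hphi x ximg y; rewrite sqr_form_norm.
apply/(straight_squareP data) => x y ximg y0.
apply/(hamelP data ximg y0).
apply: (square_decomposition_hamel data (metric_smooth abar hphi)
  (form_smooth bbar hphi) (Defs.metric_sym abar hphi) pos_bar aE' bE'
  (t := c (chart_inv phi x))) => //.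
- move: x ximg {y y0}; apply/(riemannian_straightP (a := abar phi)) => //.
  + exact: metric_smooth.
  + exact: Defs.metric_sym.
- by apply/closed_atP => i j; exact: closed.
- by apply/(conformal_atP abar bbar _ hphi ximg) => i j; exact: conf.
Qed.

End Decomposition.

Theorem theorem3p1 (R : realType) (n : nat) (M : manifold R n)
    (alpha : riemannian_metric M) (beta : one_form M)
    (hbeta : forall phi, atlas phi -> forall x, chart_img phi x ->
       form_norm alpha beta phi x < 1) :
  (locally_projectively_flat (square_metric alpha beta) <->
   exists (abar : riemannian_metric M) (bbar : one_form M),
     square_decomposition alpha beta abar bbar) /\
  (forall (abar : riemannian_metric M) (bbar : one_form M),
     square_decomposition alpha beta abar bbar ->
     forall phi, atlas phi -> forall x, chart_img phi x ->
     forall y : 'rV[R]_n, y != 0 ->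
       square_metric alpha beta phi x y =
         (Num.sqrt (1 + form_norm abar bbar phi x ^+ 2)
            * metric_fun abar phi x y + form_fun bbar phi x y) ^+ 2
         / metric_fun abar phi x y).
Proof.
split; first split.
- move=> flat; exists (reduced_metric hbeta), (reduced_form hbeta).
  exact: flat_square_decomposition.
- by move=> [abar [bbar]]; exact: square_decomposition_flat.
move=> abar bbar [_ _ _ aE bE] phi hphi x ximg y y0.
rewrite /square_metric aE// bE//.
set m := 1 + _ ^+ 2; set al := metric_fun abar phi x y.
have m0 : 0 < m by rewrite ltr_pwDl// sqr_ge0.
have al0 : al != 0.
  by rewrite sqrtr_eq0 -ltNge; exact: (metric_pos abar hphi ximg).
have mE : m = Num.sqrt m ^+ 2 by rewrite sqr_sqrtr// ltW.
have s0 : Num.sqrt m != 0 by rewrite sqrtr_eq0 -ltNge.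
move: (Num.sqrt m) s0 mE => s s0 ->.
by field; rewrite al0 s0.
Qed.
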